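(* For all $u\in U_{\mathbb{F}}$ and $a\in A_{\mathbb{F}}$, $$ua.o\in\mathbb{A}\iff ua.o=a.o.$$
   Context: Let $\mathbb{K},\mathbb{F}$ be real closed fields with $\mathbb{K}\subseteq\mathbb{R}\cap\mathbb{F}$. Let $O\subsetneq\mathbb{F}$ be an order convex subring ($a,b\in O$ and $a\le c\le b$ imply $c\in O$); it is a valuation ring. Let $\Lambda=\mathbb{F}^\times/O^\times$, written additively, and let $v:\mathbb{F}\to\Lambda\cup\{\infty\}$ be the associated valuation, with $\Lambda$ ordered so that $(-v)(a)\ge(-v)(b)$ whenever $a\ge b>0$; thus $O=\{a:(-v)(a)\le 0\}$. For a semialgebraic set $V$ defined over $\mathbb{K}$, $V_{\mathbb{F}}$ denotes its $\mathbb{F}$-extension. $G<\operatorname{SL}_n$ is a connected semisimple algebraic group over $\mathbb{K}$, self-adjoint ($g\in G$ implies $g^{\mathsf T}\in G$). $S<G$ is a maximal $\mathbb{K}$-split torus with $s=s^{\mathsf T}$ for all $s\in S$; $A_{\mathbb{F}}$ is the $\mathbb{F}$-extension of the semialgebraic connected component of $S_{\mathbb{K}}$ containing $\operatorname{Id}$; $K_{\mathbb{F}}=G_{\mathbb{F}}\cap\operatorname{SO}_n(\mathbb{F})$. Let $\mathfrak{g}=\operatorname{Lie}(G_{\mathbb{R}})$, $\mathfrak{a}=\operatorname{Lie}(A_{\mathbb{R}})$; $\Sigma\subseteq\mathfrak{a}^\star$ is the root system of $\mathfrak{g}$ with respect to $\mathfrak{a}$, with root spaces $\mathfrak{g}_\alpha$.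 For $\alpha\in\Sigma$, $\chi_\alpha:A_{\mathbb{F}}\to\mathbb{F}_{>0}$ is the restriction of the algebraic character of $S$ over $\mathbb{K}$ which over $\mathbb{R}$ satisfies $\chi_\alpha(\exp H)=e^{\alpha(H)}$, $H\in\mathfrak{a}$. Fix a basis $\Delta$ of $\Sigma$ with positive roots $\Sigma_{>0}$; let $A^+_{\mathbb{F}}=\{a\in A_{\mathbb{F}}:\chi_\alpha(a)\ge1\ \forall\alpha\in\Delta\}$ and $U_{\mathbb{F}}=\exp(\bigoplus_{\alpha\in\Sigma_{>0}}(\mathfrak{g}_\alpha)_{\mathbb{F}})$. $G_{\mathbb{F}}$ acts on symmetric positive definite matrices of determinant $1$ over $\mathbb{F}$ by $g.x=gxg^{\mathsf T}$, and $\mathcal{X}_{\mathbb{F}}=G_{\mathbb{F}}.\operatorname{Id}$. For $x=g.\operatorname{Id}$, $y=h.\operatorname{Id}$, $\delta_{\mathbb{F}}(x,y)$ is the unique $a\in A^+_{\mathbb{F}}$ with $g^{-1}h\in K_{\mathbb{F}}aK_{\mathbb{F}}$. For $a\in A_{\mathbb{F}}$, $N_{\mathbb{F}}(a)=\prod_{\alpha\in\Sigma}\max\{\chi_\alpha(a),\chi_\alpha(a)^{-1}\}$, and $d(x,y)=(-v)(N_{\mathbb{F}}(\delta_{\mathbb{F}}(x,y)))\in\Lambda$, a $G_{\mathbb{F}}$-invariant pseudo-distance. $\mathcal{B}=\mathcal{X}_{\mathbb{F}}/\!\sim$ with $x\sim y$ iff $d(x,y)=0$, with the induced $G_{\mathbb{F}}$-action;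 $o\in\mathcal{B}$ is the class of $\operatorname{Id}$; $\mathbb{A}=A_{\mathbb{F}}.o\subseteq\mathcal{B}$ is the standard apartment. *)

(* Defs.v *)
From mathcomp Require Import all_boot all_order all_algebra.
(* The notations of mpoly clash with those of mathcomp-analysis. *)
From mathcomp Require Import -(notations) mpoly complex.
From mathcomp Require Import all_classical all_reals all_analysis.
Import Order.TTheory GRing.Theory Num.Theory.
Import numFieldNormedType.Exports.

Set Implicit Arguments.
Unset Strict Implicit.
Unset Printing Implicit Defensive.

Local Open Scope classical_set_scope.
Local Open Scope ring_scope.

Notation "'mxpoly[' L ]_ n" := (mpoly.mpoly (n * n) L)
  (at level 8, L at level 99, n at level 2, format "'mxpoly[' L ]_ n")
  : type_scope.

(* The value at g of p, a polynomial over L in the entries of an n x n matrix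
   (numbered by mxvec), after its coefficients are sent to L' by f. *)
Definition mxeval (L L' : fieldType) (f : L -> L') n
    (p : mxpoly[L]_n) (g : 'M[L']_n) : L' :=
  mpoly.mmap f (fun k => mxvec g ord0 k) p.

(* L'-points of the closed subvariety of SL_n with equations p = 0, p \in ps,
   over L. *)
Definition SLpoints (L L' : fieldType) (f : L -> L') n
    (ps : seq (mxpoly[L]_n)) : set 'M[L']_n :=
  [set g | \det g = 1 /\ forall p, p \in ps -> mxeval f p g = 0].

Section AbstractMatrixGroups.
Variables (L : fieldType) (n : nat).
Implicit Types H N : set 'M[L]_n.

Definition mx_subgroup H :=
  [/\ H 1%:M, forall g h, H g -> H h -> H (g *m h)
    & forall g, H g -> H (invmx g)].

Definition mx_normal N H :=
  N `<=` H /\ forall g x, H g -> N x -> N (g *m x *m invmx g).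

Definition mx_derived H : set 'M[L]_n :=
  [set x | forall N, mx_subgroup N ->
     (forall g h, H g -> H h -> N (g *m h *m invmx g *m invmx h)) -> N x].

Definition mx_solvable H := exists k, iter k mx_derived H = [set 1%:M].

Definition zariski_closed H := exists ps : seq (mxpoly[L]_n), H = SLpoints idfun ps.

Definition zariski_connected H :=
  forall X Y, zariski_closed X -> zariski_closed Y ->
    H = X `|` Y -> X `&` Y = set0 -> X = set0 \/ Y = set0.

End AbstractMatrixGroups.

Section AlgebraicGroups.
Variables (K : rcfType) (n : nat).
Implicit Types ps qs : seq (mxpoly[K]_n).

Definition algclosure : fieldType := complex.complex K.

(* An algebraic group over K is identified with its points over the algebraic
   closure K[i], together with equations over K. *)
Definition geom_points ps : set 'M[algclosure]_n :=
  SLpoints (@complex.real_complex K : K -> algclosure) ps.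

Definition algebraic_group ps := mx_subgroup (geom_points ps).

(* The radical is trivial: it contains every closed connected solvable normal
   subgroup. *)
Definition semisimple ps :=
  forall N : set 'M[algclosure]_n, mx_normal N (geom_points ps) ->
    mx_subgroup N -> zariski_closed N -> zariski_connected N ->
    mx_solvable N -> N = [set 1%:M].

Definition self_adjoint ps :=
  forall g, geom_points ps g -> geom_points ps g^T.

(* Closed, connected, and diagonalizable over K. *)
Definition split_torus qs :=
  [/\ algebraic_group qs, zariski_connected (geom_points qs)
    & exists2 P : 'M[K]_n, P \in unitmx &
        forall s, geom_points qs s ->
          is_diag_mx (map_mx (@complex.real_complex K : K -> algclosure) P *m s *m
            invmx (map_mx (@complex.real_complex K : K -> algclosure) P))].

Definition maximal_split_torus ps qs :=
  [/\ split_torus qs, geom_points qs `<=` geom_points ps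
    & forall ts, split_torus ts -> geom_points ts `<=` geom_points ps ->
        geom_points qs `<=` geom_points ts -> geom_points ts = geom_points qs].

(* Multiplicative on S and equal to 1 at the identity, hence nowhere 0 on S. *)
Definition alg_character qs (chi : mxpoly[K]_n) :=
  let ev := mxeval (@complex.real_complex K : K -> algclosure) chi in
  ev 1%:M = 1 /\
  forall s t, geom_points qs s -> geom_points qs t -> ev (s *m t) = ev s * ev t.

End AlgebraicGroups.

(* A list of systems (ps, qs) of polynomials describes the union over the
   systems of the sets { p = 0 for p in ps, q > 0 for q in qs }. *)
Definition sa_desc (K : rcfType) n := seq (seq (mxpoly[K]_n) * seq (mxpoly[K]_n)).

Definition sa_points (K L : rcfType) (f : K -> L) n (D : sa_desc K n) :
    set 'M[L]_n :=
  [set g | exists2 s, s \in D &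
     (forall p, p \in s.1 -> mxeval f p g = 0) /\
     (forall q, q \in s.2 -> 0 < mxeval f q g)].

(* The F-extension of a subset V of M_n(L) which is semialgebraic and defined
   over K; by Tarski's transfer principle all descriptions of V agree. *)
Definition sa_extension (K L F : rcfType) (f : K -> L) (g : K -> F) n
    (V : set 'M[L]_n) : set 'M[F]_n :=
  [set x | exists2 D : sa_desc K n, V = sa_points f D & sa_points g D x].

Section SemialgebraicConnectedness.
Variables (K : rcfType) (n : nat).
Implicit Types V C : set 'M[K]_n.

Definition semialgebraic V := exists D : sa_desc K n, V = sa_points idfun D.

Definition closed_in V C :=
  C `<=` V /\ forall x, V x ->
    (forall e : K, 0 < e ->
       exists2 y, C y & forall i j, `|x i j - y i j| < e) -> C x.

Definition sa_connected V := semialgebraic V /\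
  forall C1 C2, semialgebraic C1 -> semialgebraic C2 ->
    closed_in V C1 -> closed_in V C2 -> C1 `&` C2 = set0 -> C1 `|` C2 = V ->
    C1 = V \/ C2 = V.

Definition sa_component V (x : 'M[K]_n) : set 'M[K]_n :=
  [set y | exists C, [/\ sa_connected C, C `<=` V, C x & C y]].

End SemialgebraicConnectedness.

(* The L-points of A, L being an extension of K along f. *)
Definition Apoints (K L : rcfType) (f : K -> L) n (qs : seq (mxpoly[K]_n)) :
    set 'M[L]_n :=
  sa_extension idfun f (sa_component (SLpoints idfun qs) 1%:M).

Definition Kpoints (K L : rcfType) (f : K -> L) n (ps : seq (mxpoly[K]_n)) :
    set 'M[L]_n :=
  [set k | SLpoints f ps k /\ k *m k^T = 1%:M /\ \det k = 1].

Definition mxexp (R : realType) n (X : 'M[R]_n) : 'M[R]_n :=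
  \matrix_(i, j) limn (fun N : nat => \sum_(k < N) (X ^+ k) i j / k`!%:R).

(* The exponential of a nilpotent matrix (whose n-th power vanishes). *)
Definition nilexp (F : fieldType) n (X : 'M[F]_n) : 'M[F]_n :=
  \sum_(k < n) (k`!%:R)^-1 *: X ^+ k.

(* The subspace consisting of the X with exp(tX) in H for all t; it exists
   whenever H is a closed subgroup of GL_n(R). *)
Definition Lie (R : realType) n (H : set 'M[R]_n) : {vspace 'M[R]_n} :=
  xget 0%VS [set W : {vspace 'M[R]_n} |
    forall X, X \in W <-> forall t : R, H (mxexp (t *: X))].

Section Roots.
Variables (R : realType) (K : rcfType) (iR : K -> R) (n : nat).
Variables (ps qs : seq (mxpoly[K]_n)).

Definition lieG : {vspace 'M[R]_n} := Lie (SLpoints iR ps).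
Definition lieA : {vspace 'M[R]_n} := Lie (Apoints iR qs).

Definition root_space (alpha : 'Hom(subvs_of lieA, R^o)) : set 'M[R]_n :=
  [set X | X \in lieG /\ forall H : subvs_of lieA,
     vsval H *m X - X *m vsval H = (alpha H : R) *: X].

Definition roots : set 'Hom(subvs_of lieA, R^o) :=
  [set alpha | alpha != 0 /\ exists2 X, X != 0 & root_space alpha X].

Definition root_basis (Delta : seq 'Hom(subvs_of lieA, R^o)) :=
  [/\ basis_of fullv Delta, forall alpha, alpha \in Delta -> roots alpha
    & forall beta, roots beta -> exists c : 'I_(size Delta) -> nat,
        beta = \sum_(i < size Delta) Delta`_i *+ c i \/
        beta = - \sum_(i < size Delta) Delta`_i *+ c i].

Definition positive_roots (Delta : seq 'Hom(subvs_of lieA, R^o)) :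
    set 'Hom(subvs_of lieA, R^o) :=
  [set beta | roots beta /\ exists c : 'I_(size Delta) -> nat,
     beta = \sum_(i < size Delta) Delta`_i *+ c i].

(* A character of S over K with value exp(alpha(H)) at exp(H). Only its
   restriction to S is determined by alpha, not the polynomial. *)
Definition root_char (alpha : 'Hom(subvs_of lieA, R^o)) : mxpoly[K]_n :=
  xget 0 [set chi : mxpoly[K]_n | alg_character qs chi /\
    forall H : subvs_of lieA, mxeval iR chi (mxexp (vsval H)) = expR (alpha H)].

End Roots.
Arguments roots {R K} iR {n} ps qs.
Arguments root_space {R K iR n} ps {qs} alpha.
Arguments positive_roots {R K iR n} ps {qs} Delta.

Section Valuation.
Variables (F : rcfType) (O : {pred F}).

Definition order_convex_subring :=
  subring_closed O /\
  forall a b c : F, a \in O -> b \in O -> a <= c <= b -> c \in O.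

Definition Ounits : set F := [set e | [/\ e != 0, e \in O & e^-1 \in O]].

(* The group Lambda = F^* / O^*, whose elements are the cosets a O^*. *)
Definition Lambda := set F.

Definition Ocoset (a : F) : Lambda := [set a * e | e in Ounits].

Definition Lambda0 : Lambda := Ocoset 1.

(* -v on F^*: Lambda is written additively, so that the opposite of the class
   v(a) of a is the class of a^-1. *)
Definition negv (a : F) : Lambda := Ocoset a^-1.

End Valuation.

Section Building.
Variables (R : realType) (K F : rcfType) (iR : K -> R) (iF : K -> F).
Variables (O : {pred F}) (n : nat) (ps qs : seq (mxpoly[K]_n)).

Local Notation dual := 'Hom(subvs_of (lieA iR qs), R^o).
Variable Delta : seq dual.

Definition chi (alpha : dual) (a : 'M[F]_n) : F :=
  mxeval iF (root_char alpha) a.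

Definition Aplus : set 'M[F]_n :=
  [set a | Apoints iF qs a /\ forall alpha, alpha \in Delta -> 1 <= chi alpha a].

Definition Upoints : set 'M[F]_n :=
  [set u | exists2 X : dual -> 'M[F]_n,
     (forall alpha, positive_roots ps Delta alpha ->
        sa_extension iR iF (root_space ps alpha) (X alpha)) &
     u = nilexp (\sum_(alpha \in positive_roots ps Delta) X alpha)].

Definition act (g x : 'M[F]_n) : 'M[F]_n := g *m x *m g^T.

Definition symspace : set 'M[F]_n := [set act g 1%:M | g in SLpoints iF ps].

(* The a in A^+ with g^-1 h in K a K for x = g.Id, y = h.Id; it exists and is
   unique by the Cartan decomposition, so the default Id of xget is not used. *)
Definition delta (x y : 'M[F]_n) : 'M[F]_n :=
  xget 1%:M [set a | Aplus a /\
    exists g h k k', [/\ SLpoints iF ps g /\ SLpoints iF ps h,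
      x = act g 1%:M, y = act h 1%:M, Kpoints iF ps k /\ Kpoints iF ps k'
      & invmx g *m h = k *m a *m k']].

Definition Nprod (a : 'M[F]_n) : F :=
  \big[*%R/1]_(alpha \in roots iR ps qs) Num.max (chi alpha a) (chi alpha a)^-1.

Definition dist (x y : 'M[F]_n) : Lambda F := negv O (Nprod (delta x y)).

(* Points of the building are the classes of x ~ y iff dist x y = 0. *)
Definition bclass (x : 'M[F]_n) : set 'M[F]_n :=
  [set y | symspace y /\ dist x y = Lambda0 O].

Definition building : set (set 'M[F]_n) := [set bclass x | x in symspace].

(* The induced action g.[x] = [g.x]: G acts by isometries, so that the image of
   the class of x under g is the class of g.x. *)
Definition bact (g : 'M[F]_n) (p : set 'M[F]_n) : set 'M[F]_n :=
  [set act g x | x in p].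

Definition base_point : set 'M[F]_n := bclass 1%:M.

Definition apartment : set (set 'M[F]_n) :=
  [set bact a base_point | a in Apoints iF qs].

End Building.

(* Main.v *)
(* Write o for the base point and O for the valuation ring. Over R, the Cartan
   decomposition G = K A^+ K is obtained by maximizing tr(k Y k^T H) over the
   compact group K, where g g^T = exp(2Y) and H is a dominant regular element of
   Lie(A): the first order condition makes k Y k^T commute with H, the second
   order one makes it dominant, and the maximality of S puts it into Lie(A). By
   Tarski's transfer principle the decomposition holds over F. As the entries of
   an element of A^+ are bounded by powers of the values of the simple roots,
   it follows that o = { h h^T : h in G_F with entries in O }.

   Suppose now that u a.o = b.o with b in A_F, and put g = b^-1 u a. Then g g^T
   has entries in O, hence so has g, whose rows have squared norms in O. In
   coordinates over K diagonalizing S and ordered by the weights at a dominant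
   point, u is unitriangular, so that the diagonal entries of g are those of
   c = b^-1 a. These lie in O as K is archimedean; thus c and c^-1 have entries in
   O, c.o = o and u a.o = b.o = b c.o = a.o. *)

(* The maximality of S is a statement over K, where a positive definite z has no logarithm and no
   one-parameter group. It is exploited with a single z of G commuting with S: the monomial
   relations valid on the monoid generated by S and z cut out a torus between S and G. This torus is
   connected, hence a competitor of S, because the lattice of relations is saturated: on S by
   connectedness, at z because a positive number with a trivial power is 1. A saturated lattice
   splits off, so that an idempotent integer matrix E has the torus as its fixed points. Only then
   does transfer carry the result to R, where it is applied to the matrices exp(tY) written as Gram
   matrices w w^T.

   Three objects are chosen with a default value, and each default has to be met: Lie(G) is 0 if no
   subspace has the defining property, and then there are no roots; the polynomial of a character is
   0 if there is none, and then the base point is empty; [delta] falls back on Id. *)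
Require Import Defs.
From HB Require Import structures.
From mathcomp Require Import all_boot all_order all_fingroup all_algebra.
From mathcomp Require Import -(notations) mpoly complex.
From mathcomp Require Import all_classical all_reals all_analysis.
From mathcomp Require Import ring lra.
From mathcomp Require qe_rcf qe_rcf_th.
Import Order.TTheory GRing.Theory Num.Theory.
Import numFieldNormedType.Exports.

Set Implicit Arguments.
Unset Strict Implicit.
Unset Printing Implicit Defensive.

Local Open Scope classical_set_scope.
Local Open Scope ring_scope.

(** * Transfer between real closed fields *)

(* The quantifier elimination of qe_rcf commutes with the extension of the
   coefficients along f, so that a formula over K and its quantifier-free form
   are equivalent in all real closed extensions of K at once. *)
Section MapTerms.
Import qe_rcf.
Variables (K L : rcfType) (f : {rmorphism K -> L}).

Fixpoint mapT (t : term K) : term L :=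
  match t with
  | Var x => Var L x
  | Const c => Const (f c)
  | NatConst n => NatConst L n
  | Add u v => Add (mapT u) (mapT v)
  | Opp u => Opp (mapT u)
  | NatMul u n => NatMul (mapT u) n
  | Mul u v => Mul (mapT u) (mapT v)
  | Exp u n => Exp (mapT u) n
  end.

Fixpoint mapF (p : formula K) : formula L :=
  match p with
  | Bool b => Bool b
  | Equal x y => Equal (mapT x) (mapT y)
  | Lt x y => Lt (mapT x) (mapT y)
  | Le x y => Le (mapT x) (mapT y)
  | And p q => And (mapF p) (mapF q)
  | Or p q => Or (mapF p) (mapF q)
  | Implies p q => Implies (mapF p) (mapF q)
  | Not p => Not (mapF p)
  end.

Local Notation mapP := (map mapT).

(** The combinators of [qe_rcf] are in continuation-passing style. The continuation [k] consumes
    data over K and [k'] the image data over L, so commutation is assumed for this pair; the lemmas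
    below have the same shape. *)
Lemma mapF_Size p k k' : (forall n, mapF (k n) = k' n) ->
  mapF (Size p k) = Size (mapP p) k'.
Proof.
elim: p k k' => [|c p IH] k k' kk' //=.
by apply: IH => -[|n] //=; rewrite /If /= ?kk' ?rmorph0.
Qed.

Lemma mapF_Isnull p k k' : (forall b, mapF (k b) = k' b) ->
  mapF (Isnull p k) = Isnull (mapP p) k'.
Proof. by move=> kk'; apply: mapF_Size => n. Qed.

Lemma mapF_LtSize p q k k' : (forall b, mapF (k b) = k' b) ->
  mapF (LtSize p q k) = LtSize (mapP p) (mapP q) k'.
Proof. by move=> kk'; apply: mapF_Size => n; apply: mapF_Size => m. Qed.

Lemma mapF_LeadCoef p k k' : (forall t, mapF (k t) = k' (mapT t)) ->
  mapF (LeadCoef p k) = LeadCoef (mapP p) k'.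
Proof.
elim: p k k' => [|c p IH] k k' kk' /=; first by rewrite kk' /= rmorph0.
by apply: IH => t; rewrite /If /= !kk'.
Qed.

Lemma map_AmulXn a n : mapP (AmulXn a n) = AmulXn (mapT a) n.
Proof. by elim: n => //= n ->; rewrite rmorph0. Qed.

Lemma map_AddPoly p q : mapP (AddPoly p q) = AddPoly (mapP p) (mapP q).
Proof. by elim: p q => [|a p IH] [|b q] //=; rewrite IH. Qed.

Lemma map_ScalPoly c p : mapP (ScalPoly c p) = ScalPoly (mapT c) (mapP p).
Proof. by rewrite /ScalPoly -!map_comp; apply: eq_map. Qed.

Lemma map_MulPoly p q : mapP (MulPoly p q) = MulPoly (mapP p) (mapP q).
Proof.
by elim: p => [|a p IH] //=; rewrite map_AddPoly map_ScalPoly /= IH.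
Qed.

Lemma map_ExpPoly p n : mapP (ExpPoly p n) = ExpPoly (mapP p) n.
Proof.
rewrite /ExpPoly; case: n => [|n] //; rewrite !iteropS.
by elim: n => [|n IH] //=; rewrite map_MulPoly IH.
Qed.

Lemma map_OppPoly p : mapP (OppPoly p) = OppPoly (mapP p).
Proof. by rewrite /OppPoly map_ScalPoly /= rmorphN1. Qed.

Lemma map_NatMulPoly n p : mapP (NatMulPoly n p) = NatMulPoly n (mapP p).
Proof. by rewrite /NatMulPoly map_ScalPoly. Qed.

Lemma map_Deriv p : mapP (Deriv p) = Deriv (mapP p).
Proof. by elim: p => //= a p IH; rewrite map_AddPoly /= IH. Qed.

Definition map_OpPoly := (map_AmulXn, map_AddPoly, map_ScalPoly, map_MulPoly,
  map_ExpPoly, map_OppPoly, map_NatMulPoly, map_Deriv).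

Lemma mapF_Rediv_rec_loop q sq cq c qq r n k k' :
  (forall c qq r, mapF (k (c, qq, r)) = k' (c, mapP qq, mapP r)) ->
  mapF (Rediv_rec_loop q sq cq c qq r n k) =
  Rediv_rec_loop (mapP q) sq (mapT cq) c (mapP qq) (mapP r) n k'.
Proof.
elim: n c qq r k k' => [|n IH] c qq r k k' kk' /=;
  apply: mapF_Size => m; case: ifP => // _; apply: mapF_LeadCoef => t.
  by rewrite kk' !map_OpPoly.
by rewrite (IH _ _ _ _ k') // !map_OpPoly.
Qed.

Lemma mapF_Rediv p q k k' :
  (forall c qq r, mapF (k (c, qq, r)) = k' (c, mapP qq, mapP r)) ->
  mapF (Rediv p q k) = Rediv (mapP p) (mapP q) k'.
Proof.
move=> kk'; apply: mapF_Isnull => -[]; first by rewrite kk' /= rmorph0.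
apply: mapF_Size => n; apply: mapF_Size => m; apply: mapF_LeadCoef => t.
by rewrite (mapF_Rediv_rec_loop _ _ _ _ _ _ _ kk') /= rmorph0.
Qed.

Lemma mapF_Rmod p q k k' : (forall r, mapF (k r) = k' (mapP r)) ->
  mapF (Rmod p q k) = Rmod (mapP p) (mapP q) k'.
Proof. by move=> kk'; apply: mapF_Rediv => c qq r; apply: kk'. Qed.

Lemma mapF_Rscal p q k k' : (forall n, mapF (k n) = k' n) ->
  mapF (Rscal p q k) = Rscal (mapP p) (mapP q) k'.
Proof. by move=> kk'; apply: mapF_Rediv => c qq r; apply: kk'. Qed.

Lemma mapF_Rgcd_loop n p q k k' : (forall r, mapF (k r) = k' (mapP r)) ->
  mapF (Rgcd_loop n p q k) = Rgcd_loop n (mapP p) (mapP q) k'.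
Proof.
elim: n p q k k' => [|n IH] p q k k' kk' /=;
  apply: mapF_Rmod => r; apply: mapF_Isnull => -[] //=.
exact: IH.
Qed.

Lemma mapF_Rgcd p q k k' : (forall r, mapF (k r) = k' (mapP r)) ->
  mapF (Rgcd p q k) = Rgcd (mapP p) (mapP q) k'.
Proof.
move=> kk'; apply: mapF_LtSize => -[]; apply: mapF_Isnull => -[] //;
  by apply: mapF_Size => n; apply: mapF_Rgcd_loop.
Qed.

Lemma mapF_BigRgcd ps k k' : (forall r, mapF (k r) = k' (mapP r)) ->
  mapF (BigRgcd ps k) = BigRgcd (map mapP ps) k'.
Proof.
elim: ps k k' => [|p ps IH] k k' kk' /=; first by rewrite kk' /= rmorph0.
by apply: IH => r; apply: mapF_Rgcd.
Qed.

Lemma mapF_Changes s k k' : (forall n, mapF (k n) = k' n) ->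
  mapF (Changes s k) = Changes (mapP s) k'.
Proof.
elim: s k k' => [|a s IH] k k' kk' //=.
apply: IH => n; rewrite /If /= !kk'.
by have -> : mapT (head 0%qfT s) = head 0%qfT (mapP s) by case: s.
Qed.

Lemma mapF_SeqPInfty ps k k' : (forall s, mapF (k s) = k' (mapP s)) ->
  mapF (SeqPInfty ps k) = SeqPInfty (map mapP ps) k'.
Proof.
elim: ps k k' => [|p ps IH] k k' kk' /=; first by rewrite kk'.
by apply: mapF_LeadCoef => t; apply: IH => s; rewrite kk'.
Qed.

Lemma mapF_SeqMInfty ps k k' : (forall s, mapF (k s) = k' (mapP s)) ->
  mapF (SeqMInfty ps k) = SeqMInfty (map mapP ps) k'.
Proof.
elim: ps k k' => [|p ps IH] k k' kk' /=; first by rewrite kk'.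
apply: mapF_LeadCoef => t; apply: mapF_Size => n; apply: IH => s.
by rewrite kk' /= rmorphN1.
Qed.

Lemma mapF_ChangesPoly ps k k' : (forall n, mapF (k n) = k' n) ->
  mapF (ChangesPoly ps k) = ChangesPoly (map mapP ps) k'.
Proof.
move=> kk'; apply: mapF_SeqMInfty => s; apply: mapF_SeqPInfty => s'.
by apply: mapF_Changes => n; apply: mapF_Changes => m; apply: kk'.
Qed.

Lemma mapF_NextMod p q k k' : (forall r, mapF (k r) = k' (mapP r)) ->
  mapF (NextMod p q k) = NextMod (mapP p) (mapP q) k'.
Proof.
move=> kk'; apply: mapF_LeadCoef => t; apply: mapF_Rscal => n.
by apply: mapF_Rmod => r; rewrite kk' map_ScalPoly.
Qed.

Lemma mapF_ModsAux p q n k k' : (forall s, mapF (k s) = k' (map mapP s)) ->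
  mapF (ModsAux p q n k) = ModsAux (mapP p) (mapP q) n k'.
Proof.
elim: n p q k k' => [|n IH] p q k k' kk' /=; first by rewrite kk'.
apply: mapF_Isnull => -[]; first by rewrite kk'.
by apply: mapF_NextMod => r; apply: IH => s; rewrite kk'.
Qed.

Lemma mapF_Mods p q k k' : (forall s, mapF (k s) = k' (map mapP s)) ->
  mapF (Mods p q k) = Mods (mapP p) (mapP q) k'.
Proof.
by move=> kk'; apply: mapF_Size => n; apply: mapF_Size => m; apply: mapF_ModsAux.
Qed.

Lemma map_PolyComb sq sc : mapP (PolyComb sq sc) = PolyComb (map mapP sq) sc.
Proof.
rewrite /PolyComb size_map; elim: (iota 0 (size sq)) => //= i s IH.
rewrite map_MulPoly map_ExpPoly IH; congr (MulPoly (ExpPoly _ _) _).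
by elim: sq i {s IH} => [|p sq IH] [|i] //=.
Qed.

Lemma map_Pcq sq i : mapP (Pcq sq i) = Pcq (map mapP sq) i.
Proof.
rewrite /Pcq size_map; elim: (qe_rcf_th.sg_tab _) i => [|s l IH] [|i] //=.
exact: map_PolyComb.
Qed.

Lemma mapF_TaqR p q k k' : (forall n, mapF (k n) = k' n) ->
  mapF (TaqR p q k) = TaqR (mapP p) (mapP q) k'.
Proof.
move=> kk'; rewrite /TaqR /bind_def -map_Deriv -map_MulPoly.
by apply: mapF_Mods => s; apply: mapF_ChangesPoly.
Qed.

Lemma mapF_TaqsR p sq i k k' : (forall t, mapF (k t) = k' (mapT t)) ->
  mapF (TaqsR p sq i k) = TaqsR (mapP p) (map mapP sq) i k'.
Proof.
move=> kk'; rewrite /TaqsR /bind_def -map_Pcq.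
by apply: mapF_TaqR => n; rewrite kk' /= rmorph_int.
Qed.

(** From n = 2 on these constants are entries of the inverse of an integer matrix, computed in the
    field; a field morphism commutes with the inversion and fixes the integers. The smaller n are
    given by explicit lists. *)
Lemma map_Coefs n i : mapT (Coefs K n i) = Coefs L n i.
Proof.
rewrite /Coefs /=; congr Const; case: n => [|[|n]]; first by rewrite rmorph_nat.
  by case: i => [|[|[|i]]] /=; rewrite ?nth_nil ?(rmorph0, fmorphV, rmorph_nat).
rewrite /qe_rcf_th.coefs.
have [si|si] := leqP (3 ^ n.+2)%N i.
  by rewrite !nth_default ?rmorph0 // size_map -cardE card_ord.
have sz : (i < size (enum 'I_(3 ^ n.+2)))%N by rewrite -cardE card_ord.
have nm (T : nmodType) (g : 'I_(3 ^ n.+2) -> T) :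
    [seq g j | j <- enum 'I_(3 ^ n.+2)]`_i =
    g (nth (Ordinal si) (enum 'I_(3 ^ n.+2)) i) by apply: nth_map.
rewrite !nm.
set M := qe_rcf_th.ctmat _.
have -> : map_mx intr M = map_mx f (map_mx intr M).
  by rewrite -map_mx_comp; apply: eq_map_mx => z /=; rewrite rmorph_int.
rewrite -map_invmx.
by rewrite !castmxE !mxE.
Qed.

Lemma mapF_CcountWeak p sq k k' : (forall t, mapF (k t) = k' (mapT t)) ->
  mapF (CcountWeak p sq k) = CcountWeak (mapP p) (map mapP sq) k'.
Proof.
rewrite /CcountWeak size_map -[NatConst L 0]/(mapT (NatConst K 0)).
move: (NatConst K 0); elim: (3 ^ size sq)%N k k' => [|i IH] k k' t kk' //=.
by apply: mapF_TaqsR => x; rewrite (IH _ k') // -map_Coefs.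
Qed.

Lemma map_BoundingPoly sq : mapP (BoundingPoly sq) = BoundingPoly (map mapP sq).
Proof.
rewrite /BoundingPoly map_Deriv; congr Deriv.
by elim: sq => //= p sq IH; rewrite map_MulPoly IH.
Qed.

Lemma mapF_CcountGt0 sp sq :
  mapF (CcountGt0 sp sq) = CcountGt0 (map mapP sp) (map mapP sq).
Proof.
apply: mapF_BigRgcd => p; apply: mapF_Isnull => -[] /=; last first.
  by apply: mapF_CcountWeak.
rewrite /bind_def -map_BoundingPoly; apply: mapF_CcountWeak => t /=.
congr (Or _ (Or _ _)).
  elim: sq => //= q sq ->; congr (And _ _).
  exact: mapF_LeadCoef.
elim: sq => //= q sq ->; congr (And _ _).
by apply: mapF_Size => n; apply: mapF_LeadCoef.
Qed.

Lemma map_abstrX i t : mapP (abstrX i t) = abstrX i (mapT t).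
Proof.
elim: t => //=.
- by move=> n; case: ifP.
- by move=> u IHu v IHv; rewrite map_AddPoly IHu IHv.
- by move=> u IHu; rewrite map_OppPoly IHu.
- by move=> u IHu n; rewrite map_NatMulPoly IHu.
- by move=> u IHu v IHv; rewrite map_MulPoly IHu IHv.
- by move=> u IHu n; rewrite map_ExpPoly IHu.
Qed.

End MapTerms.

(** * Elimination of one quantifier, uniformly in the extension field *)

Section Elimination.
Variable K : rcfType.

(** A system of equations t = 0 and strict inequalities t > 0: the shape for which
    [qe_rcf.CcountGt0] decides the existence of a solution in one variable. *)
Definition clause := (seq (qe_rcf.term K) * seq (qe_rcf.term K))%type.

Definition eval_clause (L : rcfType) (f : {rmorphism K -> L}) (e : seq L)
    (c : clause) : bool :=
  all (fun t => qe_rcf.eval e (mapT f t) == 0) c.1 &&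
  all (fun t => 0 < qe_rcf.eval e (mapT f t)) c.2.

Definition eval_dnf (L : rcfType) (f : {rmorphism K -> L}) (e : seq L)
    (d : seq clause) : bool := has (eval_clause f e) d.

Lemma eval_dnf_and (d1 d2 : seq clause) :
  exists d, forall (L : rcfType) (f : {rmorphism K -> L}) (e : seq L),
  @eval_dnf L f e d = eval_dnf f e d1 && eval_dnf f e d2.
Proof.
exists [seq (c1.1 ++ c2.1, c1.2 ++ c2.2) | c1 <- d1, c2 <- d2] => L f e.
rewrite /eval_dnf; elim: d1 => //= c1 d1 IH.
rewrite has_cat IH andb_orl; congr (_ || _); rewrite has_map.
elim: d2 {IH} => /= [|c2 d2 ->]; first by rewrite andbF.
rewrite andb_orr; congr (_ || _).
by rewrite /eval_clause /= !all_cat -!andbA; do !bool_congr.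
Qed.

Lemma eval_dnf_or (d1 d2 : seq clause) :
  exists d, forall (L : rcfType) (f : {rmorphism K -> L}) (e : seq L),
  @eval_dnf L f e d = eval_dnf f e d1 || eval_dnf f e d2.
Proof. by exists (d1 ++ d2) => L f e; rewrite /eval_dnf has_cat. Qed.

(** The boolean b carries negations down to the atoms, where a negated or weak comparison is split
    into equations and strict inequalities. The same [d] has to serve in all extensions. *)
Lemma dnf_exists (p : qe_rcf.formula K) (b : bool) :
  exists d, forall (L : rcfType) (f : {rmorphism K -> L}) (e : seq L),
  @eval_dnf L f e d = (qe_rcf.qf_eval e (mapF f p) == b).
Proof.
elim: p b => [c|t u|t u|t u|p IHp q IHq|p IHp q IHq|p IHp q IHq|p IHp] b.
- exists (if c == b then [:: ([::], [::])] else [::]) => L f e /=.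
  by case: (c == b).
- pose s := qe_rcf.Add t (qe_rcf.Opp u).
  exists (if b then [:: ([:: s], [::])] else
    [:: ([::], [:: s]); ([::], [:: qe_rcf.Opp s])]) => L f e.
  case: b; rewrite /eval_dnf /eval_clause /= ?(andbT, orbF) ?eqb_id ?subr_eq0 //.
  by rewrite eqbF_neg oppr_gt0 subr_gt0 subr_lt0 -neq_lt eq_sym.
- pose s := qe_rcf.Add t (qe_rcf.Opp u).
  exists (if b then [:: ([::], [:: qe_rcf.Opp s])] else
    [:: ([:: s], [::]); ([::], [:: s])]) => L f e.
  case: b; rewrite /eval_dnf /eval_clause /= ?(andbT, orbF) ?eqb_id.
    by rewrite oppr_gt0 subr_lt0.
  by rewrite eqbF_neg -leNgt subr_eq0 subr_gt0 le_eqVlt eq_sym.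
- pose s := qe_rcf.Add t (qe_rcf.Opp u).
  exists (if b then [:: ([:: s], [::]); ([::], [:: qe_rcf.Opp s])] else
    [:: ([::], [:: s])]) => L f e.
  case: b; rewrite /eval_dnf /eval_clause /= ?(andbT, orbF) ?eqb_id.
    by rewrite oppr_gt0 subr_lt0 subr_eq0 le_eqVlt.
  by rewrite eqbF_neg -ltNge subr_gt0.
- have [d1 h1] := IHp b; have [d2 h2] := IHq b.
  have [d3 h3] := eval_dnf_and d1 d2; have [d4 h4] := eval_dnf_or d1 d2.
  exists (if b then d3 else d4) => L f e.
  case: b h1 h2 => h1 h2; rewrite ?h3 ?h4 h1 h2 /=;
  by case: (qe_rcf.qf_eval _ _); case: (qe_rcf.qf_eval _ _).
- have [d1 h1] := IHp b; have [d2 h2] := IHq b.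
  have [d3 h3] := eval_dnf_and d1 d2; have [d4 h4] := eval_dnf_or d1 d2.
  exists (if b then d4 else d3) => L f e.
  case: b h1 h2 => h1 h2; rewrite ?h3 ?h4 h1 h2 /=;
  by case: (qe_rcf.qf_eval _ _); case: (qe_rcf.qf_eval _ _).
- have [d1 h1] := IHp (~~ b); have [d2 h2] := IHq b.
  have [d3 h3] := eval_dnf_and d1 d2; have [d4 h4] := eval_dnf_or d1 d2.
  exists (if b then d4 else d3) => L f e.
  case: b h1 h2 => h1 h2; rewrite ?h3 ?h4 h1 h2 /=;
  by case: (qe_rcf.qf_eval _ _); case: (qe_rcf.qf_eval _ _).
- have [d1 h1] := IHp (~~ b); exists d1 => L f e; rewrite h1 /=.
  by case: b {h1}; case: (qe_rcf.qf_eval _ _).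
Qed.

Lemma clause_elim (i : nat) (c : clause) : exists p : qe_rcf.formula K,
  forall (L : rcfType) (f : {rmorphism K -> L}) (e : seq L), qe_rcf.qf_eval e (mapF f p) <->
    exists x : L, eval_clause f (set_nth 0 e i x) c.
Proof.
exists (qe_rcf.CcountGt0 (map (qe_rcf.abstrX i) c.1) (map (qe_rcf.abstrX i) c.2)).
move=> L f e; rewrite mapF_CcountGt0 qe_rcf.eval_CcountGt0.
rewrite -!map_comp; split.
  move=> /qe_rcf_th.ccount_gt0P[x]; rewrite !big_map !big_all => h.
  exists x; rewrite /eval_clause; congr (_ && _) : h; apply: eq_all => t /=;
  by rewrite map_abstrX qe_rcf.abstrXP.
move=> [x h]; apply/qe_rcf_th.ccount_gt0P; exists x.
rewrite !big_map !big_all; congr (_ && _) : h; apply: eq_all => t /=;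
by rewrite map_abstrX qe_rcf.abstrXP.
Qed.

Lemma exists_elim (i : nat) (p : qe_rcf.formula K) : exists q : qe_rcf.formula K,
  forall (L : rcfType) (f : {rmorphism K -> L}) (e : seq L), qe_rcf.qf_eval e (mapF f q) <->
    exists x : L, qe_rcf.qf_eval (set_nth 0 e i x) (mapF f p).
Proof.
have [d hd] := dnf_exists p true.
suff [q hq] : exists q : qe_rcf.formula K, forall (L : rcfType) (f : {rmorphism K -> L}) (e : seq L),
    qe_rcf.qf_eval e (mapF f q) <-> exists x : L, eval_dnf f (set_nth 0 e i x) d.
  exists q => L f e; rewrite hq.
  by split=> -[x h]; exists x; [rewrite hd eqb_id in h|rewrite hd eqb_id].
elim: d {hd} => [|c d [q hq]].
  by exists (qe_rcf.Bool false) => L f e; split=> // -[].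
have [r hr] := clause_elim i c.
exists (qe_rcf.Or r q) => L f e; rewrite /eval_dnf /=; split.
  case/orP => [/hr[x h]|/hq[x h]]; exists x; apply/orP; by [left|right].
case=> x /orP[h|h]; apply/orP; [left; apply/hr|right; apply/hq]; by exists x.
Qed.

End Elimination.

(** Positive elements of a real closed field are squares, so a ring morphism preserves the order.
    This is why the embeddings of the theorem carry no hypothesis on the order. *)
Lemma rcf_rmorph_gt0 (K L : rcfType) (f : {rmorphism K -> L}) (x : K) :
  (0 < f x) = (0 < x).
Proof.
have pos y : 0 < y -> 0 < f y.
  move=> y0; rewrite -(sqr_sqrtr (ltW y0)) rmorphXn exprn_even_gt0 //=.
  by rewrite fmorph_eq0 gt_eqF // sqrtr_gt0.
apply/idP/idP => [fx|]; last exact: pos.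
have [//|x0|x0] := ltrgtP 0 x; last by rewrite -x0 rmorph0 ltxx in fx.
by have := pos (- x); rewrite oppr_gt0 rmorphN oppr_gt0 => /(_ x0)/lt_gtF; rewrite fx.
Qed.

Lemma rcf_rmorph_lt (K L : rcfType) (f : {rmorphism K -> L}) :
  {mono f : x y / x < y}.
Proof. by move=> x y; rewrite -subr_gt0 -rmorphB rcf_rmorph_gt0 subr_gt0. Qed.

Lemma rcf_rmorph_le (K L : rcfType) (f : {rmorphism K -> L}) :
  {mono f : x y / x <= y}.
Proof. by move=> x y; rewrite leNgt rcf_rmorph_lt -leNgt. Qed.

(** * Definable families of properties of matrices, and the transfer principle *)

Section Definable.
Variables (K : rcfType) (n : nat).

Definition mxlist (L : rcfType) (M : 'M[L]_n) : seq L :=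
  [seq mxvec M ord0 j | j <- enum 'I_(n * n)].

Definition flat (L : rcfType) (es : seq 'M[L]_n) : seq L :=
  flatten (map (@mxlist L) es).

Lemma size_mxlist (L : rcfType) (M : 'M[L]_n) : size (mxlist M) = (n * n)%N.
Proof. by rewrite size_map size_enum_ord. Qed.

Lemma size_flat (L : rcfType) (es : seq 'M[L]_n) :
  size (flat es) = (size es * (n * n))%N.
Proof.
by elim: es => //= M es IH; rewrite /flat /= size_cat -/(flat es) IH size_mxlist mulSn.
Qed.

Lemma flat_rcons (L : rcfType) (es : seq 'M[L]_n) M :
  flat (rcons es M) = flat es ++ mxlist M.
Proof. by rewrite /flat map_rcons flatten_rcons. Qed.

Lemma mxlist_surj (L : rcfType) (s : seq L) : size s = (n * n)%N ->
  exists M : 'M[L]_n, mxlist M = s.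
Proof.
move=> ss; exists (vec_mx (\row_j nth 0 s j)).
apply: (@eq_from_nth _ 0); rewrite size_mxlist // => i ni.
rewrite (nth_map (Ordinal ni)) ?size_enum_ord // vec_mxK mxE.
by rewrite nth_enum_ord.
Qed.

Lemma nth_mxlist (L : rcfType) (M : 'M[L]_n) i j :
  nth 0 (mxlist M) (mxvec_index i j) = M i j.
Proof.
rewrite (nth_map (mxvec_index i j)) ?size_enum_ord //.
rewrite -[in RHS](mxvecE M i j); congr (mxvec M _ _).
exact: nth_ord_enum.
Qed.

Lemma nth_flat (L : rcfType) (es : seq 'M[L]_n) k i j :
  nth 0 (flat es) (k * (n * n) + mxvec_index i j) = (nth 0 es k) i j.
Proof.
elim: es k => [|M es IH] k; first by rewrite /flat /= !nth_nil mxE.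
rewrite /flat /= nth_cat size_mxlist; case: k => [|k].
  by rewrite mul0n add0n (ltn_ord (mxvec_index i j)) nth_mxlist.
by rewrite mulSn -addnA ltnNge leq_addr /= addKn IH.
Qed.

Implicit Type m : nat.

Definition def_term m
    (t : forall L : rcfType, {rmorphism K -> L} -> seq 'M[L]_n -> L) :=
  exists u : qe_rcf.term K, forall (L : rcfType) (f : {rmorphism K -> L}) es,
    size es = m -> t L f es = qe_rcf.eval (flat es) (mapT f u).

(** P is a family indexed by all real closed extensions of K at once, and a single formula over K
    has to express all its members; this uniformity is what [transfer] rests on. *)
Definition definable m
    (P : forall L : rcfType, {rmorphism K -> L} -> seq 'M[L]_n -> Prop) :=
  exists p : qe_rcf.formula K, forall (L : rcfType) (f : {rmorphism K -> L}) es,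
    size es = m -> P L f es <-> qe_rcf.qf_eval (flat es) (mapF f p).

Definition def_mx m
    (A : forall L : rcfType, {rmorphism K -> L} -> seq 'M[L]_n -> 'M[L]_n) :=
  forall i j, def_term m (fun L f es => A L f es i j).

Lemma def_const m c : def_term m (fun L f es => f c).
Proof. by exists (qe_rcf.Const c). Qed.

Lemma def_add m t u : def_term m t -> def_term m u ->
  def_term m (fun L f es => t L f es + u L f es).
Proof.
move=> [x hx] [y hy]; exists (qe_rcf.Add x y) => L f es ses /=.
by rewrite hx // hy.
Qed.

Lemma def_sub m t u : def_term m t -> def_term m u ->
  def_term m (fun L f es => t L f es - u L f es).
Proof.
move=> [x hx] [y hy]; exists (qe_rcf.Add x (qe_rcf.Opp y)) => L f es ses /=.
by rewrite hx // hy.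
Qed.

Lemma def_mul m t u : def_term m t -> def_term m u ->
  def_term m (fun L f es => t L f es * u L f es).
Proof.
move=> [x hx] [y hy]; exists (qe_rcf.Mul x y) => L f es ses /=.
by rewrite hx // hy.
Qed.

Lemma def_exp m t k : def_term m t -> def_term m (fun L f es => t L f es ^+ k).
Proof.
by move=> [x hx]; exists (qe_rcf.Exp x k) => L f es ses /=; rewrite hx.
Qed.

Lemma def_ext m t u :
  (forall L f es, t L f es = u L f es) -> def_term m t -> def_term m u.
Proof. by move=> tu [x hx]; exists x => L f es ses; rewrite -tu hx. Qed.

Lemma def_sum m I (r : seq I) t : (forall i, def_term m (t i)) ->
  def_term m (fun L f es => \sum_(i <- r) t i L f es).
Proof.
move=> ht; elim: r => [|i r IH].
  by apply: def_ext (def_const m 0) => L f es; rewrite big_nil rmorph0.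
by apply: def_ext (def_add (ht i) IH) => L f es; rewrite big_cons.
Qed.

Lemma def_prod m I (r : seq I) t : (forall i, def_term m (t i)) ->
  def_term m (fun L f es => \prod_(i <- r) t i L f es).
Proof.
move=> ht; elim: r => [|i r IH].
  by apply: def_ext (def_const m 1) => L f es; rewrite big_nil rmorph1.
by apply: def_ext (def_mul (ht i) IH) => L f es; rewrite big_cons.
Qed.

Lemma def_nth m k : def_mx m (fun L f es => nth 0 es k).
Proof.
move=> i j; exists (qe_rcf.Var K (k * (n * n) + mxvec_index i j)) => L f es _ /=.
by rewrite nth_flat.
Qed.

Lemma def_map m (A : 'M[K]_n) : def_mx m (fun L f es => map_mx f A).
Proof. by move=> i j; apply: def_ext (def_const m (A i j)) => L f es; rewrite mxE. Qed.

Lemma def_entry m A i j : def_mx m A -> def_term m (fun L f es => A L f es i j).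
Proof. exact. Qed.

Lemma def_mulmx m A B : def_mx m A -> def_mx m B ->
  def_mx m (fun L f es => A L f es *m B L f es).
Proof.
move=> hA hB i j.
apply: def_ext (def_sum _ (fun k => def_mul (hA i k) (hB k j))) => L f es.
by rewrite mxE.
Qed.

Lemma def_trmx m A : def_mx m A -> def_mx m (fun L f es => (A L f es)^T).
Proof. by move=> hA i j; apply: def_ext (hA j i) => L f es; rewrite mxE. Qed.

Lemma def_det m A : def_mx m A -> def_term m (fun L f es => \det (A L f es)).
Proof.
move=> hA; apply: def_ext (def_sum (index_enum _) (fun s : {perm 'I_n} =>
  def_mul (def_const m ((-1) ^+ s)) (def_prod (index_enum 'I_n) (fun i => hA i (s i))))) => L f es.
by apply: eq_bigr => s _; rewrite rmorphXn rmorphN1.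
Qed.

Lemma def_mxeval m A (p : mxpoly[K]_n) : def_mx m A ->
  def_term m (fun L f es => mxeval f p (A L f es)).
Proof.
move=> hA.
have hv k : def_term m (fun L f es => mxvec (A L f es) ord0 k).
  case/mxvec_indexP: k => i j.
  by apply: def_ext (hA i j) => L f es; rewrite mxvecE.
apply: def_ext (def_sum (mpoly.msupp p) (fun mu => def_mul
  (def_const m (mpoly.mcoeff mu p : K))
  (def_prod (index_enum _) (fun k => def_exp (fun_of_multinom mu k) (hv k))))) => L f es.
by [].
Qed.

Lemma definable_ext m P Q : (forall L f es, size es = m -> P L f es <-> Q L f es) ->
  definable m P -> definable m Q.
Proof. by move=> PQ [p hp]; exists p => L f es ses; rewrite -PQ // hp. Qed.

Lemma definable_eq m t u : def_term m t -> def_term m u ->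
  definable m (fun L f es => t L f es = u L f es).
Proof.
move=> [x hx] [y hy]; exists (qe_rcf.Equal x y) => L f es ses /=.
by rewrite hx // hy //; split=> /eqP.
Qed.

Lemma definable_lt m t u : def_term m t -> def_term m u ->
  definable m (fun L f es => t L f es < u L f es).
Proof.
move=> [x hx] [y hy]; exists (qe_rcf.Lt x y) => L f es ses /=.
by rewrite hx // hy.
Qed.

Lemma definable_le m t u : def_term m t -> def_term m u ->
  definable m (fun L f es => t L f es <= u L f es).
Proof.
move=> [x hx] [y hy]; exists (qe_rcf.Le x y) => L f es ses /=.
by rewrite hx // hy.
Qed.

Lemma definable_not m P : definable m P -> definable m (fun L f es => ~ P L f es).
Proof.
move=> [p hp]; exists (qe_rcf.Not p) => L f es ses /=.
by rewrite hp //; split=> /negP.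
Qed.

Lemma definable_and m P Q : definable m P -> definable m Q ->
  definable m (fun L f es => P L f es /\ Q L f es).
Proof.
move=> [p hp] [q hq]; exists (qe_rcf.And p q) => L f es ses /=.
by rewrite hp // hq //; split=> /andP.
Qed.

Lemma definable_imp m P Q : definable m P -> definable m Q ->
  definable m (fun L f es => P L f es -> Q L f es).
Proof.
move=> [p hp] [q hq]; exists (qe_rcf.Implies p q) => L f es ses /=.
by rewrite hp // hq //; split=> /implyP.
Qed.

Lemma definable_iff m P Q : definable m P -> definable m Q ->
  definable m (fun L f es => P L f es <-> Q L f es).
Proof.
move=> hP hQ; exact: definable_and (definable_imp hP hQ) (definable_imp hQ hP).
Qed.

Lemma definable_true m : definable m (fun L f es => True).
Proof. by exists (qe_rcf.Bool true). Qed.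

Lemma definable_bool m (b : bool) : definable m (fun L f es => b).
Proof. by exists (qe_rcf.Bool b). Qed.

Lemma definable_all_in m (I : eqType) (r : seq I) P :
  (forall i, definable m (P i)) ->
  definable m (fun L f es => forall i, i \in r -> P i L f es).
Proof.
move=> hP; elim: r => [|i r IH].
  by apply: definable_ext (definable_true m) => L f es ses; split.
apply: definable_ext (definable_and (hP i) IH) => L f es ses.
split=> [[Pi Pr] j|Pr]; first by rewrite inE => /orP[/eqP->//|/Pr].
by split=> [|j jr]; apply: Pr; rewrite inE ?eqxx ?jr ?orbT.
Qed.

Lemma definable_ex_in m (I : eqType) (r : seq I) P :
  (forall i, definable m (P i)) ->
  definable m (fun L f es => exists2 i, i \in r & P i L f es).
Proof.
move=> hP; apply: definable_ext (definable_not
  (definable_all_in r (fun i => definable_not (hP i)))) => L f es ses.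
split=> [|[i ir Pi]]; last by move=> /(_ i ir).
by move=> h; apply: contrapT => h'; apply: h => i ir Pi; apply: h'; exists i.
Qed.

Lemma definable_forall_fin m (I : finType) P :
  (forall i, definable m (P i)) ->
  definable m (fun L f es => forall i : I, P i L f es).
Proof.
move=> hP; apply: definable_ext (definable_all_in (enum I) hP) => L f es ses.
by split=> h i *; apply: h; rewrite ?mem_enum.
Qed.

Lemma definable_mx_eq m A B : def_mx m A -> def_mx m B ->
  definable m (fun L f es => A L f es = B L f es).
Proof.
move=> hA hB; apply: definable_ext (definable_forall_fin (fun i =>
  definable_forall_fin (fun j => definable_eq (hA i j) (hB i j)))) => L f es ses.
by split=> [h|->//]; apply/matrixP.
Qed.

Lemma definable_ex_rcons m P : definable m.+1 P ->
  definable m (fun L f es => exists M : 'M[L]_n, P L f (rcons es M)).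
Proof.
move=> [p hp].
(* A quantifier over a matrix is a block of n * n scalar quantifiers; H removes the last N of s + N
   variables one at a time. *)
have H N s : exists q : qe_rcf.formula K,
    forall (L : rcfType) (f : {rmorphism K -> L}) (e : seq L), size e = s ->
    qe_rcf.qf_eval e (mapF f q) <->
    exists2 e', size e' = N & qe_rcf.qf_eval (e ++ e') (mapF f p).
  elim: N s => [|N IH] s.
    exists p => L f e es; split=> [h|[[|//]]]; last by rewrite cats0.
    by exists [::]; rewrite // cats0.
  have [q hq] := IH s.+1; have [r hr] := exists_elim s q.
  exists r => L f e es; rewrite hr.
  have eqx x : set_nth 0 e s x = rcons e x.
    by rewrite -es; elim: (e) => //= a ? ->.
  split=> [[x]|[[//|x e'] [se'] he']].
    rewrite eqx hq ?size_rcons ?es // => -[e' se' he'].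
    by exists (x :: e'); rewrite /= ?se' // -cat_rcons.
  exists x; rewrite eqx hq ?size_rcons ?es //.
  by exists e'; rewrite // cat_rcons.
have [q hq] := H (n * n)%N (m * (n * n))%N.
exists q => L f es ses; rewrite hq ?size_flat ?ses //; split.
  move=> [M]; rewrite hp ?size_rcons ?ses // flat_rcons => h.
  by exists (mxlist M); rewrite // size_mxlist.
move=> [e' se' h]; have [M hM] := mxlist_surj se'.
by exists M; rewrite hp ?size_rcons ?ses // flat_rcons hM.
Qed.

(** The bound matrix is the last one of the environment, and [take m es] gives back the free ones.
    In this form the lemma unifies with a property written with an ordinary quantifier. *)
Lemma definable_ex m
    (Q : forall L : rcfType, {rmorphism K -> L} -> seq 'M[L]_n -> 'M[L]_n -> Prop) :
  definable m.+1 (fun L f es => Q L f (take m es) (nth 0 es m)) ->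
  definable m (fun L f es => exists M, Q L f es M).
Proof.
move=> /definable_ex_rcons; apply: definable_ext => L f es ses.
have E M : take m (rcons es M) = es /\ nth 0 (rcons es M) m = M.
  by rewrite -ses -cats1 take_size_cat // nth_cat ltnn subnn.
by split=> -[M]; have [e1 e2] := E M => h; exists M; move: h; rewrite e1 e2.
Qed.

Lemma definable_all m
    (Q : forall L : rcfType, {rmorphism K -> L} -> seq 'M[L]_n -> 'M[L]_n -> Prop) :
  definable m.+1 (fun L f es => Q L f (take m es) (nth 0 es m)) ->
  definable m (fun L f es => forall M, Q L f es M).
Proof.
move=> hQ; apply: definable_ext (definable_not
  (definable_ex (Q := fun L f es M => ~ Q L f es M) (definable_not hQ))) => L f es ses.
split=> [h M|h [M]]; last exact.
by apply: contrapT => QM; apply: h; exists M.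
Qed.

(** Nested quantifiers leave iterated [take]s around the environment, which this lemma peels off;
    beyond the cut the entry is the default matrix 0, which is definable as well. *)
Lemma def_nth_take m a k
    (T : forall L : rcfType, {rmorphism K -> L} -> seq 'M[L]_n -> seq 'M[L]_n) :
  (forall k, def_mx m (fun L f es => nth 0 (T L f es) k)) ->
  def_mx m (fun L f es => nth 0 (take a (T L f es)) k).
Proof.
move=> hT i j; have [ka|ka] := ltnP k a.
  by apply: def_ext (hT k i j) => L f es; rewrite nth_take.
apply: def_ext (def_const m 0) => L f es.
by rewrite rmorph0 nth_default ?mxE // size_take_min (leq_trans (geq_minl _ _)).
Qed.

Lemma def_zero m : def_term m (fun L f es => 0).
Proof. by apply: def_ext (def_const m 0) => L f es; rewrite rmorph0. Qed.

Lemma def_one m : def_term m (fun L f es => 1).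
Proof. by apply: def_ext (def_const m 1) => L f es; rewrite rmorph1. Qed.

Lemma def_mx1 m : def_mx m (fun L f es => 1%:M).
Proof.
by move=> i j; apply: def_ext (def_map m 1%:M i j) => L f es; rewrite map_mx1.
Qed.

Lemma definable_SLpoints m A (ps : seq (mxpoly[K]_n)) : def_mx m A ->
  definable m (fun L f es => SLpoints f ps (A L f es)).
Proof.
move=> hA; apply: definable_ext (definable_and
  (definable_eq (def_det hA) (def_const m 1))
  (definable_all_in ps (fun p =>
     definable_eq (def_mxeval p hA) (def_const m 0)))) => L f es ses.
by rewrite /SLpoints /= rmorph1 rmorph0.
Qed.

Lemma definable_sa_points m A (D : sa_desc K n) : def_mx m A ->
  definable m (fun L f es => sa_points f D (A L f es)).
Proof.
move=> hA; apply: definable_ext (definable_ex_in D (fun s => definable_and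
  (definable_all_in s.1 (fun p => definable_eq (def_mxeval p hA) (def_const m 0)))
  (definable_all_in s.2 (fun p => definable_lt (def_const m 0) (def_mxeval p hA)))))
  => L f es ses.
rewrite /sa_points /=; split=> -[s sD [h1 h2]]; exists s => //; split=> p ps.
- by rewrite h1 ?rmorph0.
- by have := h2 _ ps; rewrite rmorph0.
- by rewrite h1 ?rmorph0.
- by rewrite rmorph0; exact: h2.
Qed.

Lemma eval_map (L : rcfType) (f : {rmorphism K -> L}) (e : seq K)
    (u : qe_rcf.term K) :
  qe_rcf.eval (map f e) (mapT f u) = f (qe_rcf.eval e (mapT idfun u)).
Proof.
elim: u => //=.
- move=> i; have [si|si] := ltnP i (size e); first by rewrite (nth_map 0).
  by rewrite !nth_default ?size_map // rmorph0.
- by move=> k; rewrite rmorph_nat.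
- by move=> u -> v ->; rewrite rmorphD.
- by move=> u ->; rewrite rmorphN.
- by move=> u -> k; rewrite rmorphMn.
- by move=> u -> v ->; rewrite rmorphM.
- by move=> u -> k; rewrite rmorphXn.
Qed.

Lemma qf_eval_map (L : rcfType) (f : {rmorphism K -> L}) (e : seq K)
    (p : qe_rcf.formula K) :
  qe_rcf.qf_eval (map f e) (mapF f p) = qe_rcf.qf_eval e (mapF idfun p).
Proof.
elim: p => //=.
- by move=> u v; rewrite !eval_map (inj_eq (fmorph_inj f)).
- by move=> u v; rewrite !eval_map rcf_rmorph_lt.
- by move=> u v; rewrite !eval_map rcf_rmorph_le.
- by move=> p -> q ->.
- by move=> p -> q ->.
- by move=> p -> q ->.
- by move=> p ->.
Qed.

(** After elimination P is a quantifier-free sentence with coefficients in K, and f preserves and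
    reflects equality and order. *)
Theorem transfer P : definable 0 P ->
  forall (L : rcfType) (f : {rmorphism K -> L}), P L f [::] <-> P K idfun [::].
Proof.
move=> [p hp] L f; rewrite !hp //.
by rewrite -[flat [::] in X in X <-> _]/(map f (flat [::])) qf_eval_map.
Qed.

End Definable.

Ltac definability := repeat first
  [ apply: definable_SLpoints | apply: definable_sa_points
  | apply: definable_mx_eq | apply: definable_eq | apply: definable_lt
  | apply: definable_le | exact: definable_true | exact: definable_bool
  | apply: definable_all | apply: definable_ex
  | apply: definable_all_in => ? | apply: definable_forall_fin => ?
  | apply: definable_iff | apply: definable_and | apply: definable_not
  | apply: definable_imp
  | exact: def_nth | apply: def_nth_take => ? | exact: def_map | exact: def_mx1
  | apply: def_entry | apply: def_mulmx | apply: def_trmx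
  | exact: def_zero | exact: def_one | exact: def_const
  | apply: def_sub | apply: def_add | apply: def_mul | apply: def_exp | apply: def_det
  | apply: def_mxeval ].

(** * Characters and tori *)

Section Characters.
Variables (L : fieldType) (I : finType) (T : Type) (op : T -> T -> T) (H : set T).
Variables (chi : I -> T -> L) (x0 : T).
Hypothesis Hop : forall x y, H x -> H y -> H (op x y).
Hypothesis chiM : forall i x y, H x -> H y -> chi i (op x y) = chi i x * chi i y.
Hypothesis Hx0 : H x0.
Hypothesis chi0 : forall i, chi i x0 != 0.

(* Dedekind: distinct characters are linearly independent, so the coefficients
   of equal characters add up to 0. *)
Lemma character_sum (c v : I -> L) :
  (forall x, H x -> \sum_i c i * chi i x = 0) ->
  (forall i j, (forall x, H x -> chi i x = chi j x) -> v i = v j) ->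
  \sum_i c i * v i = 0.
Proof.
move=> sum0 vE.
pose eqv i j := `[< forall x, H x -> chi i x = chi j x >].
have cls0 i0 : \sum_(i | eqv i i0) c i = 0.
  have /(_ _)/cid h_ j : exists h, ~~ eqv j i0 -> H h /\ chi i0 h != chi j h.
    case: (boolP (eqv j i0)) => [|/asboolPn nj]; first by exists x0.
    have [h nh] : exists h, H h /\ chi i0 h != chi j h.
      apply: contrapT => nh; apply: nj => x Hx; apply/eqP; apply: contrapT => e.
      by apply: nh; exists x; split=> //; apply/negP; rewrite eq_sym.
    by exists h.
  pose h j := sval (h_ j).
  have hP j : ~~ eqv j i0 -> H (h j) /\ chi i0 (h j) != chi j (h j).
    exact: (svalP (h_ j)).
  (* Translating the relation by h_j and subtracting chi_j(h_j) times the relation itself multiplies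
     the i-th coefficient by chi_i(h_j) - chi_j(h_j). Doing this for all j outside the class of i0
     leaves only that class. *)
  have kill (J : seq I) : all (fun j => ~~ eqv j i0) J -> forall x, H x ->
      \sum_i c i * \prod_(j <- J) (chi i (h j) - chi j (h j)) * chi i x = 0.
    elim: J => [_ x Hx|j J IH /= /andP[jN JN] x Hx].
      by rewrite -[RHS](sum0 x Hx); apply: eq_bigr => i _; rewrite big_nil mulr1.
    have [Hj _] := hP _ jN.
    have := IH JN _ (Hop Hj Hx); have := IH JN _ Hx.
    set w := fun i => c i * \prod_(j <- J) (chi i (h j) - chi j (h j)).
    move=> E1 E2; rewrite -[RHS](subrr 0) -[X in _ = X - _]E2.
    rewrite -[X in _ = _ - X](mulr0 (chi j (h j))) -[X in _ * X]E1 mulr_sumr -sumrB.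
    apply: eq_bigr => i _; rewrite big_cons chiM //.
    by rewrite /w; ring.
  pose J := [seq j <- enum I | ~~ eqv j i0].
  have JN : all (fun j => ~~ eqv j i0) J by exact: filter_all.
  have := kill J JN x0 Hx0.
  rewrite (bigID (fun i => eqv i i0)) /= [X in _ + X]big1 ?addr0 => [|i iN].
    pose a := \prod_(j <- J) (chi i0 (h j) - chi j (h j)) * chi i0 x0.
    have -> : \sum_(i | eqv i i0) c i * \prod_(j <- J) (chi i (h j) - chi j (h j)) *
        chi i x0 = \sum_(i | eqv i i0) c i * a.
      apply: eq_bigr => i /asboolP ei; rewrite /a -mulrA ei //; congr (_ * (_ * _)).
      rewrite big_seq [RHS]big_seq; apply: eq_bigr => j jJ; rewrite ei //.
      by case: (hP _ (allP JN _ jJ)).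
    rewrite -mulr_suml => /eqP; rewrite mulf_eq0 => /orP[/eqP//|].
    rewrite mulf_eq0 (negbTE (chi0 _)) orbF prodf_seq_eq0 => /hasP[j jJ /=].
    by rewrite subr_eq0; case: (hP _ (allP JN _ jJ)) => _ /negbTE->.
  have iJ : i \in J by rewrite mem_filter iN mem_enum.
  by rewrite (big_rem _ iJ) /= subrr mul0r mulr0 mul0r.
(* The sum is cut into classes of equal characters; v is constant on each of them and the
   coefficients of each add up to 0. *)
rewrite (partition_big (fun i => [set j | eqv i j]%SET) xpredT) //=.
apply: big1 => A _; have [i0 /eqP Ai0|noi] := pickP (fun i => [set j | eqv i j]%SET == A).
  rewrite (eq_bigl (fun i => eqv i i0)) => [|i].
    rewrite (eq_bigr (fun i => c i * v i0)) => [|i /asboolP ei].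
      by rewrite -mulr_suml cls0 mul0r.
    by rewrite (vE _ _ ei).
  rewrite -Ai0; apply/eqP/idP => [/setP/(_ i0)|/asboolP ei].
    by rewrite !inE => ->; apply/asboolP.
  apply/setP => j; rewrite !inE; apply/asboolP/asboolP => e x Hx.
    by rewrite -ei // e.
  by rewrite ei // e.
by rewrite big_pred0.
Qed.

End Characters.

(** * Characters and monomial endomorphisms of the diagonal torus *)

Section Monomials.
Variables (L : fieldType) (n : nat).
Implicit Types (x y : 'rV[L]_n) (m k : 'rV[int]_n) (E : 'M[int]_n).

Definition zmon x m : L := \prod_i x ord0 i ^ m ord0 i.

Definition hmul x y : 'rV[L]_n := \row_i (x ord0 i * y ord0 i).

(** The endomorphism of the diagonal torus attached to an integer matrix; it pulls the character m
    back to m E ([zmon_zact]). *)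
Definition zact E x : 'rV[L]_n := \row_i zmon x (row i E).

Definition nonzero x := forall i, x ord0 i != 0.

Lemma zmonD x m k : nonzero x -> zmon x (m + k) = zmon x m * zmon x k.
Proof.
move=> x0; rewrite /zmon -big_split /=; apply: eq_bigr => i _.
by rewrite mxE expfzDr.
Qed.

Lemma zmon0 x : zmon x 0 = 1.
Proof. by apply: big1 => i _; rewrite mxE expr0z. Qed.

Lemma zmonZ x (c : int) m : zmon x (c *: m) = zmon x m ^ c.
Proof.
rewrite /zmon; under eq_bigr do rewrite mxE mulrC -exprz_exp.
by elim/big_rec2: _ => [|i y z _ ->]; rewrite ?exp1rz ?expfzMl.
Qed.

Lemma zmonN x m : zmon x (- m) = (zmon x m)^-1.
Proof. by rewrite -scaleN1r zmonZ. Qed.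

Lemma zmon_neq0 x m : nonzero x -> zmon x m != 0.
Proof. by move=> x0; apply/prodf_neq0 => i _; rewrite expfz_neq0. Qed.

Lemma zmon_sum x I (r : seq I) (F : I -> 'rV[int]_n) : nonzero x ->
  zmon x (\sum_(i <- r) F i) = \prod_(i <- r) zmon x (F i).
Proof.
move=> x0; elim: r => [|i r IH]; first by rewrite !big_nil zmon0.
by rewrite !big_cons zmonD // IH.
Qed.

Lemma zmonM x y m : zmon (hmul x y) m = zmon x m * zmon y m.
Proof.
rewrite /zmon -big_split /=; apply: eq_bigr => i _.
by rewrite mxE expfzMl.
Qed.

Lemma zmon_const1 m : zmon (const_mx 1) m = 1.
Proof. by apply: big1 => i _; rewrite mxE exp1rz. Qed.

Lemma nonzero_hmul x y : nonzero x -> nonzero y -> nonzero (hmul x y).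
Proof. by move=> x0 y0 i; rewrite mxE mulf_neq0. Qed.

Lemma nonzero_zact E x : nonzero x -> nonzero (zact E x).
Proof. by move=> x0 i; rewrite mxE zmon_neq0. Qed.

Lemma zmon_zact E x m : nonzero x -> zmon (zact E x) m = zmon x (m *m E).
Proof.
move=> x0; rewrite mulmx_sum_row zmon_sum //; apply: eq_bigr => i _.
by rewrite mxE zmonZ.
Qed.

Lemma zact_mul E E' x : nonzero x -> zact E (zact E' x) = zact (E *m E') x.
Proof.
by move=> x0; apply/rowP => i; rewrite !mxE zmon_zact // -row_mul.
Qed.

Lemma zact1 x : zact 1%:M x = x.
Proof.
apply/rowP => i; rewrite mxE /zmon (bigD1 i) //= big1 => [|j ji].
  by rewrite !mxE eqxx expr1z mulr1.
by rewrite !mxE eq_sym (negbTE ji) expr0z.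
Qed.

Lemma zmon_nat x (mu : 'I_n -> nat) :
  zmon x (\row_i Posz (mu i)) = \prod_i x ord0 i ^+ mu i.
Proof. by apply: eq_bigr => i _; rewrite mxE. Qed.

End Monomials.

Section ClosedClasses.
Variables (L : fieldType) (T : Type) (C : (T -> L) -> Prop).
Hypothesis Cconst : forall c, C (fun=> c).
Hypothesis Cadd : forall g h, C g -> C h -> C (fun x => g x + h x).
Hypothesis Cmul : forall g h, C g -> C h -> C (fun x => g x * h x).

Lemma class_sum I (r : seq I) g : (forall i, C (g i)) ->
  C (fun x => \sum_(i <- r) g i x).
Proof.
move=> hg; elim: r => [|i r IH].
  by rewrite (_ : (fun _ => _) = (fun=> 0)) //; apply/funext => x; rewrite big_nil.
rewrite (_ : (fun _ => _) = (fun x => g i x + \sum_(i <- r) g i x)); first exact: Cadd.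
by apply/funext => x; rewrite big_cons.
Qed.

Lemma class_prod I (r : seq I) g : (forall i, C (g i)) ->
  C (fun x => \prod_(i <- r) g i x).
Proof.
move=> hg; elim: r => [|i r IH].
  by rewrite (_ : (fun _ => _) = (fun=> 1)) //; apply/funext => x; rewrite big_nil.
rewrite (_ : (fun _ => _) = (fun x => g i x * \prod_(i <- r) g i x)); first exact: Cmul.
by apply/funext => x; rewrite big_cons.
Qed.

Lemma class_exp g k : C g -> C (fun x => g x ^+ k).
Proof.
move=> hg; elim: k => [|k IH]; first exact: Cconst.
rewrite (_ : (fun _ => _) = (fun x => g x * g x ^+ k)); first exact: Cmul.
by apply/funext => x; rewrite exprS.
Qed.

(** Applied below to four classes: polynomial functions of coordinates, polynomial functions of
    matrix entries, rational functions along a curve, and continuous functions. *)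
Lemma class_mxeval (K : fieldType) (f : K -> L) N (p : mxpoly[K]_N)
    (A : T -> 'M[L]_N) : (forall i j, C (fun x => A x i j)) ->
  C (fun x => mxeval f p (A x)).
Proof.
move=> hA; apply: class_sum => mu; apply: Cmul; first exact: Cconst.
apply: class_prod => k; apply: class_exp.
case/mxvec_indexP: k => i j.
rewrite (_ : (fun _ => _) = (fun x => A x i j)) //.
by apply/funext => x; rewrite mxvecE.
Qed.

Lemma class_mulmx N (A B : T -> 'M[L]_N) : (forall i j, C (fun x => A x i j)) ->
  (forall i j, C (fun x => B x i j)) -> forall i j, C (fun x => (A x *m B x) i j).
Proof.
move=> hA hB i j.
rewrite (_ : (fun _ => _) = (fun x => \sum_k A x i k * B x k j)).
  by apply: class_sum => k; apply: Cmul.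
by apply/funext => x; rewrite mxE.
Qed.

End ClosedClasses.

Section PolynomialFunctions.
Variables (L : fieldType) (n : nat).

Definition poly_fun (g : 'rV[L]_n -> L) := exists q : mpoly.mpoly n L,
  forall x, g x = mpoly.meval (fun i => x ord0 i) q.

Lemma poly_fun_ext g h : g =1 h -> poly_fun g -> poly_fun h.
Proof. by move=> gh [q hq]; exists q => x; rewrite -gh. Qed.

Lemma poly_fun_const c : poly_fun (fun=> c).
Proof. by exists (mpoly.mpolyC n c) => x; rewrite mpoly.mevalC. Qed.

Lemma poly_fun_coord i : poly_fun (fun x => x ord0 i).
Proof. by exists (mpoly.mpolyX L (mpoly.mnm1 i)) => x; rewrite mpoly.mevalXU. Qed.

Lemma poly_fun_add g h : poly_fun g -> poly_fun h -> poly_fun (fun x => g x + h x).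
Proof. by move=> [p hp] [q hq]; exists (p + q) => x; rewrite mpoly.mevalD hp hq. Qed.

Lemma poly_fun_mul g h : poly_fun g -> poly_fun h -> poly_fun (fun x => g x * h x).
Proof. by move=> [p hp] [q hq]; exists (p * q) => x; rewrite mpoly.mevalM hp hq. Qed.

Lemma poly_fun_mxeval (K : fieldType) (f : K -> L) N (p : mxpoly[K]_N)
    (A : 'rV[L]_n -> 'M[L]_N) : (forall i j, poly_fun (fun x => A x i j)) ->
  poly_fun (fun x => mxeval f p (A x)).
Proof. exact: class_mxeval poly_fun_const poly_fun_add poly_fun_mul _ _ _ _ _. Qed.

(** [character_sum] with the values at y as v: monomials that agree on H differ by a relation of H,
    and so they also agree at y. Only a monoid H is required. *)
Lemma poly_fun_zmon_vanish (g : 'rV[L]_n -> L) (H : set 'rV[L]_n) (y : 'rV[L]_n) :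
  poly_fun g -> H (const_mx 1) -> H `<=` @nonzero L n ->
  (forall x x', H x -> H x' -> H (hmul x x')) -> nonzero y ->
  (forall m, (forall x, H x -> zmon x m = 1) -> zmon y m = 1) ->
  (forall x, H x -> g x = 0) -> g y = 0.
Proof.
move=> [q hq] H1 H0 HM y0 Hy gH.
pose r := mpoly.msupp q.
pose mu (i : 'I_(size r)) : 'rV[int]_n :=
  \row_j Posz (mpoly.fun_of_multinom (nth (@mpoly.mnm0 n) r i) j).
have gE x : g x = \sum_(i < size r)
    mpoly.mcoeff (nth (@mpoly.mnm0 n) r i) q * zmon x (mu i).
  rewrite hq mpoly.mevalE (big_nth (@mpoly.mnm0 n)) big_mkord.
  by apply: eq_bigr => i _; rewrite zmon_nat.
rewrite gE; apply: (@character_sum _ _ _ (@hmul L n) H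
  (fun i x => zmon x (mu i)) (const_mx 1)) => //.
- by move=> i x x' _ _; rewrite zmonM.
- by move=> i; rewrite zmon_const1 oner_neq0.
- by move=> x Hx; rewrite -gE gH.
move=> i j ij; apply/eqP; rewrite -subr_eq0.
have /eqP : zmon y (mu i - mu j) = 1.
  apply: Hy => x Hx; rewrite zmonD ?zmonN ?ij ?mulfV ?zmon_neq0 //; exact: H0.
by rewrite zmonD // zmonN subr_eq0; move=> /eqP h;
  rewrite -[zmon y (mu j)]mul1r -h mulfVK // zmon_neq0.
Qed.

End PolynomialFunctions.

Section DiagonalConjugates.
Variables (L : fieldType) (n : nat) (P : 'M[L]_n).
Hypothesis Pu : P \in unitmx.

Definition dconj (x : 'rV[L]_n) : 'M[L]_n := invmx P *m diag_mx x *m P.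

Lemma dconj_mul x y : dconj x *m dconj y = dconj (hmul x y).
Proof.
rewrite /dconj !mulmxA mulmxK // -[_ *m diag_mx x *m _]mulmxA mulmx_diag.
by congr (_ *m diag_mx _ *m _); apply/rowP => i; rewrite !mxE.
Qed.

Lemma dconj1 : dconj (const_mx 1) = 1%:M.
Proof. by rewrite /dconj diag_const_mx mulmx1 mulVmx. Qed.

Lemma dconjK x : P *m dconj x *m invmx P = diag_mx x.
Proof. by rewrite /dconj !mulmxA mulmxV // mul1mx mulmxK. Qed.

Lemma det_dconj x : \det (dconj x) = \prod_i x ord0 i.
Proof.
rewrite /dconj !det_mulmx det_diag mulrAC det_inv mulVf ?mul1r //.
by rewrite -unitfE -unitmxE.
Qed.

Definition coords (s : 'M[L]_n) : 'rV[L]_n := \row_i (P *m s *m invmx P) i i.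

Lemma coords_dconj x : coords (dconj x) = x.
Proof. by apply/rowP => i; rewrite mxE dconjK // mxE eqxx mulr1n. Qed.

Lemma dconj_coords s : is_diag_mx (P *m s *m invmx P) -> dconj (coords s) = s.
Proof.
move=> /is_diag_mxP sd; rewrite /dconj.
have <- : P *m s *m invmx P = diag_mx (coords s).
  apply/matrixP => i j; rewrite [RHS]mxE [X in X *+ _]mxE.
  by case: eqVneq => [->|/sd->]; rewrite ?mulr1n ?mulr0n.
by rewrite !mulmxA mulVmx // mul1mx mulmxKV.
Qed.

Lemma coords_neq0 s : is_diag_mx (P *m s *m invmx P) -> \det s = 1 -> nonzero (coords s).
Proof.
move=> sd ds i; have := det_dconj (coords s); rewrite dconj_coords // ds => e.
have : \prod_i0 (coords s) ord0 i0 != 0 by rewrite -e oner_neq0.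
by move/prodf_neq0/(_ i isT).
Qed.

Lemma poly_fun_dconj i j : poly_fun (fun x => dconj x i j).
Proof.
apply: (@poly_fun_ext _ _ (fun x => \sum_k invmx P i k * x ord0 k * P k j)) => [x|].
  rewrite mxE; apply: eq_bigr => k _; congr (_ * _).
  by rewrite mul_mx_diag mxE.
apply: (class_sum (@poly_fun_const L n) (@poly_fun_add L n)) => k.
apply: poly_fun_mul; last exact: poly_fun_const.
by apply: poly_fun_mul; [exact: poly_fun_const|exact: poly_fun_coord].
Qed.

(* The monomials in the coordinates are characters of H, so by Dedekind's lemma
   an equation valid on H only depends on the relations between them. *)
Lemma torus_closure (K : fieldType) (f : K -> L) (ps : seq (mxpoly[K]_n))
    (H : set 'rV[L]_n) (y : 'rV[L]_n) :
  H (const_mx 1) -> H `<=` @nonzero L n ->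
  (forall x x', H x -> H x' -> H (hmul x x')) -> nonzero y ->
  (forall m, (forall x, H x -> zmon x m = 1) -> zmon y m = 1) ->
  (forall x, H x -> SLpoints f ps (dconj x)) -> SLpoints f ps (dconj y).
Proof.
move=> H1 H0 HM y0 Hy Hps.
have prodE (x : 'rV[L]_n) : \prod_i x ord0 i = zmon x (const_mx 1).
  by apply: eq_bigr => i _; rewrite mxE expr1z.
split=> [|p pps].
  rewrite det_dconj prodE; apply: Hy => x Hx.
  by rewrite -prodE -det_dconj; case: (Hps _ Hx).
apply: (poly_fun_zmon_vanish (g := fun x => mxeval f p (dconj x)) (H := H)) => //.
  by apply: poly_fun_mxeval => i j; exact: poly_fun_dconj.
by move=> x Hx; case: (Hps _ Hx) => _ ->.
Qed.

End DiagonalConjugates.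

(** Ranks are at most n, so some finite family in M has maximal rank; adjoining another member of M
    cannot raise it, so this member is a rational combination of the family. *)
Lemma max_rank_rows n (M : set 'rV[int]_n) :
  exists r (A : 'M[int]_(r, n)), (forall i, M (row i A)) /\
    forall m, M m -> (map_mx (intr : int -> rat) m <= map_mx intr A)%MS.
Proof.
pose Q k := `[< exists r (A : 'M[int]_(r, n)), (forall i, M (row i A)) /\
  \rank (map_mx (intr : int -> rat) A) = k >].
have Q0 : exists k, Q k.
  by exists 0%N; apply/asboolP; exists 0%N, 0; split=> [[]|] //; rewrite map_mx0 mxrank0.
have Qn k : Q k -> (k <= n)%N by move=> /asboolP[r [A [_ <-]]]; exact: rank_leq_col.
have [k /asboolP[r [A [AM rA]]] kmax] := ex_maxnP Q0 Qn.
exists r, A; split=> // m Mm.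
have : Q (\rank (map_mx (intr : int -> rat) (col_mx m A))).
  apply/asboolP; exists (1 + r)%N, (col_mx m A); split=> // i.
  case: (splitP i) => j ij.
    have -> : i = lshift r j by apply/val_inj.
    by rewrite rowKu (ord1 j) [row _ m](_ : _ = m) //; apply/rowP => l; rewrite mxE.
  have -> : i = rshift 1 j by apply/val_inj.
  by rewrite rowKd.
move=> /kmax; rewrite -rA map_col_mx => rk.
have sA : (map_mx (intr : int -> rat) A <= col_mx (map_mx intr m) (map_mx intr A))%MS.
  by rewrite -addsmxE addsmxSr.
have := mxrank_leqif_sup sA => /leqifP.
rewrite ltnNge rk /=; case: ifP => // sub _.
by apply: submx_trans sub; rewrite -addsmxE addsmxSl.
Qed.

(* In a Smith normal form of generators of M up to finite index, M is spanned by
   the rows of the right factor belonging to nonzero invariant factors. *)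
Lemma saturated_split n (M : set 'rV[int]_n) : M 0 ->
  (forall x y, M x -> M y -> M (x + y)) ->
  (forall c x, M x -> M (c *: x)) ->
  (forall c x, c != 0 -> M (c *: x) -> M x) ->
  exists E : 'M[int]_n, [/\ E *m E = E, forall i, M (row i (1%:M - E))
    & forall m, M m -> m *m E = 0].
Proof.
move=> M0 MD MZ Msat.
have Msum I (r : seq I) (F : I -> 'rV[int]_n) : (forall i, M (F i)) ->
    M (\sum_(i <- r) F i).
  move=> MF; elim: r => [|i r IH]; first by rewrite big_nil.
  by rewrite big_cons; apply: MD.
have [r [A [AM Amax]]] := max_rank_rows M.
have [B Bu [C Cu [d _ AE]]] := int_Smith_normal_form A.
set D := \matrix_(i, j) _ in AE.
pose good (j : 'I_n) := [exists i : 'I_r, D i j != 0].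
pose q : 'rV[int]_n := \row_j (~~ good j)%:R.
(* In the basis formed by the rows of C, E kills the rows with a nonzero invariant factor, which
   span M, and fixes the others. *)
pose E := invmx C *m diag_mx q *m C.
have DqE : D *m diag_mx q = 0.
  apply/matrixP => i j; rewrite mul_mx_diag !mxE.
  case: (boolP (good j)) => [|/existsPn/(_ i)]; first by rewrite mulr0.
  by rewrite negbK mxE => /eqP->; rewrite mul0r.
have EE : E *m E = E.
  rewrite /E !mulmxA mulmxK // -[_ *m diag_mx q *m diag_mx q]mulmxA mulmx_diag.
  congr (_ *m diag_mx _ *m _); apply/rowP => j; rewrite !mxE.
  by case: (good j).
have AE0 : A *m E = 0.
  by rewrite AE /E !mulmxA mulmxK // -[_ *m D *m _]mulmxA DqE mulmx0 mul0mx.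
have CM j : good j -> M (row j C).
  move=> /existsP[i Dij].
  have ij : (i : nat) = j.
    by apply/eqP; apply: contraNT Dij => nij; rewrite mxE (negbTE nij) mulr0n.
  (* The multiple of the row by its invariant factor is an integer combination of the rows of A;
     saturation removes the factor. *)
  apply: (Msat _ _ Dij).
  have -> : D i j *: row j C = row i (invmx B *m A).
    rewrite AE !mulmxA mulVmx // mul1mx row_mul.
    apply/rowP => l; rewrite !mxE (bigD1 j) //= big1 ?addr0 ?mxE // => k kj.
    rewrite !mxE; case: eqP => [e|]; last by rewrite mulr0n mul0r.
    by case/eqP: kj; apply/val_inj; rewrite /= -e ij.
  rewrite row_mul mulmx_sum_row; apply: Msum => k; exact: MZ.
exists E; split=> // [i|m Mm].
  have -> : 1%:M - E = invmx C *m diag_mx (const_mx 1 - q) *m C.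
    rewrite /E raddfB /= mulmxBr mulmxBl; congr (_ - _).
    by rewrite diag_const_mx mulmx1 mulVmx.
  rewrite -mulmxA row_mul mulmx_sum_row; apply: Msum => k; apply: (MZ).
  rewrite row_mul row_diag_mx -scalemxAl -rowE !mxE; case: (boolP (good k)) => [gk|_].
    by apply: MZ; apply: CM.
  by rewrite subrr scale0r.
have /submxP[w mw] := Amax m Mm.
have : map_mx (intr : int -> rat) (m *m E) = 0.
  by rewrite map_mxM mw -mulmxA -map_mxM AE0 map_mx0 mulmx0.
move=> /matrixP h; apply/matrixP => i j; have := h i j.
by rewrite !mxE => /eqP; rewrite intr_eq0 => /eqP.
Qed.

(** * Points over the extensions of K *)

Lemma mxeval_map (K L L' : fieldType) (f : K -> L) (g : {rmorphism L -> L'}) n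
    (p : mxpoly[K]_n) (x : 'M[L]_n) :
  mxeval (g \o f) p (map_mx g x) = g (mxeval f p x).
Proof.
rewrite /mxeval /mpoly.mmap rmorph_sum; apply: eq_bigr => m _ /=.
rewrite rmorphM /mpoly.mmap1 rmorph_prod; congr (_ * _).
by apply: eq_bigr => k _; rewrite rmorphXn -map_mxvec mxE.
Qed.

Lemma SLpoints_map (K L L' : fieldType) (f : K -> L) (g : {rmorphism L -> L'}) n
    (ps : seq (mxpoly[K]_n)) (x : 'M[L]_n) :
  SLpoints (g \o f) ps (map_mx g x) <-> SLpoints f ps x.
Proof.
have gI := fmorph_inj g.
rewrite /SLpoints /= det_map_mx; split=> -[h1 h2]; split.
- by apply: gI; rewrite h1 rmorph1.
- by move=> p pps; apply: gI; rewrite -mxeval_map h2 // rmorph0.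
- by rewrite h1 rmorph1.
- by move=> p pps; rewrite mxeval_map h2 // rmorph0.
Qed.

Lemma SLpoints_map_idfun (K L : fieldType) (f : {rmorphism K -> L}) n
    (ps : seq (mxpoly[K]_n)) (x : 'M[K]_n) :
  SLpoints f ps (map_mx f x) <-> SLpoints idfun ps x.
Proof. exact: (SLpoints_map idfun f). Qed.

Lemma SLpoints_unit (K L : fieldType) (f : K -> L) n (ps : seq (mxpoly[K]_n)) x :
  SLpoints f ps x -> x \in unitmx.
Proof. by case=> dx _; rewrite unitmxE dx unitr1. Qed.

Section RealPoints.
Variables (K : rcfType) (n : nat).
Local Notation rc := (@complex.real_complex K : {rmorphism K -> algclosure K}).

Lemma geom_real (ps : seq (mxpoly[K]_n)) (x : 'M[K]_n) :
  geom_points ps (map_mx rc x) <-> SLpoints idfun ps x.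
Proof. exact: (SLpoints_map_idfun rc). Qed.

Section Group.
Variables (ps : seq (mxpoly[K]_n)) (Hps : algebraic_group ps).
Variables (L : rcfType) (f : {rmorphism K -> L}).

Lemma SLpoints1 : SLpoints f ps 1%:M.
Proof.
rewrite -(map_mx1 f); apply/SLpoints_map_idfun; rewrite -geom_real.
by rewrite map_mx1; case: Hps.
Qed.

(** The group laws are given over K[i], which is not real closed. They are restricted to the points
    over K first, and transferred to L from there; the following lemmas take the same route. *)
Lemma SLpointsM x y : SLpoints f ps x -> SLpoints f ps y -> SLpoints f ps (x *m y).
Proof.
have D : definable 0 (fun L f (es : seq 'M[L]_n) =>
    forall x y : 'M[L]_n, SLpoints f ps x ->
      SLpoints f ps y ->
      SLpoints f ps (x *m y)).
  by definability.
move: x y; apply/(transfer D) => x y /= /geom_real hx /geom_real hy; apply/geom_real.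
by rewrite map_mxM; case: Hps => _ h _; apply: h.
Qed.

Lemma SLpointsV x : SLpoints f ps x -> SLpoints f ps (invmx x).
Proof.
(* [invmx] has no counterpart among the definable matrices, so the inverse enters as a matrix y with
   x y = 1. *)
have D : definable 0 (fun L f (es : seq 'M[L]_n) =>
    forall x y : 'M[L]_n, SLpoints f ps x ->
      x *m y = 1%:M ->
      SLpoints f ps y).
  by definability.
move=> hx; have xu := SLpoints_unit hx.
suff H : forall x y : 'M[L]_n, SLpoints f ps x -> x *m y = 1%:M -> SLpoints f ps y.
  by apply: H hx _; rewrite mulmxV.
apply/(transfer D) => {hx xu}x y hx xy; have xu := SLpoints_unit hx.
have -> : y = invmx x by rewrite -[y]mul1mx -(mulVmx xu) -mulmxA xy mulmx1.
move: hx => /geom_real hx; apply/geom_real.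
by rewrite map_invmx; case: Hps => _ _; apply.
Qed.

End Group.

Lemma SLpoints_trmx (ps : seq (mxpoly[K]_n)) (L : rcfType) (f : {rmorphism K -> L}) x :
  self_adjoint ps -> SLpoints f ps x -> SLpoints f ps x^T.
Proof.
move=> adj.
have D : definable 0 (fun L f (es : seq 'M[L]_n) =>
    forall x : 'M[L]_n, SLpoints f ps x ->
      SLpoints f ps x^T).
  by definability.
move: x; apply/(transfer D) => x /= /geom_real hx; apply/geom_real.
by rewrite -map_trmx; apply: adj.
Qed.

Lemma SLpoints_sub (ps qs : seq (mxpoly[K]_n)) (L : rcfType) (f : {rmorphism K -> L}) :
  geom_points qs `<=` geom_points ps -> SLpoints f qs `<=` SLpoints f ps.
Proof.
move=> sub.
have D : definable 0 (fun L f (es : seq 'M[L]_n) =>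
    forall x : 'M[L]_n, SLpoints f qs x ->
      SLpoints f ps x).
  by definability.
by apply/(transfer D) => x /= /geom_real hx; apply/geom_real; apply: sub.
Qed.

Lemma SLpoints_sym (qs : seq (mxpoly[K]_n)) (L : rcfType) (f : {rmorphism K -> L}) x :
  (forall s, geom_points qs s -> s = s^T) -> SLpoints f qs x -> x^T = x.
Proof.
move=> sym.
have D : definable 0 (fun L f (es : seq 'M[L]_n) =>
    forall x : 'M[L]_n, SLpoints f qs x ->
      x^T = x).
  by definability.
move: x; apply/(transfer D) => x /= /geom_real/sym hx.
by apply: (@map_mx_inj _ _ rc); rewrite -map_trmx -hx.
Qed.

(** Written with the image of [invmx P], a constant matrix over K, so that it is visibly
    definable. *)
Definition diag_coord (P : 'M[K]_n) (L : rcfType) (f : {rmorphism K -> L})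
    (s : 'M[L]_n) : 'M[L]_n := map_mx f P *m s *m map_mx f (invmx P).

Definition split_by (P : 'M[K]_n) (qs : seq (mxpoly[K]_n)) :=
  P \in unitmx /\ forall s, geom_points qs s ->
    is_diag_mx (map_mx rc P *m s *m invmx (map_mx rc P)).

(** By [ApointsE] these are the points of A. Unlike a connected component, they are given by a
    formula that makes sense in every extension. *)
Definition pos_points P qs (L : rcfType) (f : {rmorphism K -> L}) : set 'M[L]_n :=
  [set s | SLpoints f qs s /\ forall i, 0 < diag_coord P f s i i].

Section Split.
Variables (P : 'M[K]_n) (qs : seq (mxpoly[K]_n)) (HP : split_by P qs).
Variables (L : rcfType) (f : {rmorphism K -> L}).

Lemma split_diag s : SLpoints f qs s -> forall i j, i != j -> diag_coord P f s i j = 0.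
Proof.
have D : definable 0 (fun L f (es : seq 'M[L]_n) =>
    forall x : 'M[L]_n, SLpoints f qs x ->
      forall i j, i != j -> diag_coord P f x i j = 0).
  by definability.
move: s; apply/(transfer D) => x /= /geom_real hs i j ij.
have [Pu Pd] := HP; have /is_diag_mxP/(_ _ _ ij) := Pd _ hs.
rewrite -map_invmx -!map_mxM mxE => /eqP.
by rewrite fmorph_eq0 => /eqP; rewrite /diag_coord !map_mx_id.
Qed.

End Split.
End RealPoints.

(** * Definable sets of matrices as semialgebraic sets *)

Section Semialgebraic.
Variables (K : rcfType) (n : nat).

(** A variable beyond the n * n entries becomes 0, the default that [nth] returns for it in the
    environment. *)
Fixpoint term_poly (t : qe_rcf.term K) : mxpoly[K]_n :=
  match t with
  | qe_rcf.Var i => if insub i is Some k then mpoly.mpolyX K (mpoly.mnm1 k) else 0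
  | qe_rcf.Const c => mpoly.mpolyC _ c
  | qe_rcf.NatConst k => k%:R
  | qe_rcf.Add u v => term_poly u + term_poly v
  | qe_rcf.Opp u => - term_poly u
  | qe_rcf.NatMul u k => term_poly u *+ k
  | qe_rcf.Mul u v => term_poly u * term_poly v
  | qe_rcf.Exp u k => term_poly u ^+ k
  end.

Lemma mxeval_term_poly (L : rcfType) (f : {rmorphism K -> L}) (g : 'M[L]_n) t :
  mxeval f (term_poly t) g = qe_rcf.eval (flat [:: g]) (mapT f t).
Proof.
rewrite /mxeval; elim: t => /=.
- move=> i; case: insubP => [k _ <-|].
    rewrite mpoly.mmapX mpoly.mmap1U /flat /= cats0.
    by rewrite (nth_map k) ?size_enum_ord // nth_ord_enum.
  by rewrite -leqNgt => ni; rewrite rmorph0 nth_default // size_flat mul1n.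
- by move=> c; rewrite mpoly.mmapC.
- by move=> k; rewrite rmorph_nat.
- by move=> u <- v <-; rewrite rmorphD.
- by move=> u <-; rewrite rmorphN.
- by move=> u <- k; rewrite rmorphMn.
- by move=> u <- v <-; rewrite rmorphM.
- by move=> u <- k; rewrite rmorphXn.
Qed.

(** The disjunctive normal form of the quantifier-free formula is itself a description, and the same
    one for all extensions. *)
Lemma definable_sa (P : forall L : rcfType, {rmorphism K -> L} -> seq 'M[L]_n -> Prop) :
  definable 1 P -> exists D : sa_desc K n, forall (L : rcfType)
    (f : {rmorphism K -> L}) (g : 'M[L]_n), P L f [:: g] <-> sa_points f D g.
Proof.
move=> [p hp]; have [d hd] := dnf_exists p true.
exists [seq (map term_poly c.1, map term_poly c.2) | c <- d] => L f g.
rewrite hp // -[qe_rcf.qf_eval _ _]eqb_id -hd /eval_dnf.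
elim: d {hd} => [|c d IH] /=; first by split=> // -[].
have cE : eval_clause f (flat [:: g]) c <->
    (forall q, q \in map term_poly c.1 -> mxeval f q g = 0) /\
    (forall q, q \in map term_poly c.2 -> 0 < mxeval f q g).
  rewrite /eval_clause; split=> [/andP[h1 h2]|[h1 h2]].
    split=> q; [elim: (c.1) h1|elim: (c.2) h2] => //= t r IHr /andP[h hr];
    by rewrite inE => /orP[/eqP->|/(IHr hr)//]; rewrite mxeval_term_poly //; apply/eqP.
  apply/andP; split; [elim: (c.1) h1|elim: (c.2) h2] => //= t r IHr h.
    by rewrite -mxeval_term_poly h ?mem_head // eqxx IHr // => q qr; apply: h; rewrite inE qr orbT.
  by rewrite -mxeval_term_poly h ?mem_head // IHr // => q qr; apply: h; rewrite inE qr orbT.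
split=> [/orP[/cE h|/IH[s sd h]]|[s]].
- by exists (map term_poly c.1, map term_poly c.2); rewrite ?mem_head.
- by exists s; rewrite // inE sd orbT.
- rewrite inE => /orP[/eqP-> /cE->//|sd h]; apply/orP; right; apply/IH.
  by exists s.
Qed.

End Semialgebraic.

(** * Real powers of a positive diagonalizable element *)

Section Flow.
Variables (R : realType) (n : nat).

Definition rpow (t : R) (x : 'rV[R]_n) : 'rV[R]_n := \row_i expR (t * ln (x ord0 i)).

Lemma rpow0 x : rpow 0 x = const_mx 1.
Proof. by apply/rowP => i; rewrite !mxE mul0r expR0. Qed.

Lemma rpow1 (x : 'rV[R]_n) : (forall i, 0 < x ord0 i) -> rpow 1 x = x.
Proof. by move=> x0; apply/rowP => i; rewrite mxE mul1r lnK // posrE. Qed.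

Lemma rpow_gt0 t x i : 0 < (rpow t x) ord0 i.
Proof. by rewrite mxE expR_gt0. Qed.

Lemma expR_exprz (a : R) (m : int) : expR a ^ m = expR (a * m%:~R).
Proof.
case: m => k; first by rewrite -[k%:~R]/(k%:R) mulrC expRM_natl.
by rewrite NegzE -exprnN mulrNz mulrN expRN mulrC expRM_natl.
Qed.

Lemma zmon_rpow t (x : 'rV[R]_n) m : zmon (rpow t x) m =
  expR (t * \sum_i ln (x ord0 i) * (m ord0 i)%:~R).
Proof.
rewrite /zmon mulr_sumr expR_sum; apply: eq_bigr => i _.
by rewrite mxE expR_exprz mulrA.
Qed.

Definition powers (x : 'rV[R]_n) : set 'rV[R]_n :=
  [set z | exists k : nat, z = \row_i x ord0 i ^+ k].

Lemma powers1 x : powers x (const_mx 1).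
Proof. by exists 0%N; apply/rowP => i; rewrite !mxE. Qed.

Lemma powersM x z z' : powers x z -> powers x z' -> powers x (hmul z z').
Proof.
by move=> [k ->] [l ->]; exists (k + l)%N; apply/rowP => i; rewrite !mxE exprD.
Qed.

Lemma powers_nonzero (x : 'rV[R]_n) : (forall i, 0 < x ord0 i) -> powers x `<=` @nonzero R n.
Proof. by move=> x0 z [k ->] i; rewrite mxE expf_neq0 // gt_eqF. Qed.

(** A monomial relation at x is a linear equation between the logarithms of its coordinates, and
    this equation is homogeneous in t. *)
Lemma powers_rpow t (x : 'rV[R]_n) m : (forall i, 0 < x ord0 i) ->
  (forall z, powers x z -> zmon z m = 1) -> zmon (rpow t x) m = 1.
Proof.
move=> x0 hm; have : zmon x m = 1.
  by rewrite -[RHS](hm x) //; exists 1%N; apply/rowP => i; rewrite mxE.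
rewrite -[in X in X -> _](rpow1 x0) !zmon_rpow mul1r => e.
by rewrite (expR_inj (etrans e (esym (expR0 R)))) mulr0 expR0.
Qed.

Lemma powers_dconj (Q : 'M[R]_n) (x : 'rV[R]_n) (C : set 'M[R]_n) : Q \in unitmx ->
  C 1%:M -> (forall A, C A -> C (dconj Q x *m A)) ->
  forall z, powers x z -> C (dconj Q z).
Proof.
move=> Qu C1 CM z [k ->]; elim: k => [|k IH].
  rewrite (_ : \row_i _ = const_mx 1); last by apply/rowP => i; rewrite !mxE.
  by rewrite dconj1.
rewrite (_ : \row_i _ = hmul x (\row_i x ord0 i ^+ k)); last first.
  by apply/rowP => i; rewrite !mxE exprS.
by rewrite -dconj_mul //; apply: CM.
Qed.

(** The group contains the powers with natural exponents; relations valid on them persist at x^t, so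
    [torus_closure] carries the equations of the group over to the whole flow. *)
Lemma exp_flow (K : rcfType) (f : {rmorphism K -> R}) (ps : seq (mxpoly[K]_n))
    (Q : 'M[R]_n) (x : 'rV[R]_n) : algebraic_group ps -> Q \in unitmx ->
  (forall i, 0 < x ord0 i) -> SLpoints f ps (dconj Q x) ->
  forall t, SLpoints f ps (dconj Q (rpow t x)).
Proof.
move=> Hps Qu x0 hx t.
apply: (@torus_closure _ _ _ Qu _ _ _ (powers x)).
- exact: powers1.
- exact: powers_nonzero.
- exact: powersM.
- by move=> i; rewrite gt_eqF // rpow_gt0.
- by move=> m; exact: powers_rpow.
apply: powers_dconj => //; first exact: SLpoints1.
by move=> A; exact: SLpointsM.
Qed.

End Flow.

Lemma cvg_sumr (R : realType) (T I : Type) (F : set_system T) (FF : Filter F)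
    (r : seq I) (h : I -> T -> R) (l : I -> R) :
  (forall i, h i x @[x --> F] --> l i) ->
  \sum_(i <- r) h i x @[x --> F] --> \sum_(i <- r) l i.
Proof. by move=> hl; apply: cvg_big => // *; exact: add_continuous. Qed.

(** * The identity component of a split torus *)

Section Component.
Variables (K : rcfType) (n : nat) (P : 'M[K]_n) (qs : seq (mxpoly[K]_n)).
Hypotheses (HP : split_by P qs) (Hqs : algebraic_group qs).

Lemma map_unitP (L : rcfType) (f : {rmorphism K -> L}) : map_mx f P \in unitmx.
Proof. by rewrite map_unitmx; case: HP. Qed.

Lemma split_dconj (L : rcfType) (f : {rmorphism K -> L}) s : SLpoints f qs s ->
  s = dconj (map_mx f P) (\row_i diag_coord P f s i i).
Proof.
move=> hs; have Pu := map_unitP f.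
rewrite -{1}(@dconj_coords _ _ _ Pu s); first by congr dconj;
  apply/rowP => i; rewrite !mxE /diag_coord map_invmx.
by apply/is_diag_mxP => i j ij; have := split_diag HP hs ij; rewrite /diag_coord map_invmx.
Qed.

Lemma diag_coord_dconj (L : rcfType) (f : {rmorphism K -> L}) x :
  diag_coord P f (dconj (map_mx f P) x) = diag_mx x.
Proof. by rewrite /diag_coord map_invmx dconjK // map_unitP. Qed.

Lemma pos_points_dconj (L : rcfType) (f : {rmorphism K -> L}) x :
  pos_points P qs f (dconj (map_mx f P) x) <->
  SLpoints f qs (dconj (map_mx f P) x) /\ forall i, 0 < x ord0 i.
Proof.
by rewrite /pos_points /= diag_coord_dconj; split=> -[h1 h2]; split=> // i;
  have := h2 i; rewrite !mxE eqxx mulr1n.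
Qed.

Lemma pos_pointsP (L : rcfType) (f : {rmorphism K -> L}) s : pos_points P qs f s ->
  exists2 x : 'rV[L]_n, (forall i, 0 < x ord0 i) & s = dconj (map_mx f P) x.
Proof.
by move=> [hs s0]; exists (\row_i diag_coord P f s i i);
  [move=> i; rewrite mxE|exact: split_dconj].
Qed.

Lemma pos_points1 (L : rcfType) (f : {rmorphism K -> L}) : pos_points P qs f 1%:M.
Proof.
rewrite -(dconj1 (map_unitP f)); apply/pos_points_dconj; split.
  by rewrite dconj1 ?map_unitP //; exact: SLpoints1.
by move=> i; rewrite mxE.
Qed.

Variable R : realType.

Lemma pos_points_flow (f : {rmorphism K -> R}) (x : 'rV[R]_n) t : (forall i, 0 < x ord0 i) ->
  SLpoints f qs (dconj (map_mx f P) x) ->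
  pos_points P qs f (dconj (map_mx f P) (rpow t x)).
Proof.
move=> x0 hx; apply/pos_points_dconj; split; last by move=> i; exact: rpow_gt0.
by apply: exp_flow => //; exact: map_unitP.
Qed.

Lemma continuous_dconj_rpow (Q : 'M[R]_n) (x : 'rV[R]_n) i j :
  continuous (fun t => dconj Q (rpow t x) i j).
Proof.
have -> : (fun t => dconj Q (rpow t x) i j) =
    (fun t => \sum_k invmx Q i k * expR (t * ln (x ord0 k)) * Q k j).
  apply/funext => t; rewrite mxE; apply: eq_bigr => k _; congr (_ * _).
  by rewrite mul_mx_diag !mxE.
move=> t; apply: cvg_sumr => k; apply: cvgM; last exact: cvg_cst.
apply: cvgM; first exact: cvg_cst.
apply: continuous_cvg; first exact: continuous_expR.
by apply: cvgM; [exact: cvg_id|exact: cvg_cst].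
Qed.

Lemma dconj_rpow_near (Q : 'M[R]_n) (x : 'rV[R]_n) t0 (e : R) : 0 < e ->
  exists2 d, 0 < d & forall t, `|t0 - t| < d ->
    forall i j, `|dconj Q (rpow t0 x) i j - dconj Q (rpow t x) i j| < e.
Proof.
move=> e0.
pose h t := \sum_i \sum_j `|dconj Q (rpow t0 x) i j - dconj Q (rpow t x) i j|.
have hc : h t @[t --> t0] --> h t0.
  apply: cvg_sumr => i; apply: cvg_sumr => j; apply: cvg_norm; apply: cvgB.
    exact: cvg_cst.
  exact: continuous_dconj_rpow.
have ht0 : h t0 = 0 by apply: big1 => i _; apply: big1 => j _; rewrite subrr normr0.
move/cvgrPdist_lt/(_ _ e0) : hc => [d /= d0 hd]; exists d => // t td i j.
have := hd t td; rewrite /= ht0 sub0r normrN; apply: le_lt_trans.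
apply: le_trans (ler_norm _); rewrite /h (bigD1 i) //= (bigD1 j) //=.
rewrite -addrA lerDl addr_ge0 ?sumr_ge0 // => k _; exact: sumr_ge0.
Qed.

(** The path x^t joins the identity to s inside V. At the supremum of the times t in [0, 1] with x^t
    in C1, the point would belong to both closed sets. *)
Lemma pos_points_no_separation (f : {rmorphism K -> R}) (C1 C2 : set 'M[R]_n) s :
  let V := pos_points P qs f in
  let cl (C : set 'M[R]_n) := forall x, V x -> (forall e : R, 0 < e ->
       exists2 y, C y & forall i j, `|x i j - y i j| < e) -> C x in
  cl C1 -> cl C2 -> (forall x, V x -> C1 x \/ C2 x) ->
  (forall x, C1 x -> C2 x -> False) -> C1 1%:M -> V s -> C2 s -> False.
Proof.
move=> V cl cl1 cl2 cov dis C11 Vs C2s.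
have [x x0 sE] := pos_pointsP Vs.
pose g t := dconj (map_mx f P) (rpow t x).
have Vg t : V (g t) by apply: pos_points_flow => //; rewrite -sE; case: Vs.
have g0 : g 0 = 1%:M by rewrite /g rpow0 dconj1 // map_unitP.
have g1 : g 1 = s by rewrite /g rpow1.
pose A := [set t : R | [/\ 0 <= t, t <= 1 & C1 (g t)]].
have A0 : A 0 by split=> //; rewrite g0.
have A1 : ubound A 1 by move=> t [].
have supA : has_sup A by split; [exists 0|exists 1].
pose t0 := sup A.
have t0_ge0 : 0 <= t0 by apply: (ub_le_sup (proj2 supA)).
have t0_le1 : t0 <= 1 by apply: ge_sup => //; exists 0.
have C1t0 : C1 (g t0).
  apply: cl1 => // e e0; have [d d0 hd] := dconj_rpow_near (map_mx f P) x t0 e0.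
  have [t At td] := sup_adherent d0 supA.
  exists (g t); first by case: At.
  apply: hd; rewrite ger0_norm; first by rewrite ltrBlDr -ltrBlDl.
  by rewrite subr_ge0; apply: (ub_le_sup (proj2 supA)).
have t0_lt1 : t0 < 1.
  rewrite lt_neqAle t0_le1 andbT; apply/eqP => t01.
  by apply: (dis s) => //; rewrite -g1 -t01.
apply: (dis (g t0)) => //; apply: cl2 => // e e0.
have [d d0 hd] := dconj_rpow_near (map_mx f P) x t0 e0.
pose t := Order.min 1 (t0 + d / 2).
have tt0 : t0 < t by rewrite /t lt_min t0_lt1 ltrDl divr_gt0.
have tt1 : t <= 1 by rewrite /t ge_min lexx.
exists (g t).
  have [C1t|//] := cov _ (Vg t).
  have : t <= t0 by apply: (ub_le_sup (proj2 supA)); split=> //; apply: ltW; apply: le_lt_trans tt0.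
  by rewrite leNgt tt0.
apply: hd; rewrite distrC ger0_norm ?subr_ge0 ?ltW // ltrBlDl.
rewrite /t gt_min; apply/orP; right; rewrite ltrD2l ltr_pdivrMr // ltr_pMr //.
by rewrite ltr1n.
Qed.

End Component.

Section SplitTorusComponent.
Variables (K : rcfType) (n : nat) (P : 'M[K]_n) (qs : seq (mxpoly[K]_n)).
Hypotheses (HP : split_by P qs) (Hqs : algebraic_group qs).
Variables (R : realType) (iR : {rmorphism K -> R}) (i0 : 'I_n).

(** Over K there are no real exponents and no suprema. For semialgebraic C1 and C2 the impossibility
    of a separation is first-order, so it is obtained from R by transfer. *)
Lemma pos_points_no_separation_K (C1 C2 : set 'M[K]_n) s :
  let V := pos_points P qs idfun in
  semialgebraic C1 -> semialgebraic C2 -> closed_in V C1 -> closed_in V C2 ->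
  C1 `&` C2 = set0 -> C1 `|` C2 = V -> C1 1%:M -> C2 s -> False.
Proof.
move=> V [D1 ->] [D2 ->] [s1 cl1] [s2 cl2] dis cov C11 C2s.
(* The definable formulas quantify over matrices only: the scalar e is coded as the entry [e i0 i0],
   and the absolute value as two inequalities. *)
pose cl (D : sa_desc K n) (L : rcfType) (f : {rmorphism K -> L}) :=
  forall x : 'M[L]_n, pos_points P qs f x -> (forall e : 'M[L]_n, 0 < e i0 i0 ->
       exists y : 'M[L]_n, sa_points f D y /\ forall i j,
         y i j - x i j < e i0 i0 /\ x i j - y i j < e i0 i0) -> sa_points f D x.
have dcl D m : definable m (fun L f (es : seq 'M[L]_n) => cl D L f).
  by definability.
have D : definable 0 (fun L f (es : seq 'M[L]_n) =>
    cl D1 L f -> cl D2 L f ->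
    (forall x, pos_points P qs f x -> ~ sa_points f D1 x -> sa_points f D2 x) ->
    (forall x, sa_points f D1 x -> ~ sa_points f D2 x) -> sa_points f D1 1%:M ->
    forall s, pos_points P qs f s -> ~ sa_points f D2 s).
  do 2 (apply: definable_imp; first exact: dcl).
  by definability.
have clP D0 (L : rcfType) (f : {rmorphism K -> L}) : cl D0 L f <->
    forall x : 'M[L]_n, pos_points P qs f x -> (forall e : L, 0 < e ->
      exists2 y, sa_points f D0 y & forall i j, `|x i j - y i j| < e) ->
      sa_points f D0 x.
  split=> h x Vx hx; apply: h => // e e0.
    have [y Dy hy] := hx _ e0; exists y; split=> // i j.
    by apply/andP; rewrite -[y i j - x i j]opprB ltrNl -ltr_norml.
  have [|y [Dy hy]] := hx (const_mx e); first by rewrite mxE.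
  by exists y => // i j; rewrite ltr_norml ltrNl opprB; apply/andP; have := hy i j; rewrite !mxE.
apply: (iffLR (transfer D iR) _ (iffRL (clP _ _ _) cl1) (iffRL (clP _ _ _) cl2)
  _ _ C11 s (s2 _ C2s) C2s).
- move=> h1 h2 cov' dis' h3 s' Vs' h4.
  apply: (pos_points_no_separation HP Hqs (iffLR (clP _ _ _) h1)
    (iffLR (clP _ _ _) h2) _ _ h3 Vs' h4) => x; last exact: dis'.
  by move=> Vx; have [|nx] := pselect (sa_points iR D1 x); [left|right; exact: cov'].
- by move=> x; rewrite -[pos_points _ _ _ _]/(V x) -cov => -[].
- by move=> x h1 h2; suff : (set0 : set 'M[K]_n) x by []; rewrite -dis.
Qed.

Lemma diag_coord_close (e : K) : 0 < e -> exists2 d, 0 < d &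
  forall x y : 'M[K]_n, (forall i j, `|x i j - y i j| < d) ->
  forall i, `|diag_coord P idfun x i i - diag_coord P idfun y i i| < e.
Proof.
move=> e0; set A := map_mx idfun P; set B := map_mx idfun (invmx P).
pose M := \sum_i \sum_l \sum_k `|A i k| * `|B l i|.
have M0 : 0 <= M by do 3 (apply: sumr_ge0 => ? _); rewrite mulr_ge0.
have M1 : 0 < M + 1 by rewrite ltr_wpDl.
exists (e / (M + 1)); first by rewrite divr_gt0.
move=> x y xy i.
rewrite /diag_coord -/A -/B.
have -> : (A *m x *m B) i i - (A *m y *m B) i i =
    \sum_l \sum_k A i k * (x k l - y k l) * B l i.
  rewrite !mxE -sumrB; apply: eq_bigr => l _; rewrite !mxE -mulrBl -sumrB mulr_suml.
  by apply: eq_bigr => k _; rewrite mulrBr.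
apply: (@le_lt_trans _ _ (M * (e / (M + 1)))); last first.
  by rewrite mulrCA gtr_pMr // ltr_pdivrMr // mul1r ltrDl.
set d := e / (M + 1) in xy *.
have d0 : 0 <= d by rewrite ltW // divr_gt0.
apply: (@le_trans _ _ ((\sum_l \sum_k `|A i k| * `|B l i|) * d)).
  rewrite mulr_suml; apply: le_trans (ler_norm_sum _ _ _) _; apply: ler_sum => l _.
  rewrite mulr_suml; apply: le_trans (ler_norm_sum _ _ _) _; apply: ler_sum => k _.
  rewrite !normrM mulrAC ler_wpM2l ?mulr_ge0 //; exact: ltW.
rewrite ler_wpM2r // /M [X in _ <= X](bigD1 i) //= lerDl.
by do 3 (apply: sumr_ge0 => ? _); rewrite mulr_ge0.
Qed.

Lemma coord_neq0 (s : 'M[K]_n) : SLpoints idfun qs s -> forall i, diag_coord P idfun s i i != 0.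
Proof.
move=> hs i; have Pu := map_unitP HP idfun.
have sd : is_diag_mx (map_mx idfun P *m s *m invmx (map_mx idfun P)).
  by apply/is_diag_mxP => k l kl; have := split_diag HP hs kl; rewrite /diag_coord map_invmx.
by case: (hs) => ds _; have := coords_neq0 Pu sd ds i; rewrite mxE /diag_coord map_invmx.
Qed.

(** The coordinates of points of S never vanish, so positivity of all of them cuts a connected
    subset into two relatively closed pieces, and only the piece of the identity can remain.
    Conversely the positive points are connected. *)
Lemma sa_component_pos : sa_component (SLpoints idfun qs) 1%:M = pos_points P qs idfun.
Proof.
have V1 := pos_points1 HP Hqs idfun.
have Vdef : definable 1 (fun L f (es : seq 'M[L]_n) =>
    pos_points P qs f (nth 0 es 0)) by definability.
apply/seteqP; split=> y.
  move=> [C [[[D CE] Cconn] CS C1 Cy]].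
  have cdef : definable 1 (fun L f (es : seq 'M[L]_n) =>
      forall i, 0 < diag_coord P f (nth 0 es 0) i i).
    by definability.
  have Ddef : definable 1 (fun L f (es : seq 'M[L]_n) =>
      sa_points f D (nth 0 es 0)) by definability.
  have [D1 hD1] := definable_sa (definable_and Ddef cdef).
  have [D2 hD2] := definable_sa (definable_and Ddef (definable_not cdef)).
  have mem1 x : sa_points idfun D1 x <-> C x /\ forall i, 0 < diag_coord P idfun x i i.
    by rewrite -hD1 CE.
  have mem2 x : sa_points idfun D2 x <-> C x /\ ~ forall i, 0 < diag_coord P idfun x i i.
    by rewrite -hD2 CE.
  have [||||||E|E] := Cconn (sa_points idfun D1) (sa_points idfun D2).
  - by exists D1.
  - by exists D2.
  - split=> [x /mem1[]//|x Cx hx]; apply/mem1; split=> // i.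
    rewrite lt_def (coord_neq0 (CS _ Cx)) /= leNgt.
    apply/negP => ci; have e0 : 0 < - diag_coord P idfun x i i by rewrite oppr_gt0.
    have [d d0 hd] := diag_coord_close e0.
    have [z /mem1[Cz z0] xz] := hx _ d0.
    have := hd _ _ xz i; rewrite ltr_norml => /andP[h _].
    by have := z0 i; rewrite ltNge => /negP; apply; move: h;
      rewrite opprK -subr_gt0 addrAC subrr sub0r oppr_gt0; exact: ltW.
  - split=> [x /mem2[]//|x Cx hx]; apply/mem2; split=> // x0.
    (* A positive number below every coordinate of x: its inverse exceeds each of theirs. *)
    pose e := (\sum_i (diag_coord P idfun x i i)^-1 + 1)^-1.
    have s0 : 0 <= \sum_i (diag_coord P idfun x i i)^-1.
      by apply: sumr_ge0 => i _; rewrite invr_ge0 ltW.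
    have e0 : 0 < e by rewrite invr_gt0 ltr_wpDl.
    have [d d0 hd] := diag_coord_close e0.
    have [z /mem2[Cz nz] xz] := hx _ d0; apply: nz => i.
    have := hd _ _ xz i; rewrite ltr_norml => /andP[_ h].
    rewrite -(ltrD2l e) addr0; apply: le_lt_trans; last by rewrite -ltrBlDr; exact: h.
    rewrite -[leRHS]invrK lef_pV2 ?posrE ?invr_gt0 ?ltr_wpDl //.
    rewrite (bigD1 i) //= -addrA lerDl addr_ge0 // sumr_ge0 // => j _.
    by rewrite invr_ge0 ltW.
  - by apply/seteqP; split=> // x [/mem1[_ h] /mem2[_]].
  - apply/seteqP; split=> x; first by case=> [/mem1[]|/mem2[]].
    move=> Cx; have [h|h] := pselect (forall i, 0 < diag_coord P idfun x i i).
      by left; apply/mem1.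
    by right; apply/mem2.
  - by move: Cy; rewrite -E => /mem1[Cy y0]; split=> //; apply: CS.
  by move: C1; rewrite -E => /mem2[_ []]; case: V1.
move=> Vy; exists (pos_points P qs idfun); split=> //; last by move=> x [].
have [D hD] := definable_sa Vdef.
split; first by exists D; apply/seteqP; split=> x /hD.
move=> C1 C2 sC1 sC2 cl1 cl2 dis cov.
have : (C1 `|` C2) 1%:M by rewrite cov.
case=> h1; [left|right]; rewrite -cov; apply/seteqP; split=> x.
- by left.
- case=> // C2x; case: (pos_points_no_separation_K sC1 sC2 cl1 cl2 dis cov h1 C2x).
- by right.
- case=> // C1x; rewrite setIC in dis; rewrite setUC in cov.
  by case: (pos_points_no_separation_K sC2 sC1 cl2 cl1 dis cov h1 C1x).
Qed.

(** Whichever description over K is used for the component, it describes [pos_points] over K, and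
    hence over L by transfer. *)
Lemma ApointsE (L : rcfType) (f : {rmorphism K -> L}) : Apoints f qs = pos_points P qs f.
Proof.
rewrite /Apoints sa_component_pos; apply/seteqP; split=> x.
  move=> [D E Dx].
  have H : definable 0 (fun L f (es : seq 'M[L]_n) =>
      forall x, sa_points f D x <-> pos_points P qs f x).
    by definability.
  by apply: (iffLR (iffRL (transfer H f) _ x)) => // y; rewrite E.
move=> Vx.
have [D hD] : exists D : sa_desc K n, forall (L : rcfType) (f : {rmorphism K -> L})
    (g : 'M[L]_n), pos_points P qs f g <-> sa_points f D g.
  apply: (definable_sa (P := fun L f es => pos_points P qs f (nth 0 es 0))).
  by definability.
by exists D; [apply/seteqP; split=> y /hD|apply/hD].
Qed.

End SplitTorusComponent.

(** * Maximal split tori *)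

(** Over K[i] the spectral theorem gives a diagonalization with real eigenvalues, and real matrices
    similar over K[i] are similar by a real matrix ([real_similar]). The resulting Q need not be
    orthogonal. *)
Lemma sym_diagonalizable (K : rcfType) n (A : 'M[K]_n) : A^T = A ->
  exists2 Q : 'M[K]_n, Q \in unitmx & exists x, A = dconj Q x.
Proof.
move=> As; pose rc := @complex.real_complex K : {rmorphism K -> complex.complex K}.
pose B := map_mx rc A.
have rcR x : rc x \is Num.real by apply/complex.complex_realP; exists x.
have realP z : z \is Num.real -> exists x, z = rc x by move/complex.complex_realP.
have BR : B \is a realmx by apply/mxOverP => i j; rewrite mxE.
have Bs : B \is symmetricmx.
  by apply/is_hermitianmxP; rewrite expr0 scale1r map_mx_id // /B map_trmx As.
have Bh := realsym_hermsym Bs BR.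
have Dr := hermitian_spectral_diag_real Bh.
have /orthomx_spectralP Beq := hermitian_normalmx Bh.
have sB : simmx_in [in unitmx] B (diag_mx (spectral_diag B)).
  exists (spectralmx B); first exact: spectral_unit.
  apply/(simmxP (spectral_unit _)); rewrite [X in _ *m X = _]Beq.
  by rewrite !mulmxA mulmxV ?spectral_unit // mul1mx.
have DR : diag_mx (spectral_diag B) \is a realmx.
  apply/mxOverP => i j; rewrite mxE; case: eqP => _; rewrite ?mulr1n ?mulr0n ?real0 //.
  exact: (mxOverP Dr).
have [Q] := real_similar sB BR DR.
rewrite inE => /andP[/mxOverP QR Qu] /(simmxP Qu) QB.
have [Q0 QE] : exists Q0, Q = map_mx rc Q0.
  have /choice[q hq] : forall ij : 'I_n * 'I_n, exists x, Q ij.1 ij.2 = rc x.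
    by move=> ij; apply: realP; exact: QR.
  exists (\matrix_(i, j) q (i, j)); apply/matrixP => i j.
  by rewrite !mxE -hq.
have [d dE] : exists d, spectral_diag B = map_mx rc d.
  have /choice[q hq] : forall i : 'I_n, exists x, spectral_diag B ord0 i = rc x.
    by move=> i; apply: realP; exact: (mxOverP Dr).
  by exists (\row_i q i); apply/rowP => i; rewrite !mxE -hq.
have Q0u : Q0 \in unitmx by move: Qu; rewrite QE map_unitmx.
exists Q0 => //; exists d; rewrite /dconj.
have QA : Q0 *m A = diag_mx d *m Q0.
  by apply: (@map_mx_inj _ _ rc); rewrite !map_mxM map_diag_mx -dE -QE.
by rewrite -mulmxA -QA mulmxA mulVmx // mul1mx.
Qed.

(** The i-th row r of Q is a left eigenvector, whence |r w|^2 = x_i |r|^2. *)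
Lemma gram_eigen_gt0 (K : rcfType) n (w Q : 'M[K]_n) x : Q \in unitmx ->
  w \in unitmx -> w *m w^T = dconj Q x -> forall i, 0 < x ord0 i.
Proof.
move=> Qu wu E i.
have sq_ge0 (r : 'rV[K]_n) : 0 <= (r *m r^T) ord0 ord0.
  by rewrite mxE sumr_ge0 // => k _; rewrite mxE -expr2 sqr_ge0.
have sq_gt0 (r : 'rV[K]_n) : r != 0 -> 0 < (r *m r^T) ord0 ord0.
  move=> r0; rewrite lt_def sq_ge0 andbT; apply: contraNneq r0 => e.
  apply/eqP/rowP => k; apply/eqP; rewrite mxE -sqrf_eq0.
  have : \sum_k r ord0 k ^+ 2 = 0.
    by rewrite -[RHS]e mxE; apply: eq_bigr => l _; rewrite mxE -expr2.
  by move/psumr_eq0P => -> // l _; rewrite sqr_ge0.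
have rQ : row i Q != 0.
  apply: contraTneq Qu => r0; rewrite -row_free_unit; apply/row_freePn.
  by exists i; rewrite r0 sub0mx.
have e1 : row i Q *m w *m (row i Q *m w)^T = x ord0 i *: (row i Q *m (row i Q)^T).
  rewrite trmx_mul mulmxA -[_ *m w *m w^T]mulmxA E /dconj !mulmxA.
  rewrite -row_mul mulmxV // row1 -rowE row_diag_mx -!scalemxAl; congr (_ *: _).
  by rewrite -rowE.
have := sq_gt0 (row i Q *m w); rewrite e1 mxE.
have r1 : row i Q *m w != 0.
  by apply: contraNneq rQ => /(congr1 (mulmx^~ (invmx w))); rewrite mulmxK // mul0mx => ->.
by move=> /(_ r1); rewrite pmulr_lgt0 // sq_gt0.
Qed.

Lemma poly_nat_non_root (L : fieldType) (p : {poly L}) : [pchar L] =i pred0 ->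
  p != 0 -> exists k : nat, p.[k%:R] != 0.
Proof.
move=> char0 p0; apply: contrapT => h.
have hall k : root p k%:R by apply/rootP/eqP/contraT => px; case: h; exists k.
pose rs := [seq (k%:R : L) | k <- iota 0 (size p)].
have : (size rs < size p)%N.
  apply: max_poly_roots => //; first by apply/allP => x /mapP[k _ ->]; exact: hall.
  rewrite map_inj_uniq ?iota_uniq // => i j /eqP.
  wlog ij : i j / (i <= j)%N => [W e|].
    by have [ij|/ltnW ij] := leqP i j; [apply: W|apply/esym/W; rewrite // eq_sym].
  rewrite -subr_eq0 -oppr_eq0 opprB -natrB // => e; apply/eqP.
  rewrite eqn_leq ij /= -subn_eq0 -(iffLR (pcharf0P L) char0); exact: e.
by rewrite /rs size_map size_iota ltnn.
Qed.

(** * Connectedness of the fixed points of an idempotent integer matrix *)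

Section RationalCurve.
Variables (L : fieldType) (n : nat) (Q : 'M[L]_n) (E : 'M[int]_n).
Hypothesis char0 : [pchar L] =i pred0.
Hypothesis EE : E *m E = E.

(** Functions from the localization of L[t] at D. Leaving the exponent free makes the class closed
    under sums and products. *)
Definition rat_class (D : {poly L}) (c : L -> L) :=
  exists A k, forall t, D.[t] != 0 -> c t = A.[t] / D.[t] ^+ k.

Lemma rat_const D c : rat_class D (fun=> c).
Proof. by exists c%:P, 0%N => t _; rewrite hornerC expr0 divr1. Qed.

Lemma rat_add D g h : rat_class D g -> rat_class D h -> rat_class D (fun t => g t + h t).
Proof.
move=> [A [k hA]] [B [l hB]]; exists (A * D ^+ l + B * D ^+ k), (k + l)%N => t Dt.
rewrite hA // hB // hornerD !hornerM !horner_exp exprD; field.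
by rewrite !expf_neq0.
Qed.

Lemma rat_mul D g h : rat_class D g -> rat_class D h -> rat_class D (fun t => g t * h t).
Proof.
move=> [A [k hA]] [B [l hB]]; exists (A * B), (k + l)%N => t Dt.
by rewrite hA // hB // hornerM exprD; field; rewrite !expf_neq0.
Qed.

Lemma rat_poly D p : rat_class D (fun t => p.[t]).
Proof. by exists p, 0%N => t _; rewrite expr0 divr1. Qed.

Lemma rat_inv D p q : p * q = D -> rat_class D (fun t => p.[t]^-1).
Proof.
move=> pq; exists q, 1%N => t; rewrite -pq hornerM mulf_eq0 negb_or expr1.
by move=> /andP[p0 q0]; field; rewrite p0 q0.
Qed.

Lemma rat_exprz D p q m : p * q = D -> rat_class D (fun t => p.[t] ^ m).
Proof.
move=> pq; case: m => k.
  exact: (class_exp (rat_const D) (@rat_mul D)) (rat_poly D p).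
have -> : (fun t => p.[t] ^ Negz k) = (fun t => p.[t]^-1 ^+ k.+1).
  by apply/funext => t; rewrite exprVn.
exact: (class_exp (rat_const D) (@rat_mul D)) (rat_inv pq).
Qed.

(* Two points p, q of the torus are joined by the rational curve
   t |-> p * E(1 + t (q/p - 1)), all of whose points lie on the torus. *)
Lemma torus_connected : zariski_connected
  [set g | exists x : 'rV[L]_n, [/\ nonzero x, zact E x = x & g = dconj Q x]].
Proof.
set T := [set g | _].
move=> X Y [ps ->] [qs ->] TE dis; apply: contrapT => /not_orP[/eqP/set0P[p Xp] /eqP/set0P[q Yq]].
have : T p by rewrite TE; left.
have : T q by rewrite TE; right.
move=> [y [y0 yE qE]] [x [x0 xE pE]].
pose r := hmul y (\row_i (x ord0 i)^-1).
have r0 : nonzero r by move=> i; rewrite !mxE mulf_neq0 // invr_neq0.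
have zmonV m : zmon (\row_i (x ord0 i)^-1) m = (zmon x m)^-1.
  have xi0 : nonzero (\row_i (x ord0 i)^-1) by move=> i; rewrite mxE invr_neq0.
  apply: (mulfI (zmon_neq0 m x0)); rewrite -zmonM mulfV ?zmon_neq0 //.
  rewrite -(zmon_const1 _ m); congr (zmon _ m); apply/rowP => i.
  by rewrite !mxE mulfV.
have rE : zact E r = r.
  apply/rowP => i; rewrite mxE zmonM zmonV.
  move/rowP/(_ i): yE; rewrite mxE => ->; move/rowP/(_ i): xE; rewrite mxE => ->.
  by rewrite !mxE.
(* The j-th coordinate of the segment from 1 to r = q/p; the curve is defined off the zeros of the
   product D of these polynomials. *)
pose u j : {poly L} := 1 + (r ord0 j - 1) *: 'X.
have uE j t : (u j).[t] = 1 + (r ord0 j - 1) * t by rewrite /u !hornerE.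
pose D := \prod_j u j.
have DE t : D.[t] = \prod_j (u j).[t] by rewrite /D horner_prod.
pose v t : 'rV[L]_n := \row_j (u j).[t].
have v0 t : D.[t] != 0 -> nonzero (v t).
  by rewrite DE => /prodf_neq0 h j; rewrite mxE h.
pose c t := dconj Q (hmul x (zact E (v t))).
have Tc t : D.[t] != 0 -> T (c t).
  move=> /v0 vt; exists (hmul x (zact E (v t))); split=> //.
    by apply: nonzero_hmul => //; exact: nonzero_zact.
  apply/rowP => i; rewrite mxE zmonM zmon_zact // -row_mul EE.
  by move/rowP/(_ i): xE; rewrite mxE => ->; rewrite !mxE.
have c0 : c 0 = p.
  rewrite /c pE; congr dconj; apply/rowP => i; rewrite !mxE.
  rewrite (_ : v 0 = const_mx 1) ?zmon_const1 ?mulr1 //.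
  by apply/rowP => j; rewrite !mxE uE mulr0 addr0.
have v1 : v 1 = r by apply/rowP => j; rewrite mxE uE mulr1 addrC subrK.
have c1 : c 1 = q.
  rewrite /c qE v1 rE; congr dconj; apply/rowP => i; rewrite !mxE.
  by rewrite mulrCA mulfV // mulr1.
have D0 : D.[0] != 0.
  by rewrite DE; apply/prodf_neq0 => j _; rewrite uE mulr0 addr0 oner_neq0.
have D1 : D.[1] != 0.
  by rewrite DE; apply/prodf_neq0 => j _; rewrite uE mulr1 addrC subrK.
have Dn0 : D != 0 by apply: contraNneq D0 => ->; rewrite horner0.
have ratc i j : rat_class D (fun t => c t i j).
  apply: (class_mulmx (rat_const D) (@rat_add D) (@rat_mul D)) => {}i {}j; last first.
    exact: rat_const.
  rewrite (_ : (fun _ => _) = (fun t => invmx Q i j * (x ord0 j * zmon (v t) (row j E)))); last first.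
    by apply/funext => t; rewrite mul_mx_diag !mxE.
  apply: rat_mul; first exact: rat_const.
  apply: rat_mul; first exact: rat_const.
  apply: (class_prod (rat_const D) (@rat_mul D)) => k.
  rewrite (_ : (fun _ => _) = (fun t => (u k).[t] ^ E j k)); last first.
    by apply/funext => t; rewrite !mxE.
  by apply: (@rat_exprz _ _ (\prod_(l | l != k) u l)); rewrite /D [RHS](bigD1 k).
have ratp (a : mxpoly[L]_n) : rat_class D (fun t => mxeval idfun a (c t)).
  exact: (class_mxeval (rat_const D) (@rat_add D) (@rat_mul D)).
have detc t : D.[t] != 0 -> \det (c t) = 1.
  by move=> /Tc; rewrite TE => -[] [].
(* If X contains the whole curve, it contains q. Otherwise some equation a of X fails on the curve;
   its numerator times that of any equation b of Y vanishes at all points off the zeros of D, so b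
   is 0 along the curve and p lies in Y. *)
have [h|/existsNP[a /not_implyP[aps na]]] := pselect (forall a, a \in ps ->
    forall t, D.[t] != 0 -> mxeval idfun a (c t) = 0).
  suff : set0 q by [].
  rewrite -dis; split=> //; split; first by rewrite -c1 detc.
  by move=> a aps; rewrite -c1 h.
suff : set0 p by [].
rewrite -dis; split=> //; split; first by rewrite -c0 detc.
move=> b bqs; rewrite -c0.
have [A [k hA]] := ratp a; have [B [l hB]] := ratp b.
have AB0 : A * B = 0.
  apply/eqP/contraT => AB; have [k0] := poly_nat_non_root char0 (mulf_neq0 AB Dn0).
  move: (k0%:R) => t; rewrite !hornerM !mulf_eq0 !negb_or => /andP[/andP[At Bt] Dt].
  have := Tc _ Dt; rewrite TE => -[[_ h]|[_ h]].
    have := h _ aps; rewrite hA // => /eqP.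
    by rewrite mulf_eq0 (negbTE At) invr_eq0 expf_eq0 (negbTE Dt) andbF.
  have := h _ bqs; rewrite hB // => /eqP.
  by rewrite mulf_eq0 (negbTE Bt) invr_eq0 expf_eq0 (negbTE Dt) andbF.
move/eqP: AB0; rewrite mulf_eq0 => /orP[/eqP A0|/eqP B0].
  by case: na => t Dt; rewrite hA // A0 horner0 mul0r.
by rewrite hB // B0 horner0 mul0r.
Qed.

End RationalCurve.

Section ZariskiClosed.
Variables (L : fieldType) (n : nat).

Definition entry_fun (g : 'M[L]_n -> L) := exists p : mxpoly[L]_n,
  forall s, mxeval idfun p s = g s.

Lemma entry_funP g : poly_fun (fun v : 'rV[L]_(n * n) => g (vec_mx v)) -> entry_fun g.
Proof. by move=> [q hq]; exists q => s; rewrite -[in RHS](mxvecK s) hq. Qed.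

Lemma entry_fun_entry i j : entry_fun (fun s => s i j).
Proof.
apply: entry_funP.
apply: poly_fun_ext (poly_fun_coord L (mxvec_index i j)) => v.
by rewrite -[v in LHS]vec_mxK mxvecE.
Qed.

Lemma entry_fun_const c : entry_fun (fun=> c).
Proof. by apply: entry_funP; exact: poly_fun_const. Qed.

Lemma entry_fun_add g h : entry_fun g -> entry_fun h -> entry_fun (fun s => g s + h s).
Proof.
by move=> [p hp] [q hq]; exists (p + q) => s; rewrite -hp -hq /mxeval rmorphD.
Qed.

Lemma entry_fun_mul g h : entry_fun g -> entry_fun h -> entry_fun (fun s => g s * h s).
Proof.
by move=> [p hp] [q hq]; exists (p * q) => s; rewrite -hp -hq /mxeval rmorphM.
Qed.

Lemma zariski_closed_SLpoints (K : fieldType) (f : K -> L) (ps : seq (mxpoly[K]_n))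
    (g : 'M[L]_n -> L) : entry_fun g ->
  zariski_closed [set s | SLpoints f ps s /\ g s = 0].
Proof.
move=> [q hq].
(* [zariski_closed] asks for equations over L itself, so every equation over K is rewritten with
   coefficients in L. *)
have /choice[F hF] : forall p : mxpoly[K]_n, exists q : mxpoly[L]_n, forall s,
    mxeval idfun q s = mxeval f p s.
  move=> p; exact: (class_mxeval entry_fun_const entry_fun_add entry_fun_mul f p entry_fun_entry).
exists (q :: map F ps); apply/seteqP; split=> s.
  move=> [[ds hs] gs]; split=> // p; rewrite inE => /orP[/eqP->|/mapP[r rps ->]].
    by rewrite hq.
  by rewrite hF hs.
move=> [ds hs]; split; last by rewrite -hq hs // mem_head.
by split=> // p pps; rewrite -hF hs // inE map_f ?orbT.
Qed.

End ZariskiClosed.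

(** * Monomial relations on a diagonalizable group, and tori defined by them *)

Section Relations.
Variables (L : fieldType) (n : nat) (Q : 'M[L]_n).
Hypothesis Qu : Q \in unitmx.
Local Notation coords := (coords Q).

Lemma entry_fun_coords i : entry_fun (fun s => coords s ord0 i).
Proof.
rewrite (_ : (fun _ => _) = (fun s => (Q *m s *m invmx Q) i i)); last first.
  by apply/funext => s; rewrite mxE.
apply: (class_mulmx (@entry_fun_const L n) (@entry_fun_add L n) (@entry_fun_mul L n)).
  move=> {}i j; apply: (class_mulmx (@entry_fun_const L n) (@entry_fun_add L n)
    (@entry_fun_mul L n)) => {}i {}j; [exact: entry_fun_const|exact: entry_fun_entry].
by move=> {}i j; exact: entry_fun_const.
Qed.

(** The positive and negative parts of the exponents turn a Laurent monomial into a quotient of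
    monomials, as equations have to be polynomials. *)
Definition zpos (z : int) : nat := if z is Posz k then k else 0.
Definition zneg (z : int) : nat := if z is Negz k then k.+1 else 0.

Lemma exprz_posneg (x : L) z : x != 0 -> x ^ z = x ^+ zpos z / x ^+ zneg z.
Proof.
by move=> x0; case: z => k /=; rewrite ?divr1 ?div1r //= NegzE exprnN.
Qed.

Definition mon_pos (x : 'rV[L]_n) (m : 'rV[int]_n) := \prod_i x ord0 i ^+ zpos (m ord0 i).
Definition mon_neg (x : 'rV[L]_n) (m : 'rV[int]_n) := \prod_i x ord0 i ^+ zneg (m ord0 i).

Lemma mon_neg_neq0 x m : nonzero x -> mon_neg x m != 0.
Proof. by move=> x0; apply/prodf_neq0 => i _; rewrite expf_neq0. Qed.

Lemma zmon_posneg x m : nonzero x -> zmon x m = mon_pos x m / mon_neg x m.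
Proof.
move=> x0; rewrite /zmon /mon_pos /mon_neg -prodf_div; apply: eq_bigr => i _.
by rewrite exprz_posneg.
Qed.

Variables (K : fieldType) (f : K -> L) (ps : seq (mxpoly[K]_n)).
Hypothesis diagH : forall s, SLpoints f ps s -> is_diag_mx (Q *m s *m invmx Q).
Hypothesis H1 : SLpoints f ps 1%:M.
Hypothesis Hconn : zariski_connected (SLpoints f ps).
Hypothesis char0 : [pchar L] =i pred0.

(* The points of the group where a character of finite order is 1 form a clopen
   subset. *)
Lemma relations_saturated (m : 'rV[int]_n) (N : nat) : (0 < N)%N ->
  (forall s, SLpoints f ps s -> zmon (coords s) m ^+ N = 1) ->
  forall s, SLpoints f ps s -> zmon (coords s) m = 1.
Proof.
move=> N0 hN.
pose A s := mon_pos (coords s) m; pose B s := mon_neg (coords s) m.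
have Apoly : entry_fun A.
  apply: (class_prod (@entry_fun_const L n) (@entry_fun_mul L n)) => i.
  apply: (class_exp (@entry_fun_const L n) (@entry_fun_mul L n)); exact: entry_fun_coords.
have Bpoly : entry_fun B.
  apply: (class_prod (@entry_fun_const L n) (@entry_fun_mul L n)) => i.
  apply: (class_exp (@entry_fun_const L n) (@entry_fun_mul L n)); exact: entry_fun_coords.
have B0 s : SLpoints f ps s -> B s != 0.
  by move=> hs; apply/mon_neg_neq0/(coords_neq0 Qu); [exact: diagH|case: hs].
have zE s : SLpoints f ps s -> zmon (coords s) m = A s / B s.
  by move=> hs; apply/zmon_posneg/(coords_neq0 Qu); [exact: diagH|case: hs].
have XC : zariski_closed [set s | SLpoints f ps s /\ A s + -1 * B s = 0].
  apply: zariski_closed_SLpoints; apply: entry_fun_add => //.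
  by apply: entry_fun_mul => //; exact: entry_fun_const.
(* The cofactor of A - B in A^N - B^N. Where A = B it equals N B^(N-1), which is nonzero in
   characteristic 0, so the two closed sets are disjoint. *)
have YC : zariski_closed [set s | SLpoints f ps s /\
    \sum_(k < N) A s ^+ (N.-1 - k) * B s ^+ k = 0].
  apply: zariski_closed_SLpoints.
  apply: (class_sum (@entry_fun_const L n) (@entry_fun_add L n)) => k.
  by apply: entry_fun_mul;
    apply: (class_exp (@entry_fun_const L n) (@entry_fun_mul L n)).
have XE s : SLpoints f ps s -> (A s + -1 * B s = 0) <-> zmon (coords s) m = 1.
  move=> hs; rewrite zE // mulN1r; split=> [/eqP|e].
    by rewrite subr_eq0 => /eqP->; rewrite divff // B0.
  by rewrite -[A s](mulfVK (B0 _ hs)) e mul1r subrr.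
have prod0 s : SLpoints f ps s -> A s + -1 * B s = 0 \/
    \sum_(k < N) A s ^+ (N.-1 - k) * B s ^+ k = 0.
  move=> hs; have : (A s - B s) * \sum_(k < N) A s ^+ (N.-1 - k) * B s ^+ k = 0.
    have := hN _ hs; rewrite zE // expr_div_n => e.
    have e' : A s ^+ N = B s ^+ N.
      by rewrite -[LHS](@mulfVK _ (B s ^+ N)) ?expf_neq0 ?B0 // e mul1r.
    by rewrite -subrXX e' subrr.
  by move/eqP; rewrite mulf_eq0 -[X in _ - X]mul1r -mulNr => /orP[/eqP h|/eqP h]; [left|right].
have [||X0|Y0] := Hconn XC YC.
- by apply/seteqP; split=> [s hs|s [[]|[]]//]; have [h|h] := prod0 s hs; [left|right].
- apply/seteqP; split=> // s [[hs /(XE _ hs) e] [_ h]].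
  have AB : A s = B s by rewrite -[A s](mulfVK (B0 _ hs)) -zE // e mul1r.
  move/eqP: h; rewrite AB (eq_bigr (fun=> B s ^+ N.-1)) => [|k _].
    rewrite sumr_const card_ord -mulr_natr mulf_eq0 expf_eq0 (negbTE (B0 _ hs)) andbF /=.
    by rewrite (iffLR (pcharf0P L) char0) eqn0Ngt N0.
  by rewrite -exprD subnK // -ltnS prednK.
- suff : set0 (1%:M : 'M[L]_n) by [].
  rewrite -X0; split=> //; apply/XE => //.
  by rewrite -(dconj1 Qu) (coords_dconj Qu) zmon_const1.
move=> s hs; apply/XE => //; have [//|h] := prod0 s hs.
by suff : set0 s by []; rewrite -Y0.
Qed.

End Relations.

Lemma exprz1_exp (L : fieldType) (x : L) c : x ^ c = 1 -> x ^+ `|c|%N = 1.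
Proof.
by case: c => k // /(congr1 GRing.inv); rewrite invr1 /= invrK.
Qed.

(** The relations of H form a saturated lattice, to which [saturated_split] applies. The fixed
    points of E are the smallest torus containing H: a relation m of H satisfies m E = 0, so it
    holds at every fixed point of E. *)
Lemma torus_of_relations (L : fieldType) n (H : set 'rV[L]_n) :
  H `<=` @nonzero L n ->
  (forall m N, (0 < N)%N -> (forall h, H h -> zmon h m ^+ N = 1) ->
     forall h, H h -> zmon h m = 1) ->
  exists E : 'M[int]_n, [/\ E *m E = E, forall h, H h -> zact E h = h
    & forall m, (forall h, H h -> zmon h m = 1) -> m *m E = 0].
Proof.
move=> H0 sat.
have [||||E [EE E1 E0]] := @saturated_split n [set m | forall h, H h -> zmon h m = 1].
- by move=> h _; rewrite zmon0.
- by move=> x y hx hy h Hh; rewrite zmonD ?hx ?hy ?mulr1 //; exact: H0.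
- by move=> c x hx h Hh; rewrite zmonZ hx // exp1rz.
- move=> c x c0 hx; apply: (sat _ `|c|%N); first by rewrite absz_gt0.
  by move=> h /hx; rewrite zmonZ; exact: exprz1_exp.
exists E; split=> // h Hh; apply/rowP => i; rewrite mxE.
have := E1 i h Hh; rewrite linearB /= zmonD ?zmonN; last exact: H0.
have -> : zmon h (row i 1%:M) = h ord0 i.
  by have /rowP/(_ i) := zact1 h; rewrite mxE.
move=> e; rewrite -[RHS](@mulfVK _ (zmon h (row i E))) ?e ?mul1r //.
by apply: zmon_neq0; exact: H0.
Qed.

Section TorusEquations.
Variables (K : rcfType) (n : nat) (Q : 'M[K]_n) (E : 'M[int]_n).
Hypothesis Qu : Q \in unitmx.
Local Notation rc := (@complex.real_complex K : {rmorphism K -> algclosure K}).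
Local Notation Qb := (map_mx rc Q).

Lemma algclosure_char0 : [pchar (algclosure K)] =i pred0.
Proof.
apply/(pcharf0P (algclosure K)) => k; rewrite -(rmorph_nat rc) fmorph_eq0.
by rewrite pnatr_eq0.
Qed.

Lemma Qb_unit : Qb \in unitmx. Proof. by rewrite map_unitmx. Qed.

Definition entry_poly i j : mxpoly[K]_n :=
  \sum_k \sum_l mpoly.mpolyC _ (Q i k * invmx Q l j) *
    mpoly.mpolyX K (mpoly.mnm1 (mxvec_index k l)).

Lemma mxeval_entry_poly (L : fieldType) (f : {rmorphism K -> L}) i j g :
  mxeval f (entry_poly i j) g = (map_mx f Q *m g *m invmx (map_mx f Q)) i j.
Proof.
rewrite /mxeval rmorph_sum -map_invmx mxE.
under [in RHS]eq_bigr do rewrite mxE mulr_suml.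
rewrite [RHS]exchange_big; apply: eq_bigr => k _; rewrite rmorph_sum.
apply: eq_bigr => l _; rewrite rmorphM /= mpoly.mmapC mpoly.mmapX mpoly.mmap1U.
by rewrite mxvecE !mxE [RHS]mulrAC; congr (_ * _); exact: rmorphM.
Qed.

(** The fixed point equation of E in the coordinate i, with denominators cleared. *)
Definition torus_eq_poly i : mxpoly[K]_n :=
  entry_poly i i * \prod_j entry_poly j j ^+ zneg (E i j) -
  \prod_j entry_poly j j ^+ zpos (E i j).

Definition torus_eqs : seq (mxpoly[K]_n) :=
  [seq (if i == j then torus_eq_poly i else entry_poly i j) |
    i <- enum 'I_n, j <- enum 'I_n].

Lemma mxeval_torus_eq_poly (x : 'rV[algclosure K]_n) i : nonzero x ->
  mxeval rc (torus_eq_poly i) (dconj Qb x) = 0 <-> zmon x (row i E) = x ord0 i.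
Proof.
move=> x0.
have eE j : mpoly.mmap rc (fun k => mxvec (dconj Qb x) ord0 k) (entry_poly j j) = x ord0 j.
  have := mxeval_entry_poly rc j j (dconj Qb x).
  by rewrite dconjK ?Qb_unit // mxE eqxx mulr1n.
rewrite /mxeval rmorphB rmorphM !rmorph_prod /= eE.
have pE (z : 'I_n -> nat) : \prod_j mpoly.mmap rc
    (fun k => mxvec (dconj Qb x) ord0 k) (entry_poly j j ^+ z j) =
    \prod_j x ord0 j ^+ z j by apply: eq_bigr => j _; rewrite rmorphXn /= eE.
rewrite !pE zmon_posneg // /mon_pos /mon_neg.
have -> : \prod_j x ord0 j ^+ zneg (row i E ord0 j) = \prod_j x ord0 j ^+ zneg (E i j).
  by apply: eq_bigr => j _; rewrite mxE.
have -> : \prod_j x ord0 j ^+ zpos (row i E ord0 j) = \prod_j x ord0 j ^+ zpos (E i j).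
  by apply: eq_bigr => j _; rewrite mxE.
have n0 : \prod_j x ord0 j ^+ zneg (E i j) != 0.
  by apply/prodf_neq0 => j _; rewrite expf_neq0.
split=> [/eqP|<-]; last by rewrite mulfVK // subrr.
by rewrite subr_eq0 => /eqP <-; rewrite mulfK.
Qed.

Hypothesis E1 : const_mx 1 *m E = 0 :> 'rV[int]_n.

Lemma torus_eqsP g : geom_points torus_eqs g <->
  exists x, [/\ nonzero x, zact E x = x & g = dconj Qb x].
Proof.
have Qbu := Qb_unit; split=> [[dg hg]|[x [x0 xE ->]]].
  have heq i : mxeval rc (torus_eq_poly i) g = 0.
    apply: hg; apply/allpairsP; exists (i, i) => /=.
    by rewrite !mem_enum eqxx.
  have hd : is_diag_mx (Qb *m g *m invmx Qb).
    apply/is_diag_mxP => i j ij; rewrite -mxeval_entry_poly.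
    apply: hg; apply/allpairsP; exists (i, j) => /=.
    by rewrite !mem_enum ifN //; apply: contra ij => /eqP->.
  have c0 := coords_neq0 Qbu hd dg.
  have gE : g = dconj Qb (coords Qb g) by rewrite dconj_coords.
  exists (coords Qb g); split=> //; apply/rowP => i; rewrite mxE.
  by apply/(mxeval_torus_eq_poly i c0); rewrite -gE.
split=> [|p /allpairsP[[i j] /= [_ _ ->]]].
  (* The determinant is the monomial with all exponents 1, and [E1] says that E kills this exponent
     vector. *)
  rewrite det_dconj //; have -> : \prod_i x ord0 i = zmon x (const_mx 1).
    by apply: eq_bigr => i _; rewrite mxE expr1z.
  by rewrite -xE zmon_zact // E1 zmon0.
case: eqVneq => [->|ij].
  by apply/mxeval_torus_eq_poly => //; move/rowP/(_ j): xE; rewrite mxE.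
have := mxeval_entry_poly rc i j (dconj Qb x).
by rewrite dconjK // mxE (negbTE ij) mulr0n.
Qed.

Hypothesis EE : E *m E = E.

Lemma torus_eqs_split : split_torus torus_eqs.
Proof.
have Qbu := Qb_unit.
have TE : geom_points torus_eqs =
    [set g | exists x, [/\ nonzero x, zact E x = x & g = dconj Qb x]].
  by apply/seteqP; split=> g /torus_eqsP.
split.
- rewrite /algebraic_group TE; split.
  + exists (const_mx 1); split; last by rewrite dconj1.
      by move=> i; rewrite mxE oner_neq0.
    by apply/rowP => i; rewrite !mxE zmon_const1.
  + move=> g h [x [x0 xE ->]] [y [y0 yE ->]]; exists (hmul x y).
    split; [exact: nonzero_hmul| |by rewrite dconj_mul].
    apply/rowP => i; rewrite mxE zmonM.
    move/rowP/(_ i): xE; rewrite mxE => ->; move/rowP/(_ i): yE; rewrite mxE => ->.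
    by rewrite mxE.
  + move=> g [x [x0 xE ->]].
    pose y := zact (- 1%:M) x.
    have yi : hmul x y = const_mx 1.
      apply/rowP => i; rewrite !mxE linearN /= zmonN.
      have /rowP/(_ i) := zact1 x; rewrite mxE => ->; exact: mulfV.
    exists y; split; first exact: nonzero_zact.
      rewrite zact_mul // mulmxN mulmx1 /y -{2}xE zact_mul // mulNmx mul1mx //.
    have xu : dconj Qb x \in unitmx.
      by apply: (SLpoints_unit (iffRL (torus_eqsP _) _)); exists x.
    by rewrite -[RHS](mulKmx xu) dconj_mul // yi dconj1 // mulmx1.
- rewrite TE; exact: torus_connected algclosure_char0 EE.
exists Q => // s /torus_eqsP[x [_ _ ->]].
by rewrite dconjK //; exact: diag_mx_is_diag.
Qed.

End TorusEquations.

Lemma dconj_change (L : fieldType) n (P Q T : 'M[L]_n) x y : P \in unitmx ->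
  Q \in unitmx -> Q = T *m P -> T *m diag_mx x = diag_mx y *m T ->
  Q *m dconj P x *m invmx Q = diag_mx y.
Proof.
move=> Pu Qu QT Txy; have -> : Q *m dconj P x = diag_mx y *m Q.
  by rewrite QT /dconj !mulmxA mulmxK // Txy.
by rewrite mulmxK.
Qed.

(** * What the maximality of S gives *)

Section MaximalTorus.
Variables (K : rcfType) (n : nat) (G S : seq (mxpoly[K]_n)).
Hypotheses (HG : algebraic_group G) (HS : maximal_split_torus G S).
Local Notation rc := (@complex.real_complex K : {rmorphism K -> algclosure K}).

Section Diagonalized.
Variables (Q : 'M[K]_n).
Hypothesis HQ : split_by Q S.
Local Notation Qb := (map_mx rc Q).

Let Qbu : Qb \in unitmx. Proof. by apply: Qb_unit; case: HQ. Qed.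
Let HSg : algebraic_group S. Proof. by case: HS => -[]. Qed.

Lemma geomS_sat m N : (0 < N)%N ->
  (forall s, geom_points S s -> zmon (coords Qb s) m ^+ N = 1) ->
  forall s, geom_points S s -> zmon (coords Qb s) m = 1.
Proof.
apply: relations_saturated => //; first by case: HQ.
- by case: HSg.
- by case: HS => -[].
- exact: algclosure_char0.
Qed.

Lemma geom_coordsM s t : geom_points S s -> geom_points S t ->
  coords Qb (s *m t) = hmul (coords Qb s) (coords Qb t).
Proof.
case: HQ => _ d hs ht.
by rewrite -{1}(dconj_coords Qbu (d _ hs)) -{1}(dconj_coords Qbu (d _ ht))
  dconj_mul // coords_dconj.
Qed.

Lemma geom_coords_neq0 s : geom_points S s -> nonzero (coords Qb s).
Proof. by case: HQ => _ d hs; apply: coords_neq0 => //; [exact: d|case: hs]. Qed.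

Lemma geom_coords1 : coords Qb 1%:M = const_mx 1.
Proof. by rewrite -(dconj1 Qbu) coords_dconj. Qed.

(** The coordinates of S and z generate a monoid H with saturated relations. The torus that these
    define is split over K, contains S and z, and lies in G by [torus_closure]; by maximality it is
    S. *)
Lemma maximal_torus_point z zeta : SLpoints idfun G z -> z = dconj Q zeta ->
  (forall i, 0 < zeta ord0 i) -> SLpoints idfun S z.
Proof.
move=> Gz zE z0; have [[S_alg Sconn _] SG Smax] := HS; have [Qu Qd] := HQ.
have Gbz : geom_points G (map_mx rc z) by apply/geom_real.
pose x := map_mx rc zeta.
have zbE : map_mx rc z = dconj Qb x.
  by rewrite zE /dconj !map_mxM map_invmx map_diag_mx.
have x0 : nonzero x by move=> i; rewrite mxE fmorph_eq0 gt_eqF.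
pose xp k : 'rV[algclosure K]_n := \row_i x ord0 i ^+ k.
have xpS k l : xp (k + l)%N = hmul (xp k) (xp l).
  by apply/rowP => i; rewrite !mxE exprD.
have xp0 : xp 0%N = const_mx 1 by apply/rowP => i; rewrite !mxE.
have xp1 : xp 1%N = x by apply/rowP => i; rewrite !mxE.
have xpn k : nonzero (xp k) by move=> i; rewrite mxE expf_neq0.
pose H : set 'rV[algclosure K]_n :=
  [set h | exists s k, geom_points S s /\ h = hmul (coords Qb s) (xp k)].
have hmul1 (h : 'rV[algclosure K]_n) : hmul h (const_mx 1) = h.
  by apply/rowP => i; rewrite !mxE mulr1.
have hmulC (h h' : 'rV[algclosure K]_n) : hmul h h' = hmul h' h.
  by apply/rowP => i; rewrite !mxE mulrC.
have S1 : geom_points S 1%:M by case: S_alg.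
have HS' s : geom_points S s -> H (coords Qb s).
  by move=> hs; exists s, 0%N; rewrite xp0 hmul1.
have H1 : H (const_mx 1) by rewrite -geom_coords1; exact: HS'.
have Hx : H x.
  by exists 1%:M, 1%N; rewrite geom_coords1 xp1 hmulC hmul1.
have H0 : H `<=` @nonzero _ n.
  by move=> _ [s [k [hs ->]]]; apply: nonzero_hmul => //; exact: geom_coords_neq0.
have HM h h' : H h -> H h' -> H (hmul h h').
  move=> [s [k [hs ->]]] [t [l [ht ->]]]; exists (s *m t), (k + l)%N; split.
    by case: S_alg => _ SM _; exact: SM.
  rewrite (geom_coordsM hs ht) xpS; apply/rowP => i.
  rewrite [LHS]mxE [RHS]mxE ![hmul _ _ ord0 i]mxE; exact: mulrACA.
have zmonx m : zmon x m = rc (zmon zeta m).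
  rewrite /zmon rmorph_prod; apply: eq_bigr => i _; rewrite mxE.
  by case: (m ord0 i) => k; rewrite ?NegzE -?exprnN ?fmorphV rmorphXn.
have zmonxp m k : zmon (xp k) m = zmon x m ^+ k.
  elim: k => [|k IH]; first by rewrite xp0 zmon_const1.
  by rewrite -addn1 xpS zmonM IH xp1 addn1 exprSr.
clearbody xp.
(* Saturation: a relation of finite order is trivial on S by [geomS_sat], and at x because its value
   there comes from a positive element of K with N-th power 1. *)
have [m N N0 hN h [s [k [hs ->]]]|E [EE HE E0]] := torus_of_relations H0.
  rewrite zmonM zmonxp (geomS_sat N0 _ hs) => [|t /HS'/hN//].
  have : rc (zmon zeta m ^+ N) = rc 1 by rewrite rmorphXn /= -zmonx hN // rmorph1.
  move=> /fmorph_inj/eqP; rewrite pexpr_eq1 //; last first.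
    by apply: prodr_ge0 => i _; apply: exprz_ge0; exact: ltW.
  by rewrite zmonx => /eqP->; rewrite rmorph1 expr1n mulr1.
have E1 : (const_mx 1 : 'rV[int]_n) *m E = 0.
  apply: E0 => _ [s [k [hs ->]]].
  have prodE (y : 'rV[algclosure K]_n) : zmon y (const_mx 1) = \det (dconj Qb y).
    by rewrite det_dconj //; apply: eq_bigr => i _; rewrite mxE expr1z.
  rewrite zmonM zmonxp !prodE -zbE dconj_coords //; last exact: Qd.
  by case: hs => -> _; case: Gbz => -> _; rewrite expr1n mulr1.
have ST : geom_points S `<=` geom_points (torus_eqs Q E).
  move=> s hs; apply/(torus_eqsP Qu E1); exists (coords Qb s); split.
  - exact: geom_coords_neq0.
  - exact/HE/HS'.
  - by rewrite dconj_coords //; exact: Qd.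
have TG : geom_points (torus_eqs Q E) `<=` geom_points G.
  move=> g /(torus_eqsP Qu E1)[y [y0 yE ->]].
  apply: (@torus_closure _ _ _ Qbu _ _ _ H) => //.
    by move=> m /E0 mE; rewrite -yE zmon_zact // mE zmon0.
  have [G1 GM _] := HG.
  have Gx : geom_points G (dconj Qb x) by rewrite -zbE.
  have Gxp k : geom_points G (dconj Qb (xp k)).
    elim: k => [|k IH]; first by rewrite xp0 dconj1.
    by rewrite -addn1 xpS xp1 -(dconj_mul Qbu); exact: (GM _ _ IH Gx).
  move=> _ [s [k [hs ->]]]; rewrite -(dconj_mul Qbu) (dconj_coords Qbu (Qd _ hs)).
  exact: (GM _ _ (SG _ hs) (Gxp k)).
have := Smax _ (torus_eqs_split Qu E1 EE) TG ST => TS.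
apply/geom_real; rewrite -[geom_points S]TS; apply/(torus_eqsP Qu E1).
by exists x; split=> //; exact: HE.
Qed.

(* Otherwise the coordinates i and j of S are separated by a point of T_E
   having a single coordinate other than 1 before applying E. *)
Lemma coords_separated i j :
  (forall s, pos_points Q S idfun s -> diag_coord Q idfun s i i = diag_coord Q idfun s j j) ->
  forall s, geom_points S s -> coords Qb s ord0 i = coords Qb s ord0 j.
Proof.
move=> hpos; have [Qu Qd] := HQ.
pose H : set 'rV[algclosure K]_n := [set h | exists2 s, geom_points S s & h = coords Qb s].
have H0 : H `<=` @nonzero _ n by move=> _ [s hs ->]; exact: geom_coords_neq0.
have [m N N0 hN h [s hs ->]|E [EE HE E0]] := torus_of_relations H0.
  by apply: (geomS_sat N0) hs => t ht; apply: hN; exists t.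
have [Eij|Eij] := eqVneq (row i E) (row j E).
  move=> s hs; have /HE h : H (coords Qb s) by exists s.
  by rewrite -h mxE Eij !mxE.
have [k Ek] : exists k, E i k != E j k.
  apply/existsP; apply: contraNT Eij => /existsPn h; apply/eqP/rowP => k.
  by have := h k; rewrite negbK !mxE => /eqP.
pose y : 'rV[K]_n := \row_l (if l == k then 2 else 1).
have y0 l : 0 < y ord0 l by rewrite mxE; case: ifP.
have yE l : zmon y (row l E) = 2 ^ E l k.
  rewrite /zmon (bigD1 k) //= big1 ?mulr1 => [|l' l'k]; first by rewrite !mxE eqxx.
  by rewrite !mxE (negbTE l'k) exp1rz.
have yn : nonzero y by move=> l; rewrite gt_eqF.
have mapz : map_mx rc (zact E y) = zact E (map_mx rc y).
  apply/rowP => l; rewrite !mxE rmorph_prod; apply: eq_bigr => l' _; rewrite !mxE.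
  by case: (E l l') => q; rewrite ?NegzE -?exprnN ?fmorphV rmorphXn.
have ybn : nonzero (map_mx rc y) by move=> l; rewrite mxE fmorph_eq0.
have Sy : SLpoints idfun S (dconj Q (zact E y)).
  apply/geom_real.
  have -> : map_mx rc (dconj Q (zact E y)) = dconj Qb (zact E (map_mx rc y)).
    by rewrite -mapz /dconj !map_mxM map_invmx map_diag_mx.
  apply: (@torus_closure _ _ _ Qbu _ _ _ H) => //.
  - by exists 1%:M; [case: HSg|rewrite geom_coords1].
  - move=> _ _ [s hs ->] [t ht ->]; exists (s *m t); last by rewrite geom_coordsM.
    by case: HSg => _ SM _; exact: SM.
  - exact: nonzero_zact.
  - by move=> m /E0 mE; rewrite zmon_zact // mE zmon0.
  - by move=> _ [s hs ->]; rewrite dconj_coords //; exact: Qd.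
have dE : diag_coord Q idfun (dconj Q (zact E y)) = diag_mx (zact E y).
  by have := diag_coord_dconj HQ idfun (zact E y); rewrite map_mx_id.
have Vy : pos_points Q S idfun (dconj Q (zact E y)).
  split=> // l; rewrite dE !mxE eqxx mulr1n yE; exact: exprz_gt0.
have := hpos _ Vy; rewrite dE.
rewrite !mxE !eqxx !mulr1n !yE => e.
by move/eqP: Ek; case; apply: (ieexprIz _ _ e) => //; rewrite pnatr_eq1.
Qed.

End Diagonalized.

Variable P : 'M[K]_n.
Hypothesis HP : split_by P S.
Local Notation Pb := (map_mx rc P).

Definition same_coord i j :=
  `[< forall s, pos_points P S idfun s -> diag_coord P idfun s i i = diag_coord P idfun s j j >].

(** A diagonal matrix D with one value for each class of equal coordinates commutes with z, so that
    some Q diagonalizes both. The change of basis from P to Q only mixes coordinates within a class,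
    hence Q diagonalizes S too. *)
Lemma simultaneous_split (z : 'M[K]_n) : z^T = z ->
  (forall i j, ~~ same_coord i j -> diag_coord P idfun z i j = 0) ->
  exists2 Q, split_by Q S & exists x, z = dconj Q x.
Proof.
move=> zs zij; have [Pu Pd] := HP.
(* A canonical representative of the class of i: the choice made by [pick] depends on the predicate
   only. *)
pose c i := odflt i [pick j | same_coord i j].
have cE i j : (c i == c j) = same_coord i j.
  have rfl k : same_coord k k by apply/asboolP.
  have cs k : same_coord k (c k).
    by rewrite /c; case: pickP => [//|/(_ k)]; rewrite rfl.
  apply/eqP/idP => [e|/asboolP ij].
    have /asboolP h1 := cs i; have /asboolP h2 := cs j.
    by apply/asboolP => s hs; rewrite h1 // e h2.
  rewrite /c (@eq_pick _ _ (same_coord j)) => [|k]; last first.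
    by apply/asboolP/asboolP => h s hs; rewrite -h // ij.
  by case: pickP => // /(_ j); rewrite rfl.
pose d : 'rV[K]_n := \row_i (c i : nat)%:R.
pose D := dconj P d.
pose z' := P *m z *m invmx P.
have z'E i j : ~~ same_coord i j -> z' i j = 0.
  by move=> /zij; rewrite /diag_coord !map_mx_id.
have zE : z = invmx P *m z' *m P by rewrite /z' !mulmxA mulVmx // mul1mx mulmxKV.
clearbody z'.
have dz : diag_mx d *m z' = z' *m diag_mx d.
  apply/matrixP => i j; rewrite mul_diag_mx mul_mx_diag [LHS]mxE [RHS]mxE [d ord0 i]mxE [d ord0 j]mxE.
  have [/eqP ci|ci] := boolP (c i == c j); first by rewrite ci mulrC.
  by rewrite z'E ?mulr0 ?mul0r // -cE.
have Dz : D *m z = z *m D.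
  rewrite zE /D /dconj !mulmxA mulmxK // [in RHS]mulmxK //.
  by rewrite -[_ *m diag_mx d *m z']mulmxA dz !mulmxA.
have : codiagonalizable [:: D; z].
  apply/codiagonalizableP; split.
    move=> A B; rewrite !inE => /orP[]/eqP-> /orP[]/eqP-> //; exact/esym.
  move=> A; rewrite !inE => /orP[]/eqP->.
    exists P => //; apply/diagonalizable_forPex; exists d; apply/simmxP => //.
    by rewrite /D /dconj !mulmxA mulmxV // mul1mx.
  have [Q Qu [x ->]] := sym_diagonalizable zs.
  exists Q => //; apply/diagonalizable_forPex; exists x; apply/simmxP => //.
  by rewrite /dconj !mulmxA mulmxV // mul1mx.
move=> [Q Qu /allP QD].
have /diagonalizable_forPex[e /(simmxP Qu) eE] := QD D (mem_head _ _).
have zin : z \in [:: D; z] by rewrite !inE eqxx orbT.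
have /diagonalizable_forPex[x /(simmxP Qu) xE] := QD z zin.
exists Q; last first.
  by exists x; rewrite /dconj -mulmxA -xE mulmxA mulVmx // mul1mx.
split; first exact: Qu.
move=> s hs.
pose T := Q *m invmx P.
have Tu : T \in unitmx by rewrite unitmx_mul Qu unitmx_inv.
have TD : T *m diag_mx d = diag_mx e *m T.
  rewrite /T !mulmxA -eE /D /dconj !mulmxA.
  by rewrite mulmxK.
have TDE i j : T i j != 0 -> d ord0 j = e ord0 i.
  move=> Tij; have /matrixP/(_ i j) := TD.
  by rewrite mul_diag_mx mul_mx_diag [LHS]mxE [RHS]mxE mulrC => /(mulIf Tij).
have Pbu : Pb \in unitmx by exact: Qb_unit.
pose X := coords Pb s.
have sE : s = dconj Pb X by rewrite dconj_coords //; exact: Pd.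
pose y : 'rV[algclosure K]_n := \row_i (if [pick j | T i j != 0] is Some j then X ord0 j else 0).
have TX : map_mx rc T *m diag_mx X = diag_mx y *m map_mx rc T.
  apply/matrixP => i j; rewrite mul_diag_mx mul_mx_diag ![LHS]mxE [RHS]mxE.
  have [T0|Tn] := eqVneq (T i j) 0; first by rewrite mxE T0 rmorph0 mul0r mulr0.
  rewrite mulrC [X in _ = X * _]mxE; congr (_ * _).
  case: pickP => [k Tk|/(_ j)]; last by rewrite Tn.
  (* [same_coord] compares coordinates at positive points over K; here they must agree at the points
     over K[i]. *)
  apply: coords_separated => //.
  have : c j = c k.
    apply/val_inj; apply/eqP; rewrite -(eqr_nat K); apply/eqP.
    have := TDE _ _ Tn; rewrite -(TDE _ _ Tk) !mxE; exact.
  by move/eqP; rewrite cE => /asboolP.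
have QT : map_mx rc Q = map_mx rc T *m Pb by rewrite -map_mxM /T mulmxKV.
have Qbu : map_mx rc Q \in unitmx by exact: Qb_unit.
rewrite sE (dconj_change Pbu Qbu QT TX).
exact: diag_mx_is_diag.
Qed.

(** Maximality is known over K, and the conclusion is wanted over R. The form w w^T has symmetry and
    positivity built in and makes the statement first-order. *)
Lemma maximal_torus_gram (L : rcfType) (f : {rmorphism K -> L}) (w : 'M[L]_n) :
  SLpoints f G (w *m w^T) ->
  (forall i j, ~~ same_coord i j -> diag_coord P f (w *m w^T) i j = 0) ->
  SLpoints f S (w *m w^T).
Proof.
have D : definable 0 (fun L f (es : seq 'M[L]_n) =>
    forall w : 'M[L]_n, SLpoints f G (w *m w^T) ->
     (forall i j, ~~ same_coord i j -> diag_coord P f (w *m w^T) i j = 0) ->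
     SLpoints f S (w *m w^T)).
  by definability.
move: w; apply/(transfer D) => w hw hij.
have ws : (w *m w^T)^T = w *m w^T by rewrite trmx_mul trmxK.
have [Q HQ [x xE]] := simultaneous_split ws hij.
have wu : w \in unitmx.
  rewrite unitmxE unitfE; apply/eqP => w0; case: hw => + _.
  by rewrite det_mulmx w0 mul0r => /eqP; rewrite eq_sym oner_eq0.
apply: (maximal_torus_point HQ hw xE).
by have [Qu _] := HQ; exact: gram_eigen_gt0 Qu wu xE.
Qed.

End MaximalTorus.

(** * Matrix exponential *)

Section Jets.
Variable R : realType.
Implicit Types (g h : R -> R) (a b c t : R).

(** The expansion g(t) = a + b t + c t^2 + O(t^3) on [-1, 1]. It plays the role of the first two
    derivatives at 0, and its sums and products only need elementary estimates. *)
Definition jet g a b c := exists C : R, forall t, `|t| <= 1 ->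
  `|g t - (a + b * t + c * t ^+ 2)| <= C * `|t| ^+ 3.

Lemma jet_const a : jet (fun=> a) a 0 0.
Proof. by exists 0 => t _; rewrite !mul0r !addr0 subrr normr0. Qed.

Lemma jet_add g h a b c a' b' c' : jet g a b c -> jet h a' b' c' ->
  jet (fun t => g t + h t) (a + a') (b + b') (c + c').
Proof.
move=> [C hC] [D hD]; exists (C + D) => t t1; rewrite [leRHS]mulrDl.
apply: le_trans _ (lerD (hC t t1) (hD t t1)); apply: le_trans _ (ler_normD _ _).
by rewrite le_eqVlt; apply/orP; left; apply/eqP; congr (`|_|); ring.
Qed.

Lemma jet_bound g a b c : jet g a b c -> exists2 B, 0 <= B &
  forall t, `|t| <= 1 -> `|g t| <= B.
Proof.
move=> [C hC]; exists (`|C| + (`|a| + `|b| + `|c|)) => [|t t1].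
  by rewrite !addr_ge0.
have t2 : `|t| ^+ 2 <= 1 by rewrite expr_le1.
have t3 : `|t| ^+ 3 <= 1 by rewrite expr_le1.
rewrite -[g t](subrK (a + b * t + c * t ^+ 2)).
apply: le_trans (ler_normD _ _) _; apply: lerD.
  apply: le_trans (hC t t1) _; apply: le_trans (ler_norm _) _.
  by rewrite normrM [X in _ * X]ger0_norm ?exprn_ge0 // ler_piMr.
apply: le_trans (ler_normD _ _) _; apply: lerD.
  apply: le_trans (ler_normD _ _) _; apply: lerD => //.
  by rewrite normrM ler_piMr.
by rewrite normrM normrX ler_piMr.
Qed.

Lemma jet_mul g h a b c a' b' c' : jet g a b c -> jet h a' b' c' ->
  jet (fun t => g t * h t) (a * a') (a * b' + b * a') (a * c' + b * b' + c * a').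
Proof.
move=> hg hh; have [B B0 hB] := jet_bound hh.
have [C hC] := hg; have [D hD] := hh.
pose P t := a + b * t + c * t ^+ 2.
pose M := `|a| + `|b| + `|c|.
exists (C * B + M * D + (`|b * c' + c * b'| + `|c * c'|)) => t t1.
have PM : `|P t| <= M.
  apply: le_trans (ler_normD _ _) _; apply: lerD.
    apply: le_trans (ler_normD _ _) _; apply: lerD => //.
    by rewrite normrM ler_piMr.
  by rewrite normrM normrX ler_piMr // expr_le1.
have -> : g t * h t - (a * a' + (a * b' + b * a') * t + (a * c' + b * b' + c * a') * t ^+ 2) =
    (g t - P t) * h t + P t * (h t - (a' + b' * t + c' * t ^+ 2)) +
    (b * c' + c * b' + c * c' * t) * t ^+ 3 by rewrite /P; ring.
have C0 : 0 <= C * `|t| ^+ 3 by apply: le_trans _ (hC t t1).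
have D0 : 0 <= D * `|t| ^+ 3 by apply: le_trans _ (hD t t1).
rewrite [leRHS]mulrDl [X in _ <= X + _]mulrDl; apply: le_trans (ler_normD _ _) _; apply: lerD.
  apply: le_trans (ler_normD _ _) _; apply: lerD; rewrite normrM.
    by rewrite mulrAC; apply: ler_pM => //; [exact: hC|exact: hB].
  by rewrite -mulrA; apply: ler_pM => //; exact: hD.
rewrite normrM normrX ler_wpM2r ?exprn_ge0 //.
apply: le_trans (ler_normD _ _) _; apply: lerD => //.
by rewrite [leLHS]normrM ler_piMr.
Qed.

Lemma jet_sum I (r : seq I) (g : I -> R -> R) (a b c : I -> R) :
  (forall i, jet (g i) (a i) (b i) (c i)) ->
  jet (fun t => \sum_(i <- r) g i t) (\sum_(i <- r) a i) (\sum_(i <- r) b i)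
    (\sum_(i <- r) c i).
Proof.
move=> hg; elim: r => [|i r IH].
  rewrite !big_nil (_ : (fun _ => _) = (fun=> 0)); first exact: jet_const.
  by apply/funext => t; rewrite big_nil.
rewrite !big_cons (_ : (fun _ => _) = (fun t => g i t + \sum_(i <- r) g i t)).
  exact: jet_add.
by apply/funext => t; rewrite big_cons.
Qed.

Lemma jet_le g a b c : jet g a b c -> (forall t, g t <= a) -> b = 0 /\ c <= 0.
Proof.
move=> [C hC] ga.
have H t : `|t| <= 1 -> b * t + c * t ^+ 2 <= `|C| * `|t| ^+ 3.
  move=> t1; have := hC t t1; rewrite ler_norml => /andP[h _].
  have C3 : C * `|t| ^+ 3 <= `|C| * `|t| ^+ 3 by rewrite ler_wpM2r ?exprn_ge0 // ler_norm.
  by have := ga t; lra.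
have Hb : forall b', (forall t, 0 < t -> t <= 1 -> b' * t + c * t ^+ 2 <= `|C| * t ^+ 3) ->
    b' <= 0.
  move=> b' hb'; rewrite leNgt; apply/negP => b0.
  (* A point of (0, 1] where the linear term outweighs the others: the inequality at t reduces to b'
     <= t (|c| + |C|) = b' - t b'. *)
  pose t := b' / (b' + `|c| + `|C|).
  have den : 0 < b' + `|c| + `|C| by rewrite -addrA ltr_wpDr // addr_ge0.
  have t0 : 0 < t by rewrite divr_gt0.
  have cC : 0 <= `|c| + `|C| by rewrite addr_ge0.
  have t1 : t <= 1 by rewrite ler_pdivrMr // mul1r -addrA lerDl.
  have := hb' t t0 t1.
  rewrite -[t in b' * t]expr1 (_ : b' * t ^+ 1 + c * t ^+ 2 = (b' + c * t) * t); last by ring.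
  rewrite (_ : `|C| * t ^+ 3 = (`|C| * t ^+ 2) * t); last by ring.
  rewrite ler_pM2r // => h.
  have t2 : `|C| * t ^+ 2 <= `|C| * t by rewrite ler_wpM2l // expr2 ler_piMr // ltW.
  have ct : - (`|c| * t) <= c * t.
    by rewrite -mulNr ler_pM2r // lerNl -normrN ler_norm.
  have e : t * (b' + `|c| + `|C|) = b' by rewrite /t mulfVK // gt_eqF.
  have : t * b' <= 0 by move: h t2 ct e; nra.
  by rewrite leNgt mulr_gt0.
have b0 : b = 0.
  apply: le_anti; apply/andP; split.
    by apply: Hb => t t0 t1; have := H t; rewrite (ger0_norm (ltW t0)) => /(_ t1).
  rewrite -oppr_le0; apply: Hb => t t0 t1.
  by have := H (- t); rewrite normrN (ger0_norm (ltW t0)) sqrrN mulrN mulNr => /(_ t1).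
split=> //; rewrite leNgt; apply/negP => c0.
pose t := c / (c + `|C| + 1).
have den : 0 < c + `|C| + 1 by rewrite -addrA ltr_wpDr // addr_ge0.
have t0 : 0 < t by rewrite divr_gt0.
have t1 : t <= 1 by rewrite ler_pdivrMr // mul1r -addrA lerDl addr_ge0.
have := H t; rewrite (ger0_norm (ltW t0)) b0 mul0r add0r => /(_ t1).
rewrite (_ : `|C| * t ^+ 3 = `|C| * t * t ^+ 2); last by ring.
rewrite ler_pM2r ?exprn_gt0 // => h.
have e : t * (c + `|C| + 1) = c by rewrite /t mulfVK // gt_eqF.
by have := mulr_gt0 t0 c0; move: h e t0; nra.
Qed.

Lemma jet0 b c : jet (fun=> 0) 0 b c -> b = 0 /\ c = 0.
Proof.
move=> h; have [b0 c0] := jet_le h (fun _ => lexx _).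
have h' : jet (fun=> 0) 0 (- b) (- c).
  move: h => [C hC]; exists C => t /hC; rewrite -[in X in X -> _]normrN.
  by move=> hh; apply: le_trans hh; rewrite le_eqVlt; apply/orP; left; apply/eqP;
    congr (`|_|); ring.
have [_ c0'] := jet_le h' (fun _ => lexx _).
by split=> //; apply: le_anti; rewrite c0 -oppr_le0.
Qed.

End Jets.

Section MatrixExponential.
Variables (R : realType) (n : nat).
Implicit Types (X Y Z : 'M[R]_n.+1).

Definition mxnorm1 X : R := \sum_i \sum_j `|X i j|.

Lemma mxnorm1_ge0 X : 0 <= mxnorm1 X.
Proof. by apply: sumr_ge0 => i _; apply: sumr_ge0. Qed.

Lemma exprmx_bound X k i j : `|(X ^+ k) i j| <= mxnorm1 X ^+ k.
Proof.
elim: k i j => [|k IH] i j.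
  by rewrite !expr0 mxE; case: (i == j); rewrite ?normr1 ?normr0.
rewrite exprSr mxE exprSr; apply: le_trans (ler_norm_sum _ _ _) _.
apply: (@le_trans _ _ (\sum_l mxnorm1 X ^+ k * `|X l j|)).
  by apply: ler_sum => l _; rewrite normrM ler_wpM2r.
rewrite -mulr_sumr ler_wpM2l ?exprn_ge0 ?mxnorm1_ge0 //.
by apply: ler_sum => l _; rewrite (bigD1 j) //= lerDl sumr_ge0.
Qed.

Definition mxpsum X N : 'M[R]_n.+1 := \sum_(k < N) (k`!%:R)^-1 *: X ^+ k.

Lemma mxpsumE X N i j : mxpsum X N i j = \sum_(k < N) (X ^+ k) i j / k`!%:R.
Proof. by rewrite summxE; apply: eq_bigr => k _; rewrite mxE mulrC. Qed.

Lemma expcoeff_cvg (c : R) :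
  series (exp_coeff c) N @[N --> \oo] --> expR c.
Proof. exact: is_cvg_series_exp_coeff. Qed.

Lemma cvg_mxpsum X i j : mxpsum X N i j @[N --> \oo] --> mxexp X i j.
Proof.
have e : (fun N => mxpsum X N i j) = series (fun k => (X ^+ k) i j / k`!%:R).
  by apply/funext => N; rewrite mxpsumE /series /= big_mkord.
have c : cvgn (series (fun k => (X ^+ k) i j / k`!%:R)).
  apply: normed_cvg.
  apply: (@series_le_cvg _ _ (exp_coeff (mxnorm1 X))).
  - by move=> k; exact: normr_ge0.
  - by move=> k; rewrite /exp_coeff /= divr_ge0 // exprn_ge0 // mxnorm1_ge0.
  - move=> k /=; rewrite normrM normfV [`|k`!%:R|]ger0_norm // ler_wpM2r ?invr_ge0 //.
    exact: exprmx_bound.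
  - exact: is_cvg_series_exp_coeff.
rewrite e; have -> : mxexp X i j = limn (series (fun k => (X ^+ k) i j / k`!%:R)).
  by rewrite mxE; congr (limn _); apply/funext => N; rewrite /series /= big_mkord.
exact: c.
Qed.

Lemma cvg_mxpsum_mul X (A B : 'M[R]_n.+1) i j :
  (A *m mxpsum X N *m B) i j @[N --> \oo] --> (A *m mxexp X *m B) i j.
Proof.
have E M : (A *m M *m B) i j = \sum_l \sum_k A i k * M k l * B l j.
  by rewrite mxE; apply: eq_bigr => l _; rewrite mxE mulr_suml.
under eq_fun do rewrite E; rewrite E.
apply: cvg_sumr => l; apply: cvg_sumr => k; apply: cvgM; last exact: cvg_cst.
by apply: cvgM; [exact: cvg_cst|exact: cvg_mxpsum].
Qed.

(** Identities for [mxexp] are checked on partial sums between constant matrices and passed to the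
    limit entrywise. *)
Lemma mxexp_unique X (A B : 'M[R]_n.+1) i j (u : nat -> R) l :
  (forall N, (A *m mxpsum X N *m B) i j = u N) -> u N @[N --> \oo] --> l ->
  (A *m mxexp X *m B) i j = l.
Proof.
move=> hu ul; have h := @cvg_mxpsum_mul X A B i j.
have e : (fun N => (A *m mxpsum X N *m B) i j) = u by apply/funext.
rewrite e in h; exact: (cvg_unique _ h ul).
Qed.

Lemma mxexp_conj (Q : 'M[R]_n.+1) X : Q \in unitmx ->
  mxexp (Q *m X *m invmx Q) = Q *m mxexp X *m invmx Q.
Proof.
move=> Qu.
have pw k : (Q *m X *m invmx Q) ^+ k = Q *m (X ^+ k) *m invmx Q.
  elim: k => [|k IH]; first by rewrite !expr0 mulmx1 mulmxV.
  by rewrite !exprS -!mulmxE IH !mulmxA mulmxKV.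
have ps N : mxpsum (Q *m X *m invmx Q) N = Q *m mxpsum X N *m invmx Q.
  rewrite /mxpsum mulmx_sumr mulmx_suml; apply: eq_bigr => k _.
  by rewrite pw -scalemxAr -scalemxAl.
apply/matrixP => i j; apply/esym; apply: mxexp_unique => [N|]; first by rewrite -ps.
exact: cvg_mxpsum.
Qed.

Lemma mxexp_tr X : mxexp X^T = (mxexp X)^T.
Proof.
have pw k : (X^T) ^+ k = (X ^+ k)^T.
  elim: k => [|k IH]; first by rewrite !expr0 trmx1.
  by rewrite exprS exprSr -!mulmxE IH trmx_mul.
by apply/matrixP => i j; rewrite !mxE; congr (limn _); apply/funext => N;
  apply: eq_bigr => k _; rewrite pw mxE.
Qed.

Lemma mxexp_comm X Y : X *m Y = Y *m X -> mxexp X *m Y = Y *m mxexp X.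
Proof.
move=> XY.
have pw k : X ^+ k *m Y = Y *m X ^+ k.
  elim: k => [|k IH]; first by rewrite expr0 mul1mx mulmx1.
  by rewrite exprS -mulmxE -mulmxA IH !mulmxA XY.
have ps N : mxpsum X N *m Y = Y *m mxpsum X N.
  rewrite /mxpsum mulmx_sumr mulmx_suml; apply: eq_bigr => k _.
  by rewrite -scalemxAr -scalemxAl pw.
apply/matrixP => i j.
have h : (1%:M *m mxexp X *m Y) i j = (Y *m mxexp X *m 1%:M) i j.
  apply: mxexp_unique (@cvg_mxpsum_mul X Y 1%:M i j) => N.
  by rewrite mul1mx mulmx1 ps.
by move: h; rewrite mul1mx mulmx1.
Qed.

Lemma mxexp_dconj (Q : 'M[R]_n.+1) (x : 'rV[R]_n.+1) : Q \in unitmx ->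
  mxexp (dconj Q x) = dconj Q (\row_i expR (x ord0 i)).
Proof.
move=> Qu; have := @mxexp_conj (invmx Q) (diag_mx x).
rewrite unitmx_inv invmxK /dconj => /(_ Qu) ->.
congr (_ *m _ *m _).
have pw k : (diag_mx x) ^+ k = diag_mx (\row_i x ord0 i ^+ k).
  elim: k => [|k IH].
    by rewrite expr0 -[1]/(1%:M) -diag_const_mx; congr diag_mx; apply/rowP => i; rewrite !mxE.
  rewrite exprS -mulmxE IH mulmx_diag; congr diag_mx; apply/rowP => i.
  by rewrite !mxE exprS.
apply/matrixP => i j; rewrite -[mxexp _]mul1mx -[_ *m _]mulmx1.
apply: (@mxexp_unique _ _ _ i j
  (fun N => (\sum_(k < N) x ord0 i ^+ k / k`!%:R) *+ (i == j))).
  move=> N; rewrite mul1mx mulmx1 mxpsumE -sumrMnl; apply: eq_bigr => k _.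
  by rewrite pw !mxE mulrnAl.
rewrite ![diag_mx _ i j]mxE [X in _ --> X *+ _]mxE.
have h : (\sum_(k < N) x ord0 i ^+ k / k`!%:R) @[N --> \oo] --> expR (x ord0 i).
  have := @expcoeff_cvg (x ord0 i).
  rewrite (_ : series _ = (fun N => \sum_(k < N) x ord0 i ^+ k / k`!%:R)) //.
  by apply/funext => N; rewrite /series /= big_mkord.
by case: (i == j); [rewrite mulr1n; exact: h|rewrite mulr0n; exact: cvg_cst].
Qed.

Lemma dconjZ (Q : 'M[R]_n.+1) (t : R) (x : 'rV[R]_n.+1) :
  t *: dconj Q x = dconj Q (t *: x).
Proof. by rewrite /dconj linearZ /= -scalemxAr -scalemxAl. Qed.

Lemma mxexp0 : mxexp (0 : 'M[R]_n.+1) = 1%:M.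
Proof.
have Z : 0 = dconj 1%:M (0 : 'rV[R]_n.+1) by rewrite /dconj linear0 mulmx0 mul0mx.
rewrite [in LHS]Z mxexp_dconj ?unitmx1 //; apply: etrans (dconj1 (unitmx1 _ _)).
congr dconj.
by apply/rowP => i; rewrite !mxE expR0.
Qed.

End MatrixExponential.

Section ExponentialInverse.
Variables (R : realType) (n : nat).
Implicit Types (X Y Z : 'M[R]_n.+1).

Lemma exp_psum_le (c : R) N : 0 <= c -> \sum_(k < N) c ^+ k / k`!%:R <= expR c.
Proof.
move=> c0; rewrite -(cvg_lim (@Rhausdorff R) (@expcoeff_cvg R c)).
have -> : \sum_(k < N) c ^+ k / k`!%:R = series (exp_coeff c) N.
  by rewrite /series /= big_mkord.
apply: nondecreasing_cvgn_le; last exact: is_cvg_series_exp_coeff.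
apply/nondecreasing_seqP => k; rewrite /series /= big_nat_recr //= lerDl.
by rewrite /exp_coeff /= divr_ge0 // exprn_ge0.
Qed.

Lemma mxexp_jet X i j : jet (fun t => mxexp (t *: X) i j)
  ((1%:M : 'M[R]_n.+1) i j) (X i j) (((2%:R)^-1 *: (X *m X)) i j).
Proof.
(* For |t| <= 1 the tail from degree 3 on is at most |t|^3 times the sum of the c^k / k!. *)
set c := mxnorm1 X; exists (expR c) => t t1.
have c0 : 0 <= c := mxnorm1_ge0 X.
set r := _ + _ + _.
have pwZ k : (t *: X) ^+ k = t ^+ k *: X ^+ k by rewrite exprZn.
have hlim : `|mxpsum (t *: X) N i j - r| @[N --> \oo] --> `|mxexp (t *: X) i j - r|.
  by apply: cvg_norm; apply: cvgB; [exact: cvg_mxpsum|exact: cvg_cst].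
rewrite -(cvg_lim (@Rhausdorff R) hlim); apply: limr_le.
  by apply/cvg_ex; eexists; exact: hlim.
exists 3%N => // N /= N3.
pose F k := (X ^+ k) i j; pose u k := t ^+ k * F k / k`!%:R.
have -> : mxpsum (t *: X) N i j = \sum_(0 <= k < N) u k.
  by rewrite mxpsumE big_mkord; apply: eq_bigr => k _; rewrite pwZ mxE.
have -> : \sum_(0 <= k < N) u k - r = \sum_(3 <= k < N) u k.
  rewrite (big_cat_nat (leq0n 3) N3) //= addrAC; apply: canLR (subrK _) _.
  rewrite subrr /index_iota /= !big_cons big_nil /u /r /F !expr0 !expr1 !expr2 -mulmxE.
  rewrite [X in X * (t * t)]mxE fact0 (_ : 1`! = 1)%N // (_ : 2`! = 2)%N //.
  by rewrite -[(1 : 'M[R]_n.+1) i j]/((1%:M : 'M[R]_n.+1) i j); field.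
apply: le_trans (ler_norm_sum _ _ _) _.
apply: (@le_trans _ _ (\sum_(3 <= k < N) c ^+ k / k`!%:R * `|t| ^+ 3)).
  rewrite big_nat [leRHS]big_nat; apply: ler_sum => k /andP[k3 _].
  rewrite /u normrM normfV [`|_`!%:R|]ger0_norm // [leRHS]mulrAC.
  rewrite ler_wpM2r ?invr_ge0 // normrM mulrC; apply: ler_pM => //.
    exact: exprmx_bound.
  by rewrite normrX -(subnKC k3) exprD ler_piMr ?exprn_ge0 // exprn_ile1.
rewrite -mulr_suml ler_wpM2r ?exprn_ge0 //.
apply: le_trans (exp_psum_le N c0).
rewrite -(big_mkord xpredT (fun k => c ^+ k / k`!%:R)) [leRHS](big_cat_nat (leq0n 3) N3) //= lerDr.
by apply: sumr_ge0 => k _; rewrite divr_ge0 // exprn_ge0.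
Qed.

(** The binomial theorem: below degree N the truncation is not felt. It is used with e = -1 for
    exp(X) exp(-X), and with e = 1 for the majorant. *)
Lemma exp_poly_coef N (e : R) k : (k < N)%N ->
  (\poly_(k < N) (k`!%:R^-1 : R) * \poly_(k < N) (e ^+ k / k`!%:R))`_k =
  (e + 1) ^+ k / k`!%:R.
Proof.
move=> kN; rewrite coefM exprDn mulr_suml; apply: eq_bigr => i _.
have ik : (i <= k)%N by rewrite -ltnS.
rewrite !coef_poly (leq_ltn_trans ik kN) (leq_ltn_trans (leq_subr _ _) kN).
rewrite expr1n mulr1 -(bin_fact ik) !natrM -mulr_natr.
have f0 m : (m`!%:R : R) != 0 by rewrite pnatr_eq0 -lt0n fact_gt0.
have b0 : ('C(k, i)%:R : R) != 0 by rewrite pnatr_eq0 -lt0n bin_gt0.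
by field; rewrite !f0 b0.
Qed.

Lemma exp_poly_coef_le N (e : R) k : `|e| <= 1 ->
  `|(\poly_(k < N) (k`!%:R^-1 : R) * \poly_(k < N) (e ^+ k / k`!%:R))`_k| <=
  (\poly_(k < N) (k`!%:R^-1 : R) * \poly_(k < N) (1 ^+ k / k`!%:R))`_k.
Proof.
move=> e1; rewrite !coefM; apply: le_trans (ler_norm_sum _ _ _) _; apply: ler_sum => i _.
rewrite !coef_poly normrM; apply: ler_pM => //.
  by case: ifP => _; rewrite ?normr0 // ger0_norm ?invr_ge0.
case: ifP => _; rewrite ?normr0 // expr1n normrM normrX normfV [`|_`!%:R|]ger0_norm //.
by rewrite ler_wpM2r ?invr_ge0 // exprn_ile1.
Qed.

Lemma horner_mx_sum X (p : {poly R}) N : (size p <= N)%N ->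
  horner_mx X p = \sum_(k < N) p`_k *: X ^+ k.
Proof.
move=> sp; rewrite -[in LHS](coefK p) poly_def (big_ord_widen _ (fun k => p`_k *: 'X^k) sp).
rewrite big_mkcond rmorph_sum; apply: eq_bigr => k _.
case: ltnP => kp; first by rewrite /= linearZ /= rmorphXn /= horner_mx_X.
by rewrite rmorph0 nth_default // scale0r.
Qed.

(* The coefficients of p_N(x) p_N(-x), p_N the N-th partial sum of exp, vanish
   in the degrees 1, ..., N - 1 and are bounded by those of p_N(x)^2. *)
Lemma mxexp_mulN X : mxexp X *m mxexp (- X) = 1%:M.
Proof.
pose p N : {poly R} := \poly_(k < N) k`!%:R^-1.
pose q e N : {poly R} := \poly_(k < N) (e ^+ k / k`!%:R).
set c := mxnorm1 X; have c0 : 0 <= c := mxnorm1_ge0 X.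
have pE N : mxpsum X N = horner_mx X (p N).
  rewrite (@horner_mx_sum _ _ N) ?size_poly //; apply: eq_bigr => k _.
  by rewrite coef_poly ltn_ord.
have qE N : mxpsum (- X) N = horner_mx X (q (-1) N).
  rewrite (@horner_mx_sum _ _ N) ?size_poly //; apply: eq_bigr => k _.
  by rewrite coef_poly ltn_ord -scaleN1r exprZn scalerA mulrC.
(* The right-hand side is the part of degree at least N of p_N(x)^2, evaluated at c; both of its
   terms tend to exp(2c). *)
have bnd N i j : (0 < N)%N -> `|(mxpsum X N *m mxpsum (- X) N) i j - (1%:M : 'M[R]_n.+1) i j|
    <= (\sum_(k < N) c ^+ k / k`!%:R) ^+ 2 - \sum_(k < N) (2 * c) ^+ k / k`!%:R.
  move=> N0; rewrite pE qE.
  have -> : horner_mx X (p N) *m horner_mx X (q (-1) N) = horner_mx X (p N * q (-1) N).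
    by rewrite rmorphM.
  have sz (e : R) : (size (p N * q e N)%R <= N + N)%N.
    apply: leq_trans (size_polyMleq _ _) _; apply: leq_trans (leq_pred _) _.
    by apply: leq_add; exact: size_poly.
  rewrite (horner_mx_sum _ (sz _)) summxE.
  rewrite big_split_ord /=.
  have -> : \sum_(k < N) ((p N * q (-1) N)`_k *: X ^+ k) i j = (1%:M : 'M[R]_n.+1) i j.
    rewrite (bigD1 (Ordinal N0)) //= big1 ?addr0 => [|k k0].
      by rewrite exp_poly_coef // !expr0 fact0 divr1 scale1r.
    rewrite exp_poly_coef // addNr expr0n -[(k : nat) == 0%N]/(k == Ordinal N0) (negbTE k0).
    by rewrite mul0r scale0r mxE.
  rewrite addrAC subrr add0r.
  have -> : \sum_(k < N) c ^+ k / k`!%:R = (p N).[c].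
    rewrite horner_poly; apply: eq_bigr => k _; exact: mulrC.
  have -> : (p N).[c] ^+ 2 = (p N * q 1 N).[c].
    rewrite hornerM expr2; congr (_ * _); rewrite !horner_poly; apply: eq_bigr => k _.
    by rewrite expr1n mul1r.
  rewrite (horner_coef_wide _ (sz 1)) big_split_ord /= addrC.
  have -> : \sum_(k < N) (p N * q 1 N)`_k * c ^+ k = \sum_(k < N) (2 * c) ^+ k / k`!%:R.
    by apply: eq_bigr => k _; rewrite exp_poly_coef // exprMn mulrAC.
  rewrite addrK; apply: le_trans (ler_norm_sum _ _ _) _; apply: ler_sum => k _.
  rewrite mxE normrM; apply: ler_pM => //; last exact: exprmx_bound.
  by apply: exp_poly_coef_le; rewrite normrN normr1.
have lim0 : (\sum_(k < N) c ^+ k / k`!%:R) ^+ 2 - \sum_(k < N) (2 * c) ^+ k / k`!%:R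
    @[N --> \oo] --> (0 : R).
  have se (x : R) : \sum_(k < N) x ^+ k / k`!%:R @[N --> \oo] --> expR x.
    have := @expcoeff_cvg R x.
    rewrite (_ : series _ = (fun N => \sum_(k < N) x ^+ k / k`!%:R)) //.
    by apply/funext => N; rewrite /series /= big_mkord.
  have e0 : expR c * expR c - expR (2 * c) = 0.
    by rewrite mulr_natl mulr2n expRD subrr.
  rewrite -[X in _ --> X]e0; apply: cvgB; last exact: se.
  under eq_fun do rewrite expr2.
  by apply: cvgM; exact: se.
apply/matrixP => i j; apply/eqP; rewrite -subr_eq0 -normr_le0.
have hl : `|(mxpsum X N *m mxpsum (- X) N) i j - (1%:M : 'M[R]_n.+1) i j| @[N --> \oo] -->
    `|(mxexp X *m mxexp (- X)) i j - (1%:M : 'M[R]_n.+1) i j|.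
  apply: cvg_norm; apply: cvgB; last exact: cvg_cst.
  under eq_fun do rewrite mxE; rewrite mxE; apply: cvg_sumr => k.
  by apply: cvgM; exact: cvg_mxpsum.
rewrite -(cvg_lim (@Rhausdorff R) hl) -(cvg_lim (@Rhausdorff R) lim0).
apply: ler_lim; [by apply/cvg_ex; eexists; exact: hl|by apply/cvg_ex; eexists; exact: lim0|].
by exists 1%N => // N /= N0; exact: bnd.
Qed.

End ExponentialInverse.

(** A subspace of maximal dimension among those inside A exhausts A. *)
Lemma vspace_of_set (F : fieldType) (V : vectType F) (A : set V) : A 0 ->
  (forall a u v, A u -> A v -> A (a *: u + v)) ->
  exists W : {vspace V}, forall v, v \in W <-> A v.
Proof.
move=> A0 AL.
pose Q k := `[< exists W : {vspace V}, (forall v, v \in W -> A v) /\ \dim W = k >].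
have Q0 : exists k, Q k.
  exists 0%N; apply/asboolP; exists 0%VS; rewrite dimv0; split=> // v.
  by rewrite memv0 => /eqP->.
have Qb k : Q k -> (k <= \dim {:V})%N.
  by move=> /asboolP[W [_ <-]]; apply/dimvS/subvf.
have [k /asboolP[W [WA Wk]] kmax] := ex_maxnP Q0 Qb.
exists W => v; split=> [/WA//|Av]; apply/contraT => vW.
have : Q (\dim (W + <[v]>)%VS).
  apply/asboolP; exists (W + <[v]>)%VS; split=> // _ /memv_addP[w wW [_ /vlineP[a ->] ->]].
  by rewrite addrC; apply: AL => //; exact: WA.
move/kmax; rewrite -Wk leqNgt ltnNge => /negP; case; apply: contra vW => le.
have /eqP -> : W == (W + <[v]>)%VS by rewrite eqEdim addvSl.
by apply: (subvP (addvSr W _)); exact: memv_line.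
Qed.

Section MatrixJets.
Variables (R : realType) (n : nat).
Implicit Types (A B C : 'M[R]_n) (M : R -> 'M[R]_n).

Definition mjet M A B C := forall i j,
  jet (fun t => M t i j) (A i j) (B i j) (C i j).

Lemma mjet_const A : mjet (fun=> A) A 0 0.
Proof. by move=> i j; rewrite !mxE; exact: jet_const. Qed.

Lemma mjet_mul M N A B C A' B' C' : mjet M A B C -> mjet N A' B' C' ->
  mjet (fun t => M t *m N t) (A *m A') (A *m B' + B *m A')
    (A *m C' + B *m B' + C *m A').
Proof.
move=> hM hN i j.
have -> : (fun t => (M t *m N t) i j) = (fun t => \sum_k M t i k * N t k j).
  by apply/funext => t; rewrite mxE.
rewrite !mxE -!big_split /=; apply: jet_sum => k; exact: jet_mul.
Qed.

Lemma mjet_linear_map (f : {linear 'M[R]_n -> R^o}) M A B C : mjet M A B C ->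
  jet (fun t => f (M t) : R) (f A) (f B) (f C).
Proof.
have fE X : (f X : R) = \sum_i \sum_j X i j * f (delta_mx i j).
  rewrite {1}(matrix_sum_delta X) linear_sum; apply: eq_bigr => i _.
  by rewrite linear_sum; apply: eq_bigr => j _; rewrite linearZ.
move=> hM; rewrite (fE A) (fE B) (fE C) (_ : (fun t => _) = (fun t =>
  \sum_i \sum_j M t i j * f (delta_mx i j))); last by apply/funext => t; rewrite fE.
apply: jet_sum => i; apply: jet_sum => j.
have := jet_mul (hM i j) (jet_const (f (delta_mx i j) : R)).
by rewrite !mulr0 !add0r.
Qed.

Lemma mjet_linear (f : 'M[R]_n -> R^o) M A B C : linear f -> mjet M A B C ->
  jet (fun t => f (M t) : R) (f A) (f B) (f C).
Proof.
move=> fl; pose F := HB.pack_for {linear 'M[R]_n -> R^o} f (GRing.isLinear.Build _ _ _ _ f fl).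
exact: (@mjet_linear_map F).
Qed.

End MatrixJets.

Section ExponentialJets.
Variables (R : realType) (n : nat).
Implicit Types X Y : 'M[R]_n.+1.

(** f(X) is the coefficient of t in f(exp(tX)). Linear conditions thus pass from a one-parameter
    group to its generator. *)
Lemma exp_jet0 (f : 'M[R]_n.+1 -> R^o) X : linear f ->
  (forall t, f (mxexp (t *: X)) = 0) -> f X = 0.
Proof.
move=> fl h; have := mjet_linear fl (mxexp_jet X).
rewrite (_ : (fun t => _) = (fun=> 0)); last by apply/funext.
have -> : f 1%:M = 0 by rewrite -(h 0) scale0r mxexp0.
by move/jet0 => [].
Qed.

Lemma exp_sym X : (forall t, (mxexp (t *: X))^T = mxexp (t *: X)) -> X^T = X.
Proof.
move=> h; apply/matrixP => i j; rewrite mxE; apply/eqP; rewrite -subr_eq0; apply/eqP.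
apply: (@exp_jet0 (fun M : 'M[R]_n.+1 => M j i - M i j)) => [c M N|t].
  by rewrite !mxE /GRing.scale /=; ring.
by have /matrixP/(_ i j) := h t; rewrite mxE => ->; rewrite subrr.
Qed.

(** The curve is exp(t ad X) applied to Y, and B is the bracket [X, Y]. *)
Lemma mjet_exp_conj X Y (B := X *m Y - Y *m X) :
  mjet (fun t => mxexp (t *: X) *m Y *m mxexp (t *: - X)) Y B
    (2^-1 *: (X *m B - B *m X)).
Proof.
have := mjet_mul (mjet_mul (mxexp_jet X) (mjet_const Y)) (mxexp_jet (- X)).
rewrite !mulmx0 !mul1mx !mulmx1 !add0r !mulmxN mulNmx opprK [- _ + _]addrC -/B.
rewrite -scalemxAr -scalemxAl -!mulmxA; set c := (X in mjet _ _ _ X).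
suff -> : c = 2^-1 *: (X *m B - B *m X) by [].
rewrite /c /B !mulmxBr !mulmxBl !mulmxA.
move: (X *m X *m Y) (X *m Y *m X) (Y *m X *m X) => p q r.
by apply/matrixP => i j; rewrite !mxE; field.
Qed.

End ExponentialJets.

Section DualBasis.
Variables (F : fieldType) (V : vectType F) (D : seq 'Hom(V, F^o)).
Hypothesis HD : basis_of fullv D.

(** The matrix of the forms in a basis of V is square with independent rows; the columns of its
    inverse are the coordinates of the dual vectors. *)
Lemma dual_basis : exists e : 'I_(size D) -> V,
  (forall j k : 'I_(size D), D`_j (e k) = (j == k)%:R) /\
  forall v : V, v = \sum_(k < size D) (D`_k v : F) *: e k.
Proof.
pose b := vbasis {:V}.
have bV : basis_of fullv b := vbasisP _.
pose M := \matrix_(j < size D, l < \dim {:V}) (D`_j b`_l : F).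
have Mf : row_free M.
  rewrite -kermx_eq0; apply/rowV0P => c /sub_kermxP cM.
  have Df : free (in_tuple D) := basis_free HD.
  have c0 : \sum_j c ord0 j *: D`_j = 0.
    apply/lfunP => v; rewrite zero_lfunE sum_lfunE.
    transitivity (\sum_j \sum_l coord b l v * (c ord0 j * M j l)).
      apply: eq_bigr => j _; rewrite scale_lfunE {1}(coord_basis bV (memvf v)).
      rewrite linear_sum scaler_sumr; apply: eq_bigr => l _.
      by rewrite linearZ mxE /= /GRing.scale /=; ring.
    rewrite exchange_big; apply: big1 => l _ /=; rewrite -mulr_sumr.
    by have /rowP/(_ l) := cM; rewrite !mxE => ->; rewrite mulr0.
  apply/rowP => j; rewrite mxE.
  exact: (elimT (@freeP _ _ _ (in_tuple D)) Df (fun j => c ord0 j) c0 j).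
have sz : size D = \dim {:V}.
  have /esym := @vector.size_basis _ _ _ _ (in_tuple D) HD.
  by rewrite !dimvf /dim /= muln1.
have NM : pinvmx M *m M = 1%:M.
  apply: mulVpmx; apply/eqP; apply: etrans sz; exact: (eqP Mf).
have MN := mulmxVp Mf.
have DE (v : V) (k : 'I_(size D)) : (D`_k v : F) = \sum_l M k l * coord b l v.
  rewrite {1}(coord_basis bV (memvf v)) linear_sum; apply: eq_bigr => l _.
  by rewrite linearZ mxE mulrC.
pose e (k : 'I_(size D)) := \sum_l pinvmx M l k *: b`_l.
exists e; split=> [j k|v].
  rewrite DE; have /matrixP/(_ j k) := MN; rewrite !mxE => <-.
  apply: eq_bigr => l _; congr (_ * _).
  rewrite /e linear_sum (bigD1 l) //= linearZ /= coord_free ?(basis_free bV) // eqxx mulr1.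
  rewrite big1 ?addr0 // => i il.
  by rewrite linearZ /= coord_free ?(basis_free bV) // (negbTE il) mulr0.
rewrite {1}(coord_basis bV (memvf v)) /e.
under [RHS]eq_bigr do rewrite scaler_sumr.
rewrite exchange_big /=; apply: eq_bigr => l _.
under eq_bigr do rewrite scalerA.
rewrite -scaler_suml; congr (_ *: _).
under eq_bigr do rewrite DE mulr_suml.
rewrite exchange_big /=.
have key l' : \sum_k M k l' * coord b l' v * pinvmx M l k = coord b l' v * (l == l')%:R.
  have /matrixP/(_ l l') := NM; rewrite mxE [in RHS]mxE => <-.
  by rewrite mulr_sumr; apply: eq_bigr => k _; ring.
rewrite (bigD1 l) //= key eqxx mulr1 big1 ?addr0 // => l' l'l.
by rewrite key eq_sym (negbTE l'l) mulr0.
Qed.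

End DualBasis.

(** * Lie algebra of the torus and Cartan decomposition over R *)

Section LieTorus.
Variables (R : realType) (K : rcfType) (iR : {rmorphism K -> R}) (n : nat).
Variables (G S : seq (mxpoly[K]_n.+1)) (P : 'M[K]_n.+1).
Hypotheses (HG : algebraic_group G) (HS : algebraic_group S) (HP : split_by P S).
Hypothesis Ssym : forall s, geom_points S s -> s = s^T.
Local Notation Pr := (map_mx iR P).
Local Notation lieA := (lieA iR S).
Local Notation dual := 'Hom(subvs_of lieA, R^o).

Definition expv (x : 'rV[R]_n.+1) : 'rV[R]_n.+1 := \row_i expR (x ord0 i).

Lemma Pr_unit : Pr \in unitmx. Proof. by have := map_unitP HP iR. Qed.

Lemma rpow_expv t x : rpow t (expv x) = expv (t *: x).
Proof. by apply/rowP => i; rewrite !mxE expRK. Qed.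

Lemma mxexp_dconjZ (Q : 'M[R]_n.+1) t x : Q \in unitmx ->
  mxexp (t *: dconj Q x) = dconj Q (rpow t (expv x)).
Proof. by move=> Qu; rewrite dconjZ mxexp_dconj // rpow_expv. Qed.

Lemma expv_gt0 x i : 0 < (expv x) ord0 i.
Proof. by rewrite mxE expR_gt0. Qed.

(** [Lie] picks a subspace by [xget], so one with the defining property has to be exhibited: the
    logarithms of the positive points. They are closed under scaling by [exp_flow], and under sums
    because all of them are diagonal in the coordinates P. *)
Lemma lieA_mem_spec X :
  (X \in lieA <-> forall t : R, pos_points P S iR (mxexp (t *: X))) /\
  (X \in lieA <-> exists2 x, X = dconj Pr x & SLpoints iR S (dconj Pr (expv x))).
Proof.
have Pru := Pr_unit.
pose A0 := [set X : 'M[R]_n.+1 | exists2 x, X = dconj Pr x & SLpoints iR S (dconj Pr (expv x))].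
have A0P Y : A0 Y <-> forall t : R, pos_points P S iR (mxexp (t *: Y)).
  split=> [[x -> hx] t|hY].
    by rewrite mxexp_dconjZ //; apply: pos_points_flow => // i; exact: expv_gt0.
  (* An off-diagonal entry is a linear form vanishing on all exp(tY), so it vanishes at Y. *)
  have dY : is_diag_mx (Pr *m Y *m invmx Pr).
    apply/is_diag_mxP => i j ij.
    apply: (@exp_jet0 _ _ (fun M : 'M[R]_n.+1 => (Pr *m M *m invmx Pr) i j)) => [c M N|t].
      by rewrite mulmxDr mulmxDl -scalemxAr -scalemxAl !mxE.
    have [hS _] := hY t.
    by have := split_diag HP hS ij; rewrite /diag_coord map_invmx.
  exists (coords Pr Y); first by rewrite dconj_coords.
  have [hS _] := hY 1.
  by move: hS; rewrite -{1}(dconj_coords Pru dY) mxexp_dconjZ // rpow_expv scale1r.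
have A00 : A0 0.
  exists 0; first by rewrite /dconj linear0 mulmx0 mul0mx.
  rewrite (_ : expv 0 = const_mx 1) ?dconj1 //; first exact: SLpoints1.
  by apply/rowP => i; rewrite !mxE expR0.
have AL a u v : A0 u -> A0 v -> A0 (a *: u + v).
  move=> [x -> hx] [y -> hy]; exists (a *: x + y).
    by rewrite /dconj linearD linearZ /= mulmxDr mulmxDl -scalemxAr -scalemxAl.
  have -> : expv (a *: x + y) = hmul (rpow a (expv x)) (expv y).
    by rewrite rpow_expv; apply/rowP => i; rewrite !mxE expRD.
  rewrite -dconj_mul //; apply: SLpointsM => //; apply: exp_flow => // i.
  exact: expv_gt0.
have [W WA] := vspace_of_set A00 AL.
suff lW Y : Y \in lieA <-> A0 Y by split=> //; rewrite lW.
rewrite /Defs.lieA /Lie (ApointsE HP HS iR ord0 iR).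
case: xgetP => [W' _ hW'|/(_ W) nW]; first by rewrite (hW' Y) -A0P.
by case: nW => Z; rewrite WA A0P.
Qed.

Lemma lieA_mem X : X \in lieA <-> forall t : R, pos_points P S iR (mxexp (t *: X)).
Proof. by case: (lieA_mem_spec X). Qed.

Lemma lieA_spec X : X \in lieA <->
  exists2 x, X = dconj Pr x & SLpoints iR S (dconj Pr (expv x)).
Proof. by case: (lieA_mem_spec X). Qed.

Lemma lieA_pos X : X \in lieA -> pos_points P S iR (mxexp X).
Proof.
move=> /lieA_spec[x -> hx]; rewrite mxexp_dconj ?Pr_unit //.
by apply/pos_points_dconj => //; split=> // i; exact: expv_gt0.
Qed.

Lemma pos_lieA s : pos_points P S iR s -> exists2 X, X \in lieA & s = mxexp X.
Proof.
move=> hs; have [y y0 sE] := pos_pointsP HP hs.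
pose x : 'rV[R]_n.+1 := \row_i ln (y ord0 i).
have xE : expv x = y by apply/rowP => i; rewrite !mxE lnK // posrE.
exists (dconj Pr x); last by rewrite mxexp_dconj ?Pr_unit // -[\row_i _]/(expv x) xE.
by apply/lieA_spec; exists x => //; rewrite xE -sE; case: hs.
Qed.

Lemma lieA_sym X : X \in lieA -> X^T = X.
Proof.
move=> XA; apply: exp_sym => t; apply: (SLpoints_sym Ssym).
have /lieA_pos[hS _] : t *: X \in lieA by rewrite memvZ.
exact: hS.
Qed.

(** The weights of Lie(A) on the standard representation. *)
Definition lam i (H : subvs_of lieA) : R := (Pr *m vsval H *m invmx Pr) i i.

Lemma lamD i a H H' : lam i (a *: H + H') = a * lam i H + lam i H'.
Proof.
rewrite /lam (_ : vsval _ = a *: vsval H + vsval H'); last by rewrite linearD linearZ.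
by rewrite mulmxDr mulmxDl -scalemxAr -scalemxAl mxE [X in X + _]mxE.
Qed.

Lemma lam_sum i I (r : seq I) (c : I -> R) (e : I -> subvs_of lieA) :
  lam i (\sum_(k <- r) c k *: e k) = \sum_(k <- r) c k * lam i (e k).
Proof.
elim: r => [|k r IH]; last by rewrite !big_cons lamD IH.
rewrite !big_nil /lam (_ : vsval _ = 0); last exact: linear0.
by rewrite mulmx0 mul0mx mxE.
Qed.

Lemma lieA_dconj (H : subvs_of lieA) : vsval H = dconj Pr (\row_i lam i H).
Proof.
have /lieA_spec[x xE _] := subvsP H.
rewrite {1}xE; congr dconj; apply/rowP => i.
by rewrite mxE /lam xE dconjK ?Pr_unit // mxE eqxx mulr1n.
Qed.

(** The entry (i, j) of [H, X] is that of X times the difference of the weights i and j. In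
    particular each root is such a difference, and there are finitely many of them. *)
Lemma root_space_coord (alpha : dual) X i j : root_space G alpha X ->
  (Pr *m X *m invmx Pr) i j != 0 -> forall H, alpha H = lam i H - lam j H :> R.
Proof.
have Pru := Pr_unit.
move=> [_ hX] X0 H; have := congr1 (fun M => Pr *m M *m invmx Pr) (hX H).
rewrite mulmxBr mulmxBl -scalemxAr -scalemxAl => /matrixP/(_ i j).
set X' := Pr *m X *m invmx Pr in X0 *.
have -> : Pr *m (vsval H *m X) *m invmx Pr = diag_mx (\row_i lam i H) *m X'.
  by rewrite lieA_dconj /X' /dconj !mulmxA mulmxV // mul1mx.
have -> : Pr *m (X *m vsval H) *m invmx Pr = X' *m diag_mx (\row_i lam i H).
  by rewrite lieA_dconj /X' /dconj !mulmxA mulmxK.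
clearbody X'.
rewrite mul_diag_mx mul_mx_diag !mxE [X' i j * _]mulrC -mulrBl => /(mulIf X0).
by move=> ->.
Qed.

Lemma roots_lam (alpha : dual) : Defs.roots iR G S alpha ->
  exists ij : 'I_n.+1 * 'I_n.+1, forall H, alpha H = lam ij.1 H - lam ij.2 H :> R.
Proof.
move=> [_ [X X0 hX]].
have [[i j] Xij] : exists ij : 'I_n.+1 * 'I_n.+1, (Pr *m X *m invmx Pr) ij.1 ij.2 != 0.
  apply/existsP; apply: contraNT X0 => /existsPn h.
  have h0 : Pr *m X *m invmx Pr = 0.
    by apply/matrixP => i j; rewrite [RHS]mxE; have := h (i, j); rewrite negbK => /eqP.
  apply/eqP; rewrite -[X](mulKmx Pr_unit) -[Pr *m X](mulmxKV Pr_unit) h0.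
  by rewrite mul0mx mulmx0.
by exists (i, j) => H; exact: root_space_coord hX Xij H.
Qed.

Lemma roots_finite : finite_set (Defs.roots iR G S).
Proof.
pose g (ij : 'I_n.+1 * 'I_n.+1) : dual :=
  xget 0 [set a : dual | forall H, a H = lam ij.1 H - lam ij.2 H :> R].
apply: (@sub_finite_set _ _ (g @` [set` predT])); last by apply: finite_image; exact: finite_finpred.
move=> a /roots_lam[ij h]; exists ij => //; rewrite /g.
case: xgetP => [b _ hb|/(_ a)//]; by apply/lfunP => H; rewrite h; exact: hb.
Qed.

Variable Delta : seq dual.
Hypothesis HDelta : root_basis G Delta.

(* The point of the moment curve in the coordinates dual to Delta avoids the
   finitely many hyperplanes on which two distinct weights agree. *)
Lemma generic_dominant : exists H0 : subvs_of lieA,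
  (forall delta, delta \in Delta -> 0 < (delta H0 : R)) /\
  forall i j, lam i H0 = lam j H0 -> forall H, lam i H = lam j H.
Proof.
have [HB _ _] := HDelta; have [e [eD eV]] := dual_basis HB.
(* As a polynomial in t, the difference of the weights i and j at the point with dual coordinates
   t^k. *)
pose q i j : {poly R} := \poly_(k < size Delta)
  (if insub k is Some k' then lam i (e k') - lam j (e k') else 0).
(* Pairs of identical weights contribute 1, so that the product over all pairs is not the zero
   polynomial. *)
pose q' i j : {poly R} := if q i j == 0 then 1 else q i j.
pose Q : {poly R} := \prod_i \prod_j q' i j.
have q'0 i j : q' i j != 0 by rewrite /q'; case: ifP => [_|->//]; exact: oner_neq0.
have Q0 : Q != 0 by apply/prodf_neq0 => i _; apply/prodf_neq0.
have char0 : [pchar R] =i pred0 by exact: pchar_num.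
(* The additional factor 'X makes t nonzero, hence positive, so that the point is dominant. *)
have [k] := poly_nat_non_root char0 (mulf_neq0 (negbT (polyX_eq0 R)) Q0).
rewrite hornerM hornerX mulf_eq0 negb_or; set t : R := k%:R => /andP[t0 Qt].
have t_gt0 : 0 < t by rewrite lt_def t0 ler0n.
exists (\sum_(k < size Delta) t ^+ k *: e k); split=> [delta /(nthP 0)[l ls <-]|i j].
  rewrite linear_sum (bigD1 (Ordinal ls)) //= big1 ?addr0 => [|m ml].
    by rewrite linearZ /= (eD (Ordinal ls) (Ordinal ls)) eqxx /GRing.scale /= mulr1 exprn_gt0.
  by rewrite linearZ /= (eD (Ordinal ls) m) eq_sym (negbTE ml) /GRing.scale /= mulr0.
rewrite !lam_sum => /eqP; rewrite -subr_eq0 -sumrB => /eqP h0.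
have qt : (q i j).[t] = 0.
  rewrite horner_poly -[RHS]h0; apply: eq_bigr => m _.
  by rewrite valK; ring.
have q0 : q i j = 0.
  apply/eqP; apply: contraTT Qt => qn0; rewrite negbK /Q horner_prod.
  rewrite (bigD1 i) //= horner_prod (bigD1 j) //= /q' (negbTE qn0) qt.
  by rewrite !mul0r.
move=> H; rewrite (eV H) !lam_sum; apply: eq_bigr => m _; congr (_ * _).
have := coef0 R m; rewrite -q0 coef_poly ltn_ord valK => /eqP.
by rewrite subr_eq0 => /eqP.
Qed.

End LieTorus.

(** * Maximization over the compact group K *)

Section CompactGroup.
Variables (R : realType) (n : nat).

Lemma class_det (T : Type) (C : (T -> R) -> Prop) (A : T -> 'M[R]_n) :
  (forall c, C (fun=> c)) -> (forall g h, C g -> C h -> C (fun x => g x + h x)) ->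
  (forall g h, C g -> C h -> C (fun x => g x * h x)) ->
  (forall i j, C (fun x => A x i j)) -> C (fun x => \det (A x)).
Proof.
move=> C1 CD CM hA; apply: (class_sum C1 CD) => s; apply: (CM); first exact: C1.
by apply: (class_prod C1 CM) => i.
Qed.

Lemma closed_level (T : topologicalType) (f : T -> R) (c : R) :
  continuous f -> closed [set x | f x = c].
Proof.
move=> fc; rewrite (_ : [set x | _] = f @^-1` [set c]) //.
by apply: preimage_closed => [x _|]; [exact: fc|exact: closed_eq].
Qed.

Variables (K : rcfType) (iR : {rmorphism K -> R}) (G : seq (mxpoly[K]_n)).
Hypothesis HG : algebraic_group G.
Variable (Y H : 'M[R]_n).

Lemma orthogonal_entry_le (k : 'M[R]_n) : k *m k^T = 1%:M -> forall i j, `|k i j| <= 1.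
Proof.
move=> kk i j; have /matrixP/(_ i i) := kk; rewrite mxE [RHS]mxE eqxx => e.
rewrite -(@expr_le1 _ 2) // real_normK ?num_real // -[leRHS]e (bigD1 j) //= mxE -expr2 lerDl.
by apply: sumr_ge0 => l _; rewrite mxE -expr2 sqr_ge0.
Qed.

(** Orthogonality confines the entries to [-1, 1] and the equations are closed conditions. Matrices
    are flattened to row vectors, for which boxes are known to be compact. *)
Lemma compact_group_max : exists2 k, SLpoints iR G k /\ k *m k^T = 1%:M &
  forall h, SLpoints iR G h -> h *m h^T = 1%:M ->
    \tr (h *m Y *m h^T *m H) <= \tr (k *m Y *m k^T *m H).
Proof.
pose C (f : 'rV[R]_(n * n) -> R) := continuous f.
have C1 c : C (fun=> c) by exact: cst_continuous.
have CD g h : C g -> C h -> C (fun x => g x + h x)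
  by move=> cg ch x; exact: (@cvgD _ R^o _ _ _ _ _ _ _ (cg x) (ch x)).
have CM g h : C g -> C h -> C (fun x => g x * h x)
  by move=> cg ch x; exact: (@cvgM _ _ _ _ _ _ _ _ (cg x) (ch x)).
have CI i j : C (fun x => (vec_mx x : 'M[R]_n) i j).
  rewrite (_ : (fun x => _) = (fun x : 'rV[R]_(n * n) => x ord0 (mxvec_index i j))).
    exact: coord_continuous.
  by apply/funext => x; rewrite mxE.
have CT i j : C (fun x => trmx (vec_mx x : 'M[R]_n) i j).
  rewrite (_ : (fun x => _) = (fun x => (vec_mx x : 'M[R]_n) j i)); first exact: CI.
  by apply/funext => x; rewrite mxE.
pose A := [set x : 'rV[R]_(n * n) | SLpoints iR G (vec_mx x) /\
  (vec_mx x : 'M[R]_n) *m (vec_mx x)^T = 1%:M].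
have Aclosed : closed A.
  have -> : A = [set x | \det (vec_mx x : 'M[R]_n) = 1] `&`
      (\bigcap_(p in [set` G]) [set x | mxeval iR p (vec_mx x) = 0]) `&`
      (\bigcap_(ij in [set: 'I_n * 'I_n])
         [set x | ((vec_mx x : 'M[R]_n) *m (vec_mx x)^T) ij.1 ij.2 = (1%:M : 'M[R]_n) ij.1 ij.2]).
    apply/seteqP; split=> x /=.
      by move=> [[h1 h2] h3]; split; [split|move=> ij _; rewrite /= h3].
    move=> [[h1 h2] h3]; split; first by split.
    by apply/matrixP => i j; exact: (h3 (i, j) I).
  apply: closedI; first apply: closedI.
  - by apply: closed_level; exact: class_det CI.
  - apply: closed_bigI => p _; apply: closed_level; exact: (class_mxeval C1 CD CM).
  - apply: closed_bigI => ij _; apply: closed_level; exact: (class_mulmx C1 CD CM).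
have Acompact : compact A.
  have Bc := @rV_compact _ (n * n) (fun=> `[(-1 : R), 1]%classic) (fun _ => @segment_compact R (-1) 1).
  apply: (subclosed_compact Aclosed Bc).
  move=> x [_ hx] i; case/mxvec_indexP: i => i j.
  have := orthogonal_entry_le hx i j; rewrite mxE ler_norml => /andP[h1 h2].
  by rewrite /= in_itv /= h1.
pose g (x : 'rV[R]_(n * n)) : R := \tr ((vec_mx x : 'M[R]_n) *m Y *m (vec_mx x)^T *m H).
have gc : continuous g.
  apply: (class_sum C1 CD) => i.
  apply: (class_mulmx C1 CD CM) => [{}i j|i' j']; last exact: C1.
  apply: (class_mulmx C1 CD CM) => [{}i {}j|//].
  by apply: (class_mulmx C1 CD CM) => [//|i' j']; exact: C1.
have A0 : A !=set0.
  exists (mxvec 1%:M); rewrite /A /= mxvecK; split; first exact: SLpoints1.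
  by rewrite trmx1 mulmx1.
have [x] := @compact_EVT_max _ _ g A A0 Acompact (continuous_subspaceT gc).
rewrite inE => -[Ax1 Ax2] xmax.
exists (vec_mx x) => // h hG hh; have := xmax (mxvec h).
by rewrite /g mxvecK; apply; rewrite inE /A /= mxvecK.
Qed.

End CompactGroup.

(** * Polar decomposition and the Lie algebra of G *)

Section Polar.
Variables (R : realType) (n : nat).
Implicit Types (X Y Z : 'M[R]_n.+1).

Lemma mxexp_invmx X : invmx (mxexp X) = mxexp (- X).
Proof.
have h := mxexp_mulN X; have [u _] := mulmx1_unit h.
by rewrite -[RHS](mulKmx u) h mulmx1.
Qed.

Lemma mxexp_unit X : mxexp X \in unitmx.
Proof. by have [] := mulmx1_unit (mxexp_mulN X). Qed.

(** Puts exp(tY) into the Gram form that [maximal_torus_gram] asks for. *)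
Lemma mxexp_sym_half Y : Y^T = Y -> forall t,
  mxexp (t *: Y) = mxexp ((t / 2) *: Y) *m (mxexp ((t / 2) *: Y))^T.
Proof.
move=> Ys t; rewrite -mxexp_tr linearZ /= Ys.
have [Q Qu [y ->]] := sym_diagonalizable Ys.
rewrite !mxexp_dconjZ // dconj_mul //; congr dconj; apply/rowP => i.
by rewrite !mxE -expRD -mulrDl -splitr.
Qed.

Lemma tr_mul_trmx_ge0 X : 0 <= \tr (X *m X^T).
Proof.
by apply: sumr_ge0 => i _; rewrite mxE; apply: sumr_ge0 => j _; rewrite mxE -expr2 sqr_ge0.
Qed.

Lemma tr_mul_trmx_eq0 X : \tr (X *m X^T) = 0 -> X = 0.
Proof.
move=> e; apply/matrixP => i j; rewrite [RHS]mxE; apply/eqP; rewrite -sqrf_eq0.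
have h : forall i, (X *m X^T) i i = 0.
  move=> k; move: e; rewrite /mxtrace => /psumr_eq0P -> // l _.
  by rewrite mxE; apply: sumr_ge0 => m _; rewrite mxE -expr2 sqr_ge0.
have := h i; rewrite mxE => /psumr_eq0P h'.
by have := h' _ j isT; rewrite mxE expr2 => -> // l _; rewrite mxE -expr2 sqr_ge0.
Qed.

(** As Q is not orthogonal, the symmetry of x^t cannot be read off [dconj Q]. Powers with natural
    exponents are symmetric, and the symmetry is a polynomial identity in the coordinates, which
    passes to real exponents. *)
Lemma sym_dconj_powers (Q : 'M[R]_n.+1) (x : 'rV[R]_n.+1) (t : R) : Q \in unitmx ->
  (forall i, 0 < x ord0 i) -> (dconj Q x)^T = dconj Q x ->
  (dconj Q (rpow t x))^T = dconj Q (rpow t x).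
Proof.
move=> Qu x0 xs; apply/matrixP => i j; rewrite mxE; apply/eqP; rewrite -subr_eq0; apply/eqP.
apply: (@poly_fun_zmon_vanish _ _ (fun y => dconj Q y j i - dconj Q y i j) (powers x)).
- apply: (@poly_fun_ext _ _ (fun y => dconj Q y j i + (-1) * dconj Q y i j)) => [y|].
    by rewrite mulN1r.
  apply: poly_fun_add; first exact: poly_fun_dconj.
  apply: poly_fun_mul; [exact: poly_fun_const|exact: poly_fun_dconj].
- exact: powers1.
- exact: powers_nonzero.
- exact: powersM.
- by move=> l; rewrite gt_eqF // rpow_gt0.
- by move=> m; exact: powers_rpow.
pose C (A : 'M[R]_n.+1) := A *m dconj Q x = dconj Q x *m A /\ A^T = A.
move=> z hz; suff [_ zs] : C (dconj Q z).
  by move/matrixP/(_ i j): zs; rewrite [LHS]mxE => ->; rewrite subrr.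
apply: (powers_dconj (C := C) Qu _ _ hz); rewrite /C.
  by rewrite trmx1 mulmx1 mul1mx.
by move=> A [Axx As]; split; [rewrite -mulmxA Axx|rewrite trmx_mul xs As Axx].
Qed.

Variables (K : rcfType) (iR : {rmorphism K -> R}) (G : seq (mxpoly[K]_n.+1)).
Hypothesis HG : algebraic_group G.
Hypothesis Gadj : self_adjoint G.

(** Y is half the logarithm of the positive definite matrix g g^T, whose real powers stay in G by
    [exp_flow]. *)
Lemma polar g : SLpoints iR G g -> exists Y, [/\ Y^T = Y,
  forall t, SLpoints iR G (mxexp (t *: Y)) & g *m g^T = mxexp Y *m (mxexp Y)^T].
Proof.
move=> hg; have gs : (g *m g^T)^T = g *m g^T by rewrite trmx_mul trmxK.
have hgg : SLpoints iR G (g *m g^T) by apply: SLpointsM => //; exact: SLpoints_trmx.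
have [Q Qu [x xE]] := sym_diagonalizable gs.
have x0 := gram_eigen_gt0 Qu (SLpoints_unit hg) xE.
pose y : 'rV[R]_n.+1 := \row_i (ln (x ord0 i) / 2).
have eY t : mxexp (t *: dconj Q y) = dconj Q (rpow (t / 2) x).
  rewrite mxexp_dconjZ //; congr dconj; apply/rowP => i.
  by rewrite !mxE expRK; congr expR; ring.
have sY : (dconj Q y)^T = dconj Q y.
  by apply: exp_sym => t; rewrite eY sym_dconj_powers // -xE.
exists (dconj Q y); split=> // [t|].
  by rewrite eY; apply: exp_flow => //; rewrite -xE.
have := mxexp_sym_half sY 2; rewrite divff ?pnatr_eq0 // scale1r => <-.
by rewrite eY divff ?pnatr_eq0 // rpow1.
Qed.

(** Replaces a proof that the Lie algebra of a closed subgroup is a subspace: if [xget] returns its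
    default 0, no root vector exists and the claims about roots become empty. *)
Lemma lieG_spec : (forall X, X \in lieG iR G <-> forall t, SLpoints iR G (mxexp (t *: X)))
  \/ lieG iR G = 0%VS.
Proof. by rewrite /lieG /Lie; case: xgetP => [W -> h|_]; [left|right]. Qed.

Section Bracket.
Hypothesis lieGP : forall X, X \in lieG iR G <-> forall t, SLpoints iR G (mxexp (t *: X)).

(** The curve exp(tX) Y exp(-tX) stays in Lie(G) and has the bracket as its linear coefficient;
    membership is written with linear equations, using a projection onto Lie(G). *)
Lemma lieG_bracket X Y : X \in lieG iR G -> Y \in lieG iR G -> X *m Y - Y *m X \in lieG iR G.
Proof.
set W := lieG iR G => XW YW.
pose M t := mxexp (t *: X) *m Y *m mxexp (t *: - X).
have MW t : M t \in W.
  apply/lieGP => s; have u := mxexp_unit (t *: X).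
  have -> : s *: M t = mxexp (t *: X) *m (s *: Y) *m invmx (mxexp (t *: X)).
    by rewrite mxexp_invmx -scalerN /M -scalemxAr -scalemxAl.
  rewrite mxexp_conj // mxexp_invmx -scalerN.
  have hX := iffLR (lieGP X) XW; have hY := iffLR (lieGP Y) YW.
  apply: SLpointsM => //; first by apply: SLpointsM.
  by rewrite scalerN -scaleNr.
have vE (V : 'M[R]_n.+1) : V \in W <-> forall i j, V i j - projv W V i j = 0.
  split=> [VW i j|h]; first by rewrite projv_id // subrr.
  suff -> : V = projv W V by apply: memv_proj.
  by apply/matrixP => i j; apply/eqP; rewrite -subr_eq0 h.
apply/vE => i j.
have fl : linear (fun V : 'M[R]_n.+1 => V i j - projv W V i j : R^o).
  by move=> c V V'; rewrite linearD linearZ /= !mxE /GRing.scale /=; ring.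
have := mjet_linear fl (mjet_exp_conj X Y).
rewrite (_ : (fun t => _) = (fun=> 0)); last first.
  by apply/funext => t; have /vE/(_ i j) := MW t.
by rewrite (iffLR (vE Y)) // => /jet0[].
Qed.

Lemma lieG_trmx X : X \in lieG iR G -> X^T \in lieG iR G.
Proof.
move=> /lieGP hX; apply/lieGP => t.
by rewrite -linearZ mxexp_tr; apply: SLpoints_trmx.
Qed.

End Bracket.

Lemma skew_exp_orthogonal Z t : Z^T = - Z -> mxexp (t *: Z) *m (mxexp (t *: Z))^T = 1%:M.
Proof. by move=> Zs; rewrite -mxexp_tr linearZ /= Zs scalerN mxexp_mulN. Qed.

(* First and second order conditions at a maximum of tr(k Y k^T H), k in K. *)
Lemma group_max_jets k0 Y H Z : SLpoints iR G k0 -> k0 *m k0^T = 1%:M ->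
  (forall h, SLpoints iR G h -> h *m h^T = 1%:M ->
    \tr (h *m Y *m h^T *m H) <= \tr (k0 *m Y *m k0^T *m H)) ->
  Z^T = - Z -> (forall t, SLpoints iR G (mxexp (t *: Z))) ->
  let Y' := k0 *m Y *m k0^T in
  \tr ((Z *m Y' - Y' *m Z) *m H) = 0 /\
  \tr (((Z *m Y' - Y' *m Z) *m Z - Z *m (Z *m Y' - Y' *m Z)) *m H) >= 0.
Proof.
move=> hk kk kmax Zs hZ Y'.
have fl : linear (fun V : 'M[R]_n.+1 => \tr (V *m H) : R^o).
  by move=> c V V'; rewrite mulmxDl -scalemxAl linearD linearZ.
have := mjet_linear fl (mjet_exp_conj Z Y').
move=> /jet_le[t|e1 e2].
  have hE : SLpoints iR G (mxexp (t *: Z) *m k0) by apply: SLpointsM.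
  have oE : mxexp (t *: Z) *m k0 *m (mxexp (t *: Z) *m k0)^T = 1%:M.
    by rewrite trmx_mul mulmxA -[_ *m k0 *m _]mulmxA kk mulmx1 skew_exp_orthogonal.
  have := kmax _ hE oE; rewrite trmx_mul -mxexp_tr linearZ /= Zs.
  by rewrite /Y' !mulmxA.
split=> //; move: e2; rewrite -scalemxAl mxtraceZ pmulr_rle0 ?invr_gt0 //.
by rewrite -oppr_ge0 -raddfN -mulNmx opprB.
Qed.

End Polar.

Section CartanR.
Variables (R : realType) (K : rcfType) (iR : {rmorphism K -> R}) (n : nat).
Variables (G S : seq (mxpoly[K]_n.+1)) (P : 'M[K]_n.+1).
Hypotheses (HG : algebraic_group G) (Gadj : self_adjoint G).
Hypotheses (HS : maximal_split_torus G S) (HP : split_by P S).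
Hypothesis Ssym : forall s, geom_points S s -> s = s^T.
Local Notation Pr := (map_mx iR P).
Local Notation lieA := (lieA iR S).
Local Notation dual := 'Hom(subvs_of lieA, R^o).
Let HSg : algebraic_group S. Proof. by case: HS => -[]. Qed.
Let SG : geom_points S `<=` geom_points G. Proof. by case: HS. Qed.

Lemma lieA_exp_G H : H \in lieA -> forall t, SLpoints iR G (mxexp (t *: H)).
Proof.
move=> /(lieA_mem iR HSg HP) h t; have [hS _] := h t.
exact: (SLpoints_sub SG hS).
Qed.

(** exp(tY) commutes with the regular H0, so it has no entries between different weights. Being a
    Gram matrix in G, it lies in S by [maximal_torus_gram], and its coordinates are positive. *)
Lemma centralizer_lieA (H0 : subvs_of lieA) Y :
  (forall i j, lam P i H0 = lam P j H0 -> forall H : subvs_of lieA, lam P i H = lam P j H) ->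
  Y^T = Y -> (forall t, SLpoints iR G (mxexp (t *: Y))) ->
  vsval H0 *m Y = Y *m vsval H0 -> Y \in lieA.
Proof.
move=> H0g Ys hY YH; apply/(lieA_mem iR HSg HP) => t.
have Pru := map_unitP HP iR.
have EH : mxexp (t *: Y) *m vsval H0 = vsval H0 *m mxexp (t *: Y).
  by apply: mxexp_comm; rewrite -scalemxAl -scalemxAr YH.
have hw := mxexp_sym_half Ys t; set w := mxexp ((t / 2) *: Y) in hw.
have hS : SLpoints iR S (w *m w^T).
  apply: (maximal_torus_gram HG HS HP); first by rewrite -hw; exact: hY.
  move=> i j ij; rewrite -hw; set E := mxexp _ in EH *.
  (* Weights equal at the regular H0 agree on Lie(A); the coordinates i and j would then agree at
     the points of A over K, whose images over R are exponentials. *)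
  have lij : lam P i H0 != lam P j H0.
    apply: contraNneq ij => /H0g h; apply/asboolP => s hs.
    have hs' : pos_points P S iR (map_mx iR s).
      split; first by apply/SLpoints_map_idfun; case: hs.
      move=> k; rewrite /diag_coord -!map_mxM mxE rcf_rmorph_gt0.
      by case: hs => _ /(_ k); rewrite /diag_coord !map_mx_id.
    have [X XA sE] := pos_lieA HSg HP hs'.
    have := h (Subvs XA); rewrite /lam /= => e.
    have [x xE _] := iffLR (lieA_spec iR HSg HP X) XA.
    apply: (fmorph_inj iR).
    have dE k : iR (diag_coord P idfun s k k) = expR (lam P k (Subvs XA)).
      transitivity (diag_coord P iR (map_mx iR s) k k).
        by rewrite /diag_coord !map_mx_id // -!map_mxM [RHS]mxE.
      rewrite /diag_coord map_invmx sE {1}xE mxexp_dconj // dconjK // /lam /= xE dconjK //.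
      by rewrite !mxE eqxx !mulr1n.
    by rewrite !dE /lam /= e.
  have := congr1 (fun M => Pr *m M *m invmx Pr) EH.
  rewrite (lieA_dconj HSg HP) => /matrixP/(_ i j).
  set l := \row_k _; set E' := diag_coord P iR E.
  have -> : Pr *m (E *m dconj Pr l) *m invmx Pr = E' *m diag_mx l.
    by rewrite /E' /diag_coord /dconj map_invmx !mulmxA mulmxK.
  have -> : Pr *m (dconj Pr l *m E) *m invmx Pr = diag_mx l *m E'.
    by rewrite /E' /diag_coord /dconj map_invmx !mulmxA mulmxV // mul1mx.
  clearbody E'; rewrite mul_mx_diag mul_diag_mx !mxE => /eqP.
  rewrite mulrC -subr_eq0 -mulrBl mulf_eq0 subr_eq0 eq_sym (negbTE lij) /= => /eqP.
  exact.
rewrite hw; split=> // i.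
have wu : w \in unitmx by exact: mxexp_unit.
have wE := split_dconj HP hS.
by have := gram_eigen_gt0 Pru wu wE i; rewrite mxE.
Qed.

Variable Delta : seq dual.
Hypothesis HDelta : root_basis G Delta.

Lemma cartan_lieA g : SLpoints iR G g -> exists k (Y : subvs_of lieA),
  [/\ SLpoints iR G k, k *m k^T = 1%:M, forall delta, delta \in Delta -> 0 <= (delta Y : R)
    & g *m g^T = k *m mxexp (vsval Y) *m (k *m mxexp (vsval Y))^T].
Proof.
move=> hg; have [Y [Ys hY gE]] := polar HG Gadj hg.
have [H0 [H0pos H0g]] := generic_dominant P HDelta.
have [k0 [hk kk] kmax] := compact_group_max iR HG Y (vsval H0).
have kk' : k0^T *m k0 = 1%:M by exact: mulmx1C.
have k0u : k0 \in unitmx := SLpoints_unit hk.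
have kV : k0^T = invmx k0 by rewrite -[RHS](mulKmx k0u) mulKmx // -[LHS](mulKmx k0u) kk mulmx1.
have jets := group_max_jets HG hk kk kmax.
set Y' := k0 *m Y *m k0^T in jets.
have Y's : Y'^T = Y' by rewrite /Y' !trmx_mul trmxK Ys mulmxA.
have hkT := SLpoints_trmx Gadj hk.
have hY' t : SLpoints iR G (mxexp (t *: Y')).
  rewrite /Y' kV scalemxAl scalemxAr mxexp_conj // -kV.
  by apply: SLpointsM => //; apply: SLpointsM.
have YE : Y = k0^T *m Y' *m k0 by rewrite /Y' !mulmxA kk' mul1mx -mulmxA kk' mulmx1.
move: YE; clearbody Y' => YE.
have H0s : (vsval H0)^T = vsval H0 by apply: (lieA_sym HSg HP Ssym); exact: subvsP.
have comm : vsval H0 *m Y' = Y' *m vsval H0.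
  have [lieGP|lieG0] := lieG_spec iR G; last first.
    have D0 : Delta = [::].
      have [_ hD _] := HDelta; case: Delta hD => // d D /(_ d (mem_head _ _)) [_ [X X0 [XG _]]].
      by move: XG X0; rewrite lieG0 memv0 => ->.
    have [HB _ _] := HDelta; have [e [_ eV]] := dual_basis HB.
    have -> : H0 = 0.
      by rewrite (eV H0); apply: big1 => i _; have := ltn_ord i; rewrite {2}D0.
    by rewrite linear0 mul0mx mulmx0.
  (* A bracket of symmetric matrices is skew, so Z is an admissible direction. The first order
     condition along Z is tr(Z Z^T) = 0. *)
  pose Z := vsval H0 *m Y' - Y' *m vsval H0.
  have ZG : Z \in lieG iR G.
    by apply: (lieG_bracket HG lieGP); apply/lieGP => //; apply: lieA_exp_G; exact: subvsP.
  have Zs : Z^T = - Z by rewrite /Z linearB /= !trmx_mul Y's H0s opprB.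
  have [e _] := jets Z Zs (iffLR (lieGP Z) ZG).
  apply/eqP; rewrite -subr_eq0 -/Z; apply/eqP; apply: tr_mul_trmx_eq0.
  have ZE : Z = vsval H0 *m Y' - Y' *m vsval H0 by [].
  clearbody Z; rewrite Zs mulmxN -[RHS]e [in LHS](congr1 (mulmx Z) ZE) mulmxBr mulmxBl.
  by rewrite opprB !mulmxA !raddfB /= -[Y' *m Z *m _]mulmxA [\tr (Y' *m _)]mxtrace_mulC.
have Y'A : Y' \in lieA by exact: (centralizer_lieA H0g Y's hY' comm).
exists k0^T, (Subvs Y'A); split=> //; first by rewrite trmxK.
- move=> d dD; have [_ hD _] := HDelta; have [_ [X X0 XR]] := hD _ dD.
  have [lieGP|lieG0] := lieG_spec iR G; last first.
    by case: XR X0 => + _; rewrite lieG0 memv0 => ->.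
  (* With Z = X - X^T one has [H, Z] = d(H) W for H in Lie(A), so that the second order condition
     along Z reads d(Y') d(H0) tr(W W^T) >= 0. *)
  have [XG XH] := XR; pose W := X + X^T.
  pose Z := X - X^T.
  have ZG : Z \in lieG iR G by rewrite memvB // lieG_trmx.
  have Zs : Z^T = - Z by rewrite /Z linearB /= trmxK opprB.
  have brZ (H : subvs_of lieA) : Z *m vsval H - vsval H *m Z = - ((d H : R) *: W).
    have Hs : (vsval H)^T = vsval H by apply: (lieA_sym HSg HP Ssym); exact: subvsP.
    have h1 := XH H; have h2 := congr1 trmx h1.
    rewrite linearB linearZ /= !trmx_mul Hs in h2.
    rewrite /W scalerDr -h1 -h2 /Z mulmxBl mulmxBr.
    by apply/matrixP => i j; rewrite !mxE; ring.
  have [_] := jets Z Zs (iffLR (lieGP Z) ZG).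
  have := brZ (Subvs Y'A); rewrite /= => ->.
  have brH : vsval H0 *m Z - Z *m vsval H0 = (d H0 : R) *: W by rewrite -opprB brZ opprK.
  have Ws : W^T = W by rewrite /W linearD /= trmxK addrC.
  (* If W = 0, then X is skew, and transposing [H0, X] = d(H0) X yields d(H0) X = - d(H0) X although
     d(H0) > 0. *)
  have Wp : 0 < \tr (W *m W^T).
    rewrite lt_def tr_mul_trmx_ge0 andbT; apply: contra_neq X0 => /tr_mul_trmx_eq0 W0.
    have XT : X^T = - X by apply/eqP; rewrite -addr_eq0 addrC -/W W0.
    have h1 := XH H0; have h2 := congr1 trmx h1.
    rewrite linearB linearZ /= !trmx_mul H0s XT mulNmx mulmxN opprK addrC h1 scalerN in h2.
    have := H0pos d dD => dpos; apply/eqP.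
    have : ((d H0 : R) + d H0) *: X == 0 by rewrite scalerDl {1}h2 addNr.
    by rewrite scaler_eq0 gt_eqF ?addr_gt0.
  set c : R := d _; clearbody Z W.
  have -> : \tr ((- (c *: W) *m Z - Z *m - (c *: W)) *m vsval H0) =
      c * (d H0 * \tr (W *m W^T)).
    rewrite Ws -[d H0 * _]mxtraceZ scalemxAr -brH mulmxBr raddfB /= !mulmxA.
    rewrite mulNmx mulmxN opprK mulmxDl mulNmx -!scalemxAl -!scalemxAr -!scalemxAl.
    rewrite raddfD raddfN /= !mxtraceZ -[Z *m W *m _]mulmxA [\tr (Z *m _)]mxtrace_mulC.
    by rewrite mulrBr addrC.
  by rewrite mulrA pmulr_lge0 // pmulr_lge0 //; exact: H0pos.
have kTV : invmx k0^T = k0 by rewrite kV invmxK.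
rewrite gE; have -> : mxexp Y = k0^T *m mxexp Y' *m k0.
  by rewrite YE; have := @mxexp_conj _ _ k0^T Y'; rewrite kTV; apply; rewrite unitmx_tr.
by rewrite [in LHS]trmx_mul mulmxA -[k0^T *m _ *m k0 *m _]mulmxA kk mulmx1.
Qed.

End CartanR.

(** * Passage to F *)

Section OverF.
Variables (R : realType) (K : rcfType) (iR : {rmorphism K -> R}) (n : nat).
Variables (G S : seq (mxpoly[K]_n.+1)) (P : 'M[K]_n.+1).
Hypotheses (HG : algebraic_group G) (Gadj : self_adjoint G).
Hypotheses (HS : maximal_split_torus G S) (HP : split_by P S).
Hypothesis Ssym : forall s, geom_points S s -> s = s^T.
Local Notation lieA := (lieA iR S).
Local Notation dual := 'Hom(subvs_of lieA, R^o).
Let HSg : algebraic_group S. Proof. by case: HS => -[]. Qed.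

(** States that the choice in [root_char] succeeded, as opposed to returning the polynomial 0. *)
Definition has_root_char (alpha : dual) := alg_character S (root_char alpha) /\
  forall H : subvs_of lieA, mxeval iR (root_char alpha) (mxexp (vsval H)) = expR (alpha H).

Section Character.
Variables (alpha : dual) (Ha : has_root_char alpha).
Variables (F : rcfType) (iF : {rmorphism K -> F}).

Lemma root_charM s t : SLpoints iF S s -> SLpoints iF S t ->
  mxeval iF (root_char alpha) (s *m t) =
  mxeval iF (root_char alpha) s * mxeval iF (root_char alpha) t.
Proof.
have D : definable 0 (fun L f (es : seq 'M[L]_n.+1) =>
    forall s t : 'M[L]_n.+1, SLpoints f S s -> SLpoints f S t ->
    mxeval f (root_char alpha) (s *m t) =
    mxeval f (root_char alpha) s * mxeval f (root_char alpha) t).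
  by definability.
move: s t; apply/(transfer D) => s t /geom_real hs /geom_real ht.
pose rc := @complex.real_complex K : {rmorphism K -> algclosure K}.
apply: (fmorph_inj rc); have [[_ h] _] := Ha.
have E x : rc (mxeval idfun (root_char alpha) x) = mxeval rc (root_char alpha) (map_mx rc x).
  by rewrite -mxeval_map.
by rewrite rmorphM /= !E map_mxM h.
Qed.

Lemma root_char1 : mxeval iF (root_char alpha) 1%:M = 1.
Proof.
have D : definable 0 (fun L f (es : seq 'M[L]_n.+1) =>
    mxeval f (root_char alpha) 1%:M = 1).
  by definability.
apply/(transfer D).
pose rc := @complex.real_complex K : {rmorphism K -> algclosure K}.
apply: (fmorph_inj rc); have [[h _] _] := Ha.
by rewrite -mxeval_map map_mx1 rmorph1.
Qed.

Lemma root_char_gt0 a : pos_points P S iF a -> 0 < mxeval iF (root_char alpha) a.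
Proof.
have D : definable 0 (fun L f (es : seq 'M[L]_n.+1) =>
    forall a : 'M[L]_n.+1, pos_points P S f a -> 0 < mxeval f (root_char alpha) a).
  by definability.
(* Down from F to K and up again to R, where the points of A are exponentials. *)
move: a; apply/(transfer D)/(transfer D iR) => a ha.
have [X XA ->] := pos_lieA HSg HP ha.
by have [_ /(_ (Subvs XA)) ->] := Ha; rewrite expR_gt0.
Qed.

End Character.

Variable Delta : seq dual.
Hypothesis HDelta : root_basis G Delta.
Hypothesis Hchar : forall alpha, Defs.roots iR G S alpha -> has_root_char alpha.

Lemma Delta_char d : d \in Delta -> has_root_char d.
Proof. by case: HDelta => _ h _ /h/Hchar. Qed.

Section Extension.
Variables (F : rcfType) (iF : {rmorphism K -> F}).

(** In [cartan_lieA] the Lie algebra and the exponential are not first-order; the point a = exp(Y)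
    and the values of its simple characters are. Stating the decomposition for g g^T spares the
    second factor in K. *)
Lemma cartan_extension g : SLpoints iF G g -> exists k a,
  [/\ SLpoints iF G k, k *m k^T = 1%:M, pos_points P S iF a,
      forall d, d \in Delta -> 1 <= mxeval iF (root_char d) a
    & g *m g^T = k *m a *m (k *m a)^T].
Proof.
have D : definable 0 (fun L f (es : seq 'M[L]_n.+1) =>
    forall g : 'M[L]_n.+1, SLpoints f G g -> exists k a : 'M[L]_n.+1,
    SLpoints f G k /\ k *m k^T = 1%:M /\ pos_points P S f a /\
    (forall d, d \in Delta -> 1 <= mxeval f (root_char d) a) /\
    g *m g^T = k *m a *m (k *m a)^T).
  by definability.
move=> hg.
suff H : forall g : 'M[F]_n.+1, SLpoints iF G g -> exists k a : 'M[F]_n.+1,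
    SLpoints iF G k /\ k *m k^T = 1%:M /\ pos_points P S iF a /\
    (forall d, d \in Delta -> 1 <= mxeval iF (root_char d) a) /\
    g *m g^T = k *m a *m (k *m a)^T.
  by have [k [a [? [? [? [? ?]]]]]] := H g hg; exists k, a.
apply/(transfer D)/(transfer D iR) => {hg}g hg.
have [k [Y [hk kk dY gE]]] := cartan_lieA HG Gadj HS HP Ssym HDelta hg.
exists k, (mxexp (vsval Y)); do 2 split => //; split; last split=> //.
  by apply: (lieA_pos HSg HP); exact: subvsP.
move=> d dD; have [_ ->] := Delta_char dD.
by rewrite -expR0 ler_expR dY.
Qed.

End Extension.

(** A weight is a real combination of simple roots with the coefficients [lam P i (e k)]. C bounds
    the sums of their absolute values and is rounded up to a natural number, so that [M ^+ C] has a
    meaning over F. *)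
Lemma coord_bound : exists C : nat, forall (F : rcfType) (iF : {rmorphism K -> F})
    (a : 'M[F]_n.+1) (M : F), pos_points P S iF a ->
  (forall d, d \in Delta -> 1 <= mxeval iF (root_char d) a <= M) -> 1 <= M ->
  forall i, diag_coord P iF a i i <= M ^+ C.
Proof.
have [HB _ _] := HDelta; have [e [eD eV]] := dual_basis HB.
pose b : R := \sum_i \sum_(k < size Delta) `|lam P i (e k)|.
have b0 : 0 <= b by apply: sumr_ge0 => i _; apply: sumr_ge0.
have [C bC] : exists C : nat, b <= C%:R.
  by exists (Num.truncn b).+1; apply: ltW; exact: truncnS_gt.
exists C => F iF a M ha hd M1 i.
(* The scalar M is coded as the entry [m i i] of a matrix. *)
have D : definable 0 (fun L f (es : seq 'M[L]_n.+1) =>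
    forall a m : 'M[L]_n.+1, pos_points P S f a ->
    (forall d, d \in Delta -> 1 <= mxeval f (root_char d) a /\ mxeval f (root_char d) a <= m i i) ->
    1 <= m i i ->
    diag_coord P f a i i <= m i i ^+ C).
  by definability.
suff H : forall a m : 'M[F]_n.+1, pos_points P S iF a ->
    (forall d, d \in Delta -> 1 <= mxeval iF (root_char d) a /\ mxeval iF (root_char d) a <= m i i) ->
    1 <= m i i ->
    diag_coord P iF a i i <= m i i ^+ C.
  have := H a (const_mx M) ha; rewrite mxE; apply=> // d /hd /andP[]; split=> //.
apply/(transfer D)/(transfer D iR) => {M1 hd ha}{}a m ha hd M1.
set M1' := m i i in hd M1 *.
have [X XA aE] := pos_lieA HSg HP ha; pose H := Subvs XA.
have cE : diag_coord P iR a i i = expR (lam P i H).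
  have [x xE _] := iffLR (lieA_spec iR HSg HP X) XA.
  have Pru := map_unitP HP iR.
  rewrite /diag_coord map_invmx aE {1}xE mxexp_dconj // dconjK // /lam /= xE.
  by rewrite dconjK // !mxE eqxx !mulr1n.
have M0 : 0 < M1' by apply: lt_le_trans M1; exact: ltr01.
have ME : M1' = expR (ln M1') by rewrite lnK // posrE.
have lnM : 0 <= ln M1' by rewrite ln_ge0.
have dH (k : 'I_(size Delta)) : 0 <= (Delta`_k H : R) <= ln M1'.
  have kD : Delta`_k \in Delta by exact: mem_nth.
  have := hd _ kD; rewrite aE; have [_ /(_ H) /= ->] := Delta_char kD.
  move=> [h1 h2]; apply/andP; split; first by rewrite -ler_expR expR0.
  by rewrite -ler_expR -ME.
have lamH : `|lam P i H| <= ln M1' *+ C.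
  rewrite {1}(eV H) lam_sum; apply: le_trans (ler_norm_sum _ _ _) _.
  apply: (@le_trans _ _ (\sum_(k < size Delta) ln M1' * `|lam P i (e k)|)).
    apply: ler_sum => k _; rewrite normrM ler_wpM2r //.
    by have /andP[h1 h2] := dH k; rewrite ger0_norm.
  rewrite -mulr_sumr -mulr_natr ler_wpM2l //; apply: le_trans bC.
  by rewrite /b [leRHS](bigD1 i) //= lerDl; apply: sumr_ge0 => j _; apply: sumr_ge0.
have MC : M1' ^+ C = expR (ln M1' *+ C) by rewrite -mulr_natr mulrC expRM_natl -ME.
by rewrite cE MC ler_expR (le_trans _ lamH) // ler_norm.
Qed.

End OverF.

Lemma lfun_mulrn (R : nzRingType) (V W : vectType R) (f : 'Hom(V, W)) k x :
  (f *+ k) x = f x *+ k.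
Proof. by elim: k => [|k IH]; rewrite ?mulr0n ?zero_lfunE // !mulrS add_lfunE IH. Qed.

Section Unipotent.
Variables (R : realType) (K : rcfType) (iR : {rmorphism K -> R}) (n : nat).
Variables (G S : seq (mxpoly[K]_n.+1)) (P : 'M[K]_n.+1).
Hypotheses (HSg : algebraic_group S) (HP : split_by P S).
Local Notation lieA := (lieA iR S).
Local Notation dual := 'Hom(subvs_of lieA, R^o).
Variable Delta : seq dual.
Hypothesis HDelta : root_basis G Delta.
Variables (F : rcfType) (iF : {rmorphism K -> F}).

Lemma diag_coordD (L : rcfType) (f : {rmorphism K -> L}) X Y :
  diag_coord P f (X + Y) = diag_coord P f X + diag_coord P f Y.
Proof. by rewrite /diag_coord mulmxDr mulmxDl. Qed.

Lemma diag_coordZ (L : rcfType) (f : {rmorphism K -> L}) c X :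
  diag_coord P f (c *: X) = c *: diag_coord P f X.
Proof. by rewrite /diag_coord -scalemxAr -scalemxAl. Qed.

Lemma diag_coord_sum (L : rcfType) (f : {rmorphism K -> L}) I (r : seq I) (X : I -> 'M[L]_n.+1) :
  diag_coord P f (\sum_(i <- r) X i) = \sum_(i <- r) diag_coord P f (X i).
Proof.
elim: r => [|i r IH]; last by rewrite !big_cons diag_coordD IH.
by rewrite !big_nil /diag_coord mulmx0 mul0mx.
Qed.

Lemma diag_coord1 (L : rcfType) (f : {rmorphism K -> L}) : diag_coord P f 1%:M = 1%:M.
Proof. by rewrite /diag_coord mulmx1 map_invmx mulmxV // (map_unitP HP). Qed.

Lemma diag_coordM (L : rcfType) (f : {rmorphism K -> L}) X Y :
  diag_coord P f (X *m Y) = diag_coord P f X *m diag_coord P f Y.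
Proof. by rewrite /diag_coord map_invmx !mulmxA mulmxKV // (map_unitP HP). Qed.

(* For the ordering of the coordinates by the weights at a dominant point, the
   elements of U are unitriangular. *)
Lemma Upoints_diag u : Upoints iF G Delta u -> forall i, diag_coord P iF u i i = 1.
Proof.
move=> [X hX ->].
have [H0 [H0pos _]] := generic_dominant P HDelta.
pose h i := lam P i H0.
have posH alpha : positive_roots G Delta alpha -> 0 < (alpha H0 : R).
  move=> [[a0 _] [c aE]].
  have ge0 (k : 'I_(size Delta)) : 0 <= (Delta`_k H0 : R) *+ c k.
    by rewrite mulrn_wge0 // ltW // H0pos // mem_nth.
  have aH : alpha H0 = \sum_(k < size Delta) (Delta`_k H0 : R) *+ c k.
    by rewrite aE sum_lfunE; apply: eq_bigr => k _; rewrite lfun_mulrn.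
  rewrite lt_def aH sumr_ge0 ?andbT //; apply: contraNneq a0 => e.
  rewrite aE; apply/eqP; apply: big1 => k _.
  move/psumr_eq0P: e => /(_ (fun k _ => ge0 k) k isT)/eqP; rewrite mulrn_eq0.
  by case/orP=> [/eqP->|]; rewrite ?mulr0n // gt_eqF // H0pos // mem_nth.
(* A nonzero entry (i, j) of a real root vector forces alpha(H0) = h i - h j, which is positive. The
   vanishing passes to the F-extension of the root space by transfer. *)
have XU alpha i j : positive_roots G Delta alpha -> h i <= h j ->
    diag_coord P iF (X alpha) i j = 0.
  move=> ha hij; have [D DE] := hX _ ha.
  have Dd : definable 0 (fun L f (es : seq 'M[L]_n.+1) =>
      forall x : 'M[L]_n.+1, sa_points f D x -> diag_coord P f x i j = 0).
    by definability.
  move: (X alpha); apply/(transfer Dd)/(transfer Dd iR) => x; rewrite -DE => hx.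
  rewrite /diag_coord map_invmx; apply/eqP/negPn/negP => x0.
  have := root_space_coord HSg HP hx x0 H0; have := posH _ ha => + e.
  by rewrite e subr_gt0 ltNge hij.
set N := \sum_(alpha \in _) _.
have NU i j : h i <= h j -> diag_coord P iF N i j = 0.
  move=> hij; rewrite /N fsbig_finite; last first.
    apply: (sub_finite_set _ (roots_finite iR G HSg HP)) => alpha [].
    by [].
  rewrite diag_coord_sum summxE big_seq; apply: big1 => alpha.
  rewrite in_fset_set ?inE => [|]; last first.
    apply: (sub_finite_set _ (roots_finite iR G HSg HP)) => beta [].
    by [].
  by move=> ha; exact: XU.
have NkU k i j : h i <= h j -> diag_coord P iF (N ^+ k.+1) i j = 0.
  elim: k i j => [|k IH] i j hij; first by rewrite expr1 NU.
  rewrite exprS -mulmxE diag_coordM mxE; apply: big1 => l _.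
  have [hil|hli] := leP (h i) (h l); first by rewrite NU // mul0r.
  by rewrite IH ?mulr0 // (le_trans (ltW hli)).
move=> i; rewrite /nilexp diag_coord_sum summxE big_ord_recl.
rewrite expr0 fact0 invr1 scale1r diag_coord1 mxE eqxx big1 ?addr0 // => k _.
by rewrite diag_coordZ mxE NkU // mulr0.
Qed.

End Unipotent.

(** * The building *)

Section ConvexSubring.
Variables (R : realType) (K F : rcfType) (iR : {rmorphism K -> R}) (iF : {rmorphism K -> F}).
Variables (O : {pred F}) (HO : order_convex_subring O).

Lemma O_1 : 1 \in O. Proof. by case: HO => -[]. Qed.

Lemma O_B x y : x \in O -> y \in O -> x - y \in O.
Proof. by case: HO => -[_ h _] _; exact: h. Qed.

Lemma O_M x y : x \in O -> y \in O -> x * y \in O.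
Proof. by case: HO => -[_ _ h] _; exact: h. Qed.

Lemma O_0 : 0 \in O. Proof. by rewrite -(subrr 1) O_B ?O_1. Qed.

Lemma O_D x y : x \in O -> y \in O -> x + y \in O.
Proof. by move=> hx hy; rewrite -[y]opprK O_B // -sub0r O_B // O_0. Qed.

Lemma O_sum I (r : seq I) (Q : pred I) (f : I -> F) : (forall i, Q i -> f i \in O) ->
  \sum_(i <- r | Q i) f i \in O.
Proof. by move=> h; elim/big_ind: _ => //; [exact: O_0|exact: O_D]. Qed.

Lemma O_prod I (r : seq I) (Q : pred I) (f : I -> F) : (forall i, Q i -> f i \in O) ->
  \prod_(i <- r | Q i) f i \in O.
Proof. by move=> h; elim/big_ind: _ => //; [exact: O_1|exact: O_M]. Qed.

Lemma O_X x k : x \in O -> x ^+ k \in O.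
Proof. by move=> hx; elim: k => [|k IH]; rewrite ?O_1 // exprS O_M. Qed.

Lemma O_le x y : y \in O -> 0 <= x <= y -> x \in O.
Proof. by case: HO => _ h hy; exact: h O_0 hy. Qed.

Lemma O_norm x y : y \in O -> `|x| <= y -> x \in O.
Proof.
case: HO => _ h hy; rewrite ler_norml; apply: h => //.
by rewrite -sub0r O_B ?O_0.
Qed.

(** A natural number exceeds |x| in the archimedean field R; the inequality descends to K and passes
    on to F. *)
Lemma O_const x : iF x \in O.
Proof.
pose m := (Num.truncn `|iR x|).+1.
apply: (@O_norm _ m%:R); first by elim: m => [|m IH]; rewrite ?O_0 // -addn1 natrD O_D ?O_1.
have : `|iR x| <= m%:R by apply: ltW; exact: truncnS_gt.
have xm : `|x| <= m%:R -> `|iF x| <= m%:R.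
  by rewrite !ler_norml -!(rmorph_nat iF) -!rmorphN /= !rcf_rmorph_le.
rewrite ler_norml -!(rmorph_nat iR) -!rmorphN /= !rcf_rmorph_le => h.
by apply: xm; rewrite ler_norml.
Qed.

Section Matrices.
Variable n : nat.
Implicit Types M N : 'M[F]_n.

Definition mxO M := forall i j, M i j \in O.

Lemma mxO_mul M N : mxO M -> mxO N -> mxO (M *m N).
Proof. by move=> hM hN i j; rewrite mxE; apply: O_sum => k _; exact: O_M. Qed.

Lemma mxO_map (A : 'M[K]_n) : mxO (map_mx iF A).
Proof. by move=> i j; rewrite mxE O_const. Qed.

Lemma mxO_tr M : mxO M -> mxO M^T.
Proof. by move=> h i j; rewrite mxE. Qed.

Lemma mxO_mxeval (p : mxpoly[K]_n) M : mxO M -> mxeval iF p M \in O.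
Proof.
move=> h; apply: O_sum => m _; apply: O_M; first exact: O_const.
apply: O_prod => k _; apply: O_X; case/mxvec_indexP: k => i j.
by rewrite mxvecE.
Qed.

Lemma O_sign (b : nat) : (-1 : F) ^+ b \in O.
Proof. by apply: O_X; rewrite -sub0r O_B ?O_0 ?O_1. Qed.

Lemma O_det m (M : 'M[F]_m) : (forall i j, M i j \in O) -> \det M \in O.
Proof.
by move=> h; apply: O_sum => s _; apply: O_M; [exact: O_sign|apply: O_prod => i _].
Qed.

Lemma mxO_inv M : \det M = 1 -> mxO M -> mxO (invmx M).
Proof.
move=> d h i j; rewrite /invmx unitmxE d unitr1 invr1 scale1r mxE.
apply: O_M; first exact: O_sign.
by apply: O_det => k l; rewrite !mxE.
Qed.

(** The diagonal of M M^T bounds the squares of the entries of M, and |x| <= 1 + x^2; convexity of O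
    does the rest. *)
Lemma mxO_gram M N : M *m M^T = N *m N^T -> mxO N -> mxO M.
Proof.
move=> e hN i j; apply: (@O_norm _ (1 + (M *m M^T) i i)).
  by apply: O_D; [exact: O_1|rewrite e; apply: mxO_mul => //; exact: mxO_tr].
have h : M i j ^+ 2 <= (M *m M^T) i i.
  rewrite mxE (bigD1 j) //= mxE -expr2 lerDl.
  by apply: sumr_ge0 => k _; rewrite mxE -expr2 sqr_ge0.
apply: le_trans (lerD (lexx 1) h); rewrite -real_normK ?num_real //.
by have := normr_ge0 (M i j); set x := `|_|; nra.
Qed.

Lemma mxO_orthogonal M : M *m M^T = 1%:M -> mxO M.
Proof.
move=> e; apply: (@mxO_gram _ 1%:M); first by rewrite e trmx1 mulmx1.
by move=> i j; rewrite mxE; case: (i == j); rewrite ?O_1 ?O_0.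
Qed.

End Matrices.

End ConvexSubring.

Section BasePoint.
Variables (R : realType) (K F : rcfType) (iR : {rmorphism K -> R}) (iF : {rmorphism K -> F}).
Variables (O : {pred F}) (HO : order_convex_subring O) (n : nat).
Variables (G S : seq (mxpoly[K]_n.+1)) (P : 'M[K]_n.+1).
Hypotheses (HG : algebraic_group G) (Gadj : self_adjoint G).
Hypotheses (HS : maximal_split_torus G S) (HP : split_by P S).
Hypothesis Ssym : forall s, geom_points S s -> s = s^T.
Local Notation dual := 'Hom(subvs_of (lieA iR S), R^o).
Variable Delta : seq dual.
Hypothesis HDelta : root_basis G Delta.
Let HSg : algebraic_group S. Proof. by case: HS => -[]. Qed.
Let SG : geom_points S `<=` geom_points G. Proof. by case: HS. Qed.
Let rfin : finite_set (Defs.roots iR G S). Proof. exact: roots_finite HSg HP. Qed.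
Local Notation o := (base_point iF O G Delta).

(** Equality of cosets means that N is a unit of O. The last condition excludes N = 0, whose inverse
    is 0 by convention. *)
Lemma dist_eq0 x y : dist iF O G Delta x y = Lambda0 O <->
  Nprod iR iF G S (delta iF G Delta x y) \in O /\
  (Nprod iR iF G S (delta iF G Delta x y))^-1 \in O /\
  Nprod iR iF G S (delta iF G Delta x y) != 0.
Proof.
rewrite /dist /negv /Lambda0; set N := Nprod _ _ _ _ _; split=> [e|[h1 [h2 h3]]].
  have : Ocoset O 1 1 by exists 1; rewrite ?mulr1 //; split; rewrite ?oner_neq0 ?invr1 ?O_1.
  rewrite -e => -[c [c0 hc hc'] /esym cE].
  have N0 : N != 0.
    by apply: contraTneq (oner_neq0 F) => N0; rewrite cE N0 invr0 mul0r eqxx.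
  have NE : N = c by rewrite -[N]mulr1 cE mulrA mulfV // mul1r.
  by rewrite NE.
apply/seteqP; split=> _ [c [c0 hc hc'] <-].
  exists (N^-1 * c); last by rewrite mul1r.
  by split; [rewrite mulf_neq0 ?invr_eq0|exact: O_M|rewrite invfM invrK; exact: O_M].
exists (N * c); last by rewrite mul1r mulKf.
by split; [rewrite mulf_neq0|exact: O_M|rewrite invfM; exact: O_M].
Qed.

Lemma NprodE : exists2 r : seq dual, (forall alpha, alpha \in r <-> Defs.roots iR G S alpha) &
  forall a, Nprod iR iF G S a =
    \prod_(alpha <- r) Num.max (chi iF alpha a) (chi iF alpha a)^-1.
Proof.
have /finite_seqP[r rE] := rfin; have E : Defs.roots iR G S = [set` undup r].
  by rewrite rE; apply/seteqP; split=> x /=; rewrite mem_undup.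
exists (undup r) => [alpha|a]; first by rewrite E.
by rewrite /Nprod E (fsbig_seq _ _ (undup_uniq r)).
Qed.

(* The junk value 0 of root_char at a root without character makes N vanish. *)
Lemma base_point_empty alpha : Defs.roots iR G S alpha -> ~ has_root_char alpha -> o = set0.
Proof.
move=> ha hn; apply/seteqP; split=> // y [_ /dist_eq0[_ [_]]]; case/negP.
have [r rP ->] := NprodE; rewrite prodf_seq_eq0; apply/hasP.
exists alpha; first by apply/rP.
have -> : chi iF alpha (delta iF G Delta 1%:M y) = 0.
  rewrite /chi /root_char; case: xgetP => [c _ hc|_].
    by case: hn; rewrite /has_root_char /root_char; case: xgetP => [//|/(_ c)].
  by rewrite /mxeval rmorph0.
by rewrite invr0 maxxx eqxx.
Qed.

Hypothesis Hchar : forall alpha, Defs.roots iR G S alpha -> has_root_char alpha.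

Lemma prod_ge1_le (T : eqType) (r : seq T) (f : T -> F) : (forall x, x \in r -> 1 <= f x) ->
  1 <= \prod_(x <- r) f x /\ forall x, x \in r -> f x <= \prod_(x <- r) f x.
Proof.
elim: r => [|y r IH] h; first by rewrite big_nil.
have [|h1 h2] := IH; first by move=> x xr; apply: h; rewrite inE xr orbT.
have fy : 1 <= f y by apply: h; rewrite mem_head.
rewrite big_cons; split; first exact: mulr_ege1.
move=> x; rewrite inE => /orP[/eqP->|/h2 fx].
  by rewrite ler_peMr // (le_trans ler01).
by apply: le_trans fx _; rewrite ler_peMl // (le_trans ler01).
Qed.

Lemma chi_le_Nprod a : pos_points P S iF a -> 1 <= Nprod iR iF G S a /\
  forall alpha, Defs.roots iR G S alpha -> chi iF alpha a <= Nprod iR iF G S a.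
Proof.
move=> ha; have [r rP ->] := NprodE.
have [|h1 h2] := @prod_ge1_le _ r (fun alpha => Num.max (chi iF alpha a) (chi iF alpha a)^-1).
  move=> alpha /rP hr; have c0 : 0 < chi iF alpha a := root_char_gt0 HS HP (Hchar hr) ha.
  rewrite le_max; have [//|/ltW c1] := leP 1 (chi iF alpha a).
  by rewrite invf_ge1.
by split=> // alpha /rP hr; apply: le_trans (h2 _ hr); rewrite le_max lexx.
Qed.

(** The values chi(a) and chi(a)^-1 = chi(a^-1) are polynomials over K in the entries of a and a^-1,
    which lie in O. As N >= 1, its inverse lies in O by convexity. *)
Lemma Nprod_units a : pos_points P S iF a -> mxO O a ->
  [/\ Nprod iR iF G S a \in O, (Nprod iR iF G S a)^-1 \in O & Nprod iR iF G S a != 0].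
Proof.
move=> ha aO; have [N1 _] := chi_le_Nprod ha; have N0 := lt_le_trans ltr01 N1.
split; last by rewrite gt_eqF.
  have [r rP ->] := NprodE; rewrite big_seq; apply: (O_prod HO) => alpha /rP hr.
  have [hS _] := ha; have hc := Hchar hr; have au := SLpoints_unit hS.
  have c1 : chi iF alpha a \in O by exact: (mxO_mxeval iR).
  have cV : (chi iF alpha a)^-1 = chi iF alpha (invmx a).
    have c0 : 0 < chi iF alpha a := root_char_gt0 HS HP hc ha.
    apply: (mulfI (lt0r_neq0 c0)); rewrite mulfV ?gt_eqF // /chi.
    rewrite -(root_charM hc) ?mulmxV ?(root_char1 hc) //; exact: SLpointsV.
  have c2 : (chi iF alpha a)^-1 \in O.
    by rewrite cV /chi; apply: (mxO_mxeval iR iF HO); apply: (mxO_inv HO) => //; case: hS.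
  by rewrite maxEle; case: ifP.
apply: (O_le HO (O_1 HO)); rewrite invr_ge0 (ltW N0) /=.
by rewrite invf_le1.
Qed.

Lemma mxO_split s : SLpoints iF S s -> (forall i, diag_coord P iF s i i \in O) -> mxO O s.
Proof.
move=> hS h; rewrite (split_dconj HP hS) /dconj -map_invmx.
apply: (mxO_mul HO); last exact: (mxO_map iR iF HO).
apply: (mxO_mul HO); first exact: (mxO_map iR iF HO).
move=> i j; rewrite mxE [X in X *+ _]mxE.
by case: eqP => _; rewrite ?mulr1n // mulr0n (O_0 HO).
Qed.

Lemma base_pointP y : o y <-> exists2 h, SLpoints iF G h /\ mxO O h & y = h *m h^T.
Proof.
have act1 (g : 'M[F]_n.+1) : Defs.act g 1%:M = g *m g^T by rewrite /Defs.act mulmx1.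
have G1 := SLpoints1 HG iF.
have K1 : Kpoints iF G 1%:M by split=> //; rewrite trmx1 mulmx1 det1.
split=> [[[g hg yE] /dist_eq0[NO _]]|[h [hG hO] ->]].
  rewrite act1 in yE.
  (* Provides a candidate for [delta], which rules out the default of [xget] in this direction. *)
  have [k [a [hk kk ha ad gE]]] := cartan_extension HG Gadj HS HP Ssym HDelta Hchar hg.
  move: NO; rewrite /delta; case: xgetP =>
    [a' _ [[Aa' a'd] [g1 [g2 [k1 [k2 [[hg1 hg2] E1 E2 [hk1 hk2] E3]]]]]] NO|/(_ a) h _].
    have ha' : pos_points P S iF a' by move: Aa'; rewrite (ApointsE HP HSg iR ord0).
    rewrite !act1 in E1 E2; exists g2; [split=> //|by []].
    have -> : g2 = g1 *m (k1 *m a' *m k2).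
      by rewrite -E3 mulKVmx // (SLpoints_unit hg1).
    have [_ [kk1 _]] := hk1; have [_ [kk2 _]] := hk2.
    apply: (mxO_mul HO); first by apply: (mxO_orthogonal HO); rewrite -E1.
    apply: (mxO_mul HO); last exact: (mxO_orthogonal HO).
    apply: (mxO_mul HO); first exact: (mxO_orthogonal HO).
    have [hS' _] := ha'; apply: mxO_split => // i.
    (* N(a') bounds the simple characters at a', and a power of it bounds the coordinates. *)
    have [C hC] := coord_bound HS HP HDelta Hchar.
    have [N1 chiN] := chi_le_Nprod ha'.
    apply: (O_le HO (O_X HO C NO)); have [_ /(_ i)/ltW ->] := ha'.
    apply: (hC _ iF a' _ ha') => // d dD; rewrite a'd // chiN //.
    by case: HDelta => _ h _; exact: h.
  exfalso; apply: h; split.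
    by split=> //; rewrite (ApointsE HP HSg iR ord0).
  exists 1%:M, (k *m a), k, 1%:M; split=> //.
  - split=> //; apply: SLpointsM => //; case: ha => + _; move=> /(SLpoints_sub SG); exact.
  - by rewrite act1 trmx1 mulmx1.
  - by rewrite act1 -gE.
  - by split=> //; split=> //; split=> //; case: hk.
  - by rewrite invmx1 mul1mx mulmx1.
split; first by exists h; rewrite ?act1.
apply/dist_eq0; suff [ha aO] : pos_points P S iF (delta iF G Delta 1%:M (h *m h^T)) /\
    mxO O (delta iF G Delta 1%:M (h *m h^T)).
  by have [] := Nprod_units ha aO.
(* In this direction the default Id is harmless: it is a point of A with entries in O. *)
rewrite /delta; case: xgetP =>
  [a _ [[Aa ad] [g1 [g2 [k1 [k2 [[hg1 hg2] E1 E2 [hk1 hk2] E3]]]]]]|_]; last first.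
  split; first exact: pos_points1.
  by apply: (mxO_orthogonal HO); rewrite trmx1 mulmx1.
have ha : pos_points P S iF a by move: Aa; rewrite (ApointsE HP HSg iR ord0).
rewrite !act1 in E1 E2; split=> //.
have [_ [kk1 _]] := hk1; have [_ [kk2 _]] := hk2.
have -> : a = k1^T *m (g1^T *m g2) *m k2^T.
  have g1V : g1^T = invmx g1 by rewrite -[LHS](mulKmx (SLpoints_unit hg1)) -E1 mulmx1.
  by rewrite g1V E3 !mulmxA (mulmx1C kk1) mul1mx -mulmxA kk2 mulmx1.
apply: (mxO_mul HO); last by apply: mxO_tr; exact: (mxO_orthogonal HO).
apply: (mxO_mul HO); first by apply: mxO_tr; exact: (mxO_orthogonal HO).
apply: (mxO_mul HO); first by apply: mxO_tr; apply: (mxO_orthogonal HO); rewrite -E1.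
exact: (mxO_gram HO (esym E2) hO).
Qed.

Variables (u a : 'M[F]_n.+1).
Hypotheses (Hu : Upoints iF G Delta u) (Ha : pos_points P S iF a).

Lemma apartment_fixed b : pos_points P S iF b ->
  bact b o = bact (u *m a) o -> bact (u *m a) o = bact a o.
Proof.
move=> Hb e; rewrite -e.
have [bS _] := Hb; have [aS _] := Ha; have bu := SLpoints_unit bS.
have actE (g h : 'M[F]_n.+1) : Defs.act g (h *m h^T) = (g *m h) *m (g *m h)^T.
  by rewrite /Defs.act trmx_mul !mulmxA.
pose c := invmx b *m a.
have cS : SLpoints iF S c by apply: SLpointsM => //; exact: SLpointsV.
have cG : SLpoints iF G c by exact: (SLpoints_sub SG).
(* This point of ua.o is the image of Id; read in b.o, it makes the Gram matrix of b^-1 u a equal to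
   some h h^T with h over O. *)
have : bact (u *m a) o ((u *m a) *m (u *m a)^T).
  exists 1%:M; last by rewrite /Defs.act mulmx1.
  apply/base_pointP; exists 1%:M; last by rewrite trmx1 mulmx1.
  split; first exact: SLpoints1.
  by apply: (mxO_orthogonal HO); rewrite trmx1 mulmx1.
rewrite -e => -[_ /base_pointP[h [hG hO] ->]]; rewrite actE => hE.
have gO : mxO O (invmx b *m (u *m a)).
  apply: (mxO_gram HO _ hO); rewrite trmx_mul mulmxA -[_ *m (u *m a) *m _]mulmxA -hE.
  by rewrite !trmx_mul !mulmxA mulVmx // mul1mx -!mulmxA -trmx_mul mulVmx // trmx1 mulmx1.
have cO : mxO O c.
  have dE (L : rcfType) (f : {rmorphism K -> L}) (s : 'M[L]_n.+1) : SLpoints f S s ->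
      exists x, diag_coord P f s = diag_mx x.
    move=> hs; exists (\row_i diag_coord P f s i i).
    by rewrite {1}(split_dconj HP hs) (diag_coord_dconj HP).
  have bVS : SLpoints iF S (invmx b) by exact: SLpointsV.
  (* b^-1 and a are diagonal in these coordinates, so the diagonal of b^-1 u a only sees that of u,
     which is 1. *)
  have di i : diag_coord P iF c i i = diag_coord P iF (invmx b *m (u *m a)) i i.
    rewrite !(diag_coordM HP); have [x ->] := dE _ _ _ bVS; have [y ->] := dE _ _ _ aS.
    have := Upoints_diag HSg HP HDelta Hu i; set U := diag_coord P iF u; clearbody U => Ui.
    by rewrite mulmx_diag mul_diag_mx mul_mx_diag !mxE eqxx mulr1n Ui mul1r.
  apply: mxO_split => // i; rewrite di.
  rewrite /diag_coord; apply: (mxO_mul HO); last exact: (mxO_map iR iF HO).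
  by apply: (mxO_mul HO) => //; exact: (mxO_map iR iF HO).
have cu := SLpoints_unit cG.
have cb : b *m c = a by rewrite /c mulKVmx.
have bc : a *m invmx c = b by rewrite -cb mulmxK.
have VO : mxO O (invmx c) by apply: (mxO_inv HO) => //; case: cG.
(* Since b c = a, a matrix k over O for one side is replaced by c^-1 k or c k for the other, again
   over O. *)
apply/seteqP; split=> _ [_ /base_pointP[k [kG kO] ->] <-]; rewrite actE.
  exists ((invmx c *m k) *m (invmx c *m k)^T); last by rewrite actE mulmxA bc.
  apply/base_pointP; exists (invmx c *m k) => //; split; last exact: (mxO_mul HO).
  by apply: SLpointsM => //; exact: SLpointsV.
exists ((c *m k) *m (c *m k)^T); last by rewrite actE mulmxA cb.
apply/base_pointP; exists (c *m k) => //; split; last exact: (mxO_mul HO).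
exact: SLpointsM.
Qed.

End BasePoint.

Theorem proposition5p7
  (R : realType) (K F : rcfType)
  (iR : {rmorphism K -> R}) (iF : {rmorphism K -> F})
  (O : {pred F}) (HO : order_convex_subring O) (HOF : exists x, x \notin O)
  (n : nat)
  (G : seq (mxpoly[K]_n)) (HG : algebraic_group G)
  (Gconn : zariski_connected (geom_points G))
  (Gss : semisimple G) (Gadj : self_adjoint G)
  (S : seq (mxpoly[K]_n)) (HS : maximal_split_torus G S)
  (Ssym : forall s, geom_points S s -> s = s^T)
  (Delta : seq 'Hom(subvs_of (lieA iR S), R^o))
  (HDelta : root_basis G Delta)
  (u a : 'M[F]_n)
  (Hu : Upoints iF G Delta u) (Ha : Apoints iF S a) :
  let o := base_point iF O G Delta in
  apartment iF O G Delta (bact (u *m a) o) <->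
  bact (u *m a) o = bact a o.
Proof.
move=> o; split=> [[b Hb e]|->]; last by exists a.
(* Size 0 is set apart, where all matrices are equal; the lemmas above are stated in size n.+1. *)
case: n G HG Gconn Gss Gadj S HS Ssym Delta HDelta u a Hu Ha @o b Hb e
    => [|m] {}G {}HG _ _ {}Gadj {}S {}HS {}Ssym {}Delta {}HDelta {}u {}a {}Hu {}Ha /= b Hb e.
  by congr bact; rewrite [LHS]flatmx0 [RHS]flatmx0.
have [[HSg _ [P Pu Pd]] _ _] := HS.
have HP : split_by P S by [].
have [Hchar|] := pselect (forall alpha, Defs.roots iR G S alpha -> has_root_char alpha).
  rewrite !(ApointsE HP HSg iR ord0) in Ha Hb.
  exact: (apartment_fixed HO HG Gadj HS HP Ssym HDelta Hchar Hu Ha Hb e).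
(* If some root has no character, the base point is the empty set and so are both of its
   translates. *)
move/existsNP => [alpha /not_implyP[ha hn]].
by rewrite /bact (base_point_empty iF HO HS HP Delta ha hn) !image_set0.
Qed.
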